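(* Let $1\le r<n$ be integers. With $\mathcal O_n$, $\mathcal L_n$, $\mathcal H_n$ as defined in the context, we have: (1) $\mathcal H_n\le\mathcal L_n\le\mathcal O_n$ (as subgroups); (2) there are elements of $\mathcal O_n$ which are not in $\mathcal L_n$; (3) there are elements of $\mathcal L_n$ which are not in $\mathcal H_n$; (4) for $n>2$ there are elements of $\mathcal H_n$ of infinite order; (5) there are non-bi-Lipschitz torsion elements of $\mathcal O_2$, i.e. elements of finite order in $\mathcal O_2$ which are not in $\mathcal L_2$; and (6) there are elements of $\mathcal L_2$ of infinite order.
   Context: Spaces. $X_n=\{0,\dots,n-1\}$; $\dot{\mathbf r}$ is a set of $r$ symbols disjoint from $X_n$ (''dotted letters''); $\mathfrak C_n=X_n^\omega$ and $\mathfrak C_{n,r}=\{ca_1a_2\ldots: c\in\dot{\mathbf r},a_i\in X_n\}$ with product topologies and the standard metric $d(x,y)=2^{-\ell}$, $\ell$ the length of the longest common prefix of $x\ne y$; $\varepsilon$ is the empty word; $W_{n,r,\varepsilon}$ is the set of finite words $ca_1\ldots a_k$, $k\ge0$, $c\in\dot{\mathbf r}$, $a_i\in X_n$; $U_\eta$ is the set of infinite sequences with prefix $\eta$. Transducers for $\mathfrak C_{n,r}$. $A_{q_0}=(\dot{\mathbf r},X_n,R,S,\pi,\lambda,q_0)$ with state set $Q=R\sqcup S$ ($R$ finite, $S$ at most countable), $q_0\in R$, and $\pi(x,q)\in Q\setminus\{q_0\}$, $\lambda(x,q)$ a finite word, defined for $x\in\dot{\mathbf r}$ if $q=q_0$ and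 for $x\in X_n$ if $q\neq q_0$, such that: (1) $\pi(x,q)\in R$ implies $q\in R$, $\lambda(x,q)=\varepsilon$; (2) $q\in R$, $\pi(x,q)\in S$ implies $\lambda(x,q)\in W_{n,r,\varepsilon}$; (3) $q\in S$ implies $\pi(x,q)\in S$, $\lambda(x,q)\in X_n^*$; and with the extensions $\pi(\mu\nu,q)=\pi(\nu,\pi(\mu,q))$, $\lambda(\mu\nu,q)=\lambda(\mu,q)\lambda(\nu,\pi(\mu,q))$ (also to infinite inputs), (4) $\pi(w,q)=q$ with $w$ nonempty implies $\lambda(w,q)\neq\varepsilon$; (5) for $q\in S$ and $x\in \mathfrak C_n$, $\lambda(x,q)\in\mathfrak C_n$. Each state $q$ induces a map $h_q:x\mapsto\lambda(x,q)$, and $A_{q_0}$ represents $h_{q_0}:\mathfrak C_{n,r}\to\mathfrak C_{n,r}$. It is minimal if every state is $\pi(\nu,q_0)$ for some $\nu$, if for every nonempty valid input word $\nu$ the word $\lambda(\nu,q_0)$ is the longest common prefix of $U_\nu h_{q_0}$, and if distinct states in $Q\setminus\{q_0\}$ induce distinct maps. Each homeomorphism $h$ representable by a finite transducer has a minimal one $A_h$, unique up to isomorphism. A transducer over $X_n$ (without initial state) is $T=\langle X_n,Q,\pi,\lambda\rangle$ with $\pi:X_n\times Q\to Q$, $\lambda:X_n\times Q\to X_n^*$, such that infinite inputs yield infinite outputs; $h_q:\mathfrak C_n\to\mathfrak C_n$ is the map induced by the state $q$. Transducers over $X_n$ are identified when strongly isomorphic (a bijection of states commuting with $\pi$ and $\lambda$).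 Synchronization and core. A transducer is strongly synchronizing if for some $m$, for every valid input word $w$ of length $m$, $\pi(w,q)$ takes the same value $\mathfrak s(w)$ for all states $q$ from which $w$ can be read (words with a dotted first letter are read only from $q_0$, words over $X_n$ from every state other than $q_0$). Its core, $\operatorname{Core}(A)$, is the transducer over $X_n$ obtained by restricting $\pi,\lambda$ to the set of states $\{\mathfrak s(w): w\in X_n^m\}$ (this does not depend on $m$). $\mathcal B_{n,r}$ is the group of homeomorphisms $h$ of $\mathfrak C_{n,r}$ such that $h$ and $h^{-1}$ are both representable by finite strongly synchronizing transducers. Groups. $\mathcal O_{n,r}=\{\operatorname{Core}(A_g): g\in\mathcal B_{n,r}\}$ and $\mathcal O_n=\bigcup_{1\le r<n}\mathcal O_{n,r}$, which is a group under the following product $T_1T_2$. (a) Form the full product $T_1*T_2$ with states $Q_{T_1}\times Q_{T_2}$, $\pi(x,(p,q))=(\pi_{1}(x,p),\pi_{2}(\lambda_{1}(x,p),q))$, $\lambda(x,(p,q))=\lambda_{2}(\lambda_{1}(x,p),q)$. (b) Remove incomplete response: writing $e_s$ for the longest common prefix of the image of $h_s$, replace each output $\lambda(x,s)$ by the word obtained from $\lambda(x,s)e_{\pi(x,s)}$ by deleting its prefix $e_s$. (c) Pass to the core. (d) Identify states inducing equal maps on $\mathfrak C_n$. $\mathcal L_n$ is the set of those $T\in\mathcal O_n$ of the form $\operatorname{Core}(A_g)$ for some $1\le r<n$ and some bi-Lipschitz $g\in\mathcal B_{n,r}$. $\mathcal H_n$ is the set of those $T\in\mathcal O_n$ which are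 synchronous (every output $\lambda(x,q)$, $x\in X_n$, has length exactly one) and which have a homeomorphism state, i.e. a state $q$ such that $h_q:\mathfrak C_n\to\mathfrak C_n$ is a homeomorphism. *)

(* Defs.v *)
From mathcomp Require Import all_boot all_order all_algebra.
From mathcomp Require Import all_classical all_reals topology.

Set Implicit Arguments.
Unset Strict Implicit.
Unset Printing Implicit Defensive.

Local Open Scope classical_set_scope.

(** * Spaces *)

(* The Cantor space X_n^omega with the product of the discrete topologies. *)
Definition cantor (n : nat) : Type := {ptws nat -> discrete_topology 'I_n}.

(* A point c a_1 a_2 ... of C_{n,r} is the pair of its dotted letter c and of
   its tail a_1 a_2 ... *)
Definition cantorR (n r : nat) : Type :=
  (discrete_topology 'I_r * cantor n)%type.

(* [inl c] is a dotted letter and [inr a] a letter of X_n; the disjoint union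
   is the alphabet in which transducers for C_{n,r} write. *)
Definition letter (n r : nat) : Type := ('I_r + 'I_n)%type.

Definition letters n r (z : cantorR n r) : nat -> letter n r :=
  fun k => if k is j.+1 then inr (z.2 j) else inl z.1.

Definition dotted_word n r (w : seq (letter n r)) : Prop :=
  exists c, exists v : seq 'I_n, w = inl c :: map inr v.

Definition plain_word n r (w : seq (letter n r)) : Prop :=
  exists v : seq 'I_n, w = map inr v.

(* The set U_{cw}. *)
Definition cylinder n r (c : 'I_r) (w : seq 'I_n) : set (cantorR n r) :=
  [set z | z.1 = c /\ mkseq z.2 (size w) = w].

Section InfiniteWords.
Context {T : eqType}.

(* [w] is the longest common prefix of the infinite words in [A]. *)
Definition is_lcp (A : set (nat -> T)) (w : seq T) : Prop :=
  (forall u, A u -> mkseq u (size w) = w) /\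
  (forall v, (forall u, A u -> mkseq u (size v) = v) -> prefix v w).

(* The length of the longest common prefix of [u] and [v], when they differ. *)
Definition lcp_length (u v : nat -> T) : nat :=
  xget 0%N [set l | mkseq u l = mkseq v l /\ u l <> v l].

(* The infinite word having all the [f k] as prefixes, when [f] is increasing
   for the prefix order and [size (f k)] is unbounded; the default letter [d]
   is used only when the sizes are bounded. *)
Definition limit_word (d : T) (f : nat -> seq T) : nat -> T :=
  fun i => nth d (f (xget 0%N [set k | (i < size (f k))%N])) i.

End InfiniteWords.

Definition dist (R : realType) n r (y z : cantorR n r) : R :=
  (if `[< y = z >] then 0 else 2 ^- lcp_length (letters y) (letters z))%R.

Definition homeomorphism (S T : topologicalType) (f : S -> T) : Prop :=
  continuous f /\
  exists g : T -> S, [/\ cancel f g, cancel g f & continuous g].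

Definition bi_lipschitz (R : realType) n r (g : cantorR n r -> cantorR n r) :
    Prop :=
  (exists2 C : R, 0 < C &
    forall y z, C^-1 * dist R y z <= dist R (g y) (g z) <= C * dist R y z)%R.

(** * Transducers over X_n *)

(* The requirement that infinite inputs give infinite outputs is not part of
   the record: it holds for all the transducers in the set [grpO] below, by
   the last clause of [well_formed] for the transducers having them as cores. *)
Record transducer (n : nat) := Transducer {
  state :> Type;
  trans : 'I_n -> state -> state;
  output : 'I_n -> state -> seq 'I_n }.

Section Transducers.
Context {n : nat}.
Implicit Types (T : transducer n).

Definition trans_word T (w : seq 'I_n) (q : T) : T :=
  foldl (fun p x => trans x p) q w.

Fixpoint output_word T (w : seq 'I_n) (q : T) : seq 'I_n :=
  if w is x :: v then output x q ++ output_word v (trans x q) else [::].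

Definition state_map T (q : T) (x : cantor n) : cantor n :=
  limit_word (x 0%N) (fun k => output_word (mkseq x k) q).

Definition strong_iso (T1 T2 : transducer n) : Prop :=
  exists f : T1 -> T2, [/\ bijective f,
    forall x q, f (trans x q) = trans x (f q)
  & forall x q, output x (f q) = output x q].

Definition sync_at T (m : nat) : Prop :=
  forall w, size w = m -> forall p q : T, trans_word w p = trans_word w q.

Definition strongly_synchronizing T : Prop := exists m, sync_at T m.

Definition core_state T (q : T) : Prop :=
  exists2 m, sync_at T m &
  exists2 w, size w = m & forall p : T, trans_word w p = q.

Lemma core_state_trans T x (q : T) : core_state q -> core_state (trans x q).
Proof.
move=> [m sm [w sw wq]]; exists m.+1.
  by case=> [|y v] // [sv] p p'; apply: (sm v sv).
exists (rcons w x); first by rewrite size_rcons sw.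
by move=> p; rewrite /trans_word -cats1 foldl_cat /= -/(trans_word w p) wq.
Qed.

(* Meaningful when [T] is strongly synchronizing. *)
Definition core T : transducer n :=
  @Transducer n {q : T | core_state q}
    (fun x q => exist _ (trans x (sval q)) (core_state_trans x (svalP q)))
    (fun x q => output x (sval q)).

Definition full_product (T1 T2 : transducer n) : transducer n :=
  @Transducer n (T1 * T2)%type
    (fun x s => (trans x s.1, trans_word (output x s.1) s.2))
    (fun x s => output_word (output x s.1) s.2).

(* The word e_s; it exists as soon as [state_map s] is not constant. *)
Definition common_output T (s : T) : seq 'I_n :=
  xget [::] [set w | is_lcp (range (state_map s)) w].

Definition remove_incomplete T : transducer n :=
  @Transducer n T (@trans n T)
    (fun x s => drop (size (common_output s))
                     (output x s ++ common_output (trans x s))).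

Definition same_map T (q p : T) : Prop := state_map p = state_map q.

(* States inducing equal maps are identified: the new states are the classes
   of old ones, on which the operations are computed through representatives.
   In a transducer without incomplete response, in which the state maps are
   not constant, the result does not depend on the representatives. *)
Definition identify_states T : transducer n :=
  let rep (C : {C : T -> Prop | exists q, C = same_map q}) :=
    sval (cid (svalP C)) in
  @Transducer n {C : T -> Prop | exists q, C = same_map q}
    (fun x C => exist _ (same_map (trans x (rep C))) (ex_intro _ _ erefl))
    (fun x C => output x (rep C)).

Definition mulT (T1 T2 : transducer n) : transducer n :=
  identify_states (core (remove_incomplete (full_product T1 T2))).

(* T^k, for k > 0. *)
Definition powT T (k : nat) : transducer n := iter k.-1 (mulT T) T.

End Transducers.

(** * Transducers for C_{n,r} *)

(* The state set Q is [option rstate], [None] being the initial state q_0: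
   no transition leads to q_0 and it reads exactly the dotted letters, hence
   the separate fields [init_trans] and [init_output].  The set R consists of
   q_0 and of the states satisfying [inR], and S of the other states. *)
Record rtransducer (n r : nat) := RTransducer {
  rstate :> Type;
  inR : set rstate;
  init_trans : 'I_r -> rstate;
  init_output : 'I_r -> seq (letter n r);
  rtrans : 'I_n -> rstate -> rstate;
  routput : 'I_n -> rstate -> seq (letter n r) }.

Section RTransducers.
Context {n r : nat}.
Implicit Types (A : rtransducer n r).

Definition rtrans_word A (w : seq 'I_n) (q : A) : A :=
  foldl (fun p x => rtrans x p) q w.

Fixpoint routput_word A (w : seq 'I_n) (q : A) : seq (letter n r) :=
  if w is x :: v then routput x q ++ routput_word v (rtrans x q) else [::].

(* The map h_q induced by a state q other than q_0; its values are infinite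
   words in both kinds of letters, as q may belong to R. *)
Definition rstate_map A (q : A) (x : cantor n) : nat -> letter n r :=
  limit_word (inr (x 0%N)) (fun k => routput_word (mkseq x k) q).

Definition init_trans_word A (c : 'I_r) (w : seq 'I_n) : A :=
  rtrans_word w (init_trans A c).

Definition init_output_word A (c : 'I_r) (w : seq 'I_n) : seq (letter n r) :=
  init_output A c ++ routput_word w (init_trans A c).

(* The map induced by q_0. *)
Definition init_map A (z : cantorR n r) : nat -> letter n r :=
  limit_word (inl z.1) (fun k => init_output_word A z.1 (mkseq z.2 k)).

Definition represents A (h : cantorR n r -> cantorR n r) : Prop :=
  forall z, init_map A z = letters (h z).

Definition well_formed A : Prop :=
  (finite_set (@inR n r A) /\ countable (~` @inR n r A)) /\
  [/\ (forall c, inR (init_trans A c) -> init_output A c = [::]) /\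
      (forall x (q : A), inR (rtrans x q) -> inR q /\ routput x q = [::]),
      (forall c, ~ inR (init_trans A c) -> dotted_word (init_output A c)) /\
      (forall x (q : A),
         inR q -> ~ inR (rtrans x q) -> dotted_word (routput x q)),
      forall x (q : A),
        ~ inR q -> ~ inR (rtrans x q) /\ plain_word (routput x q),
      forall w (q : A),
        w <> [::] -> rtrans_word w q = q -> routput_word w q <> [::]
    & forall (q : A) (x : cantor n), ~ inR q ->
        forall i, exists k, (i < size (routput_word (mkseq x k) q))%N].

Definition finite_transducer A : Prop := finite_set [set: A].

Definition minimal A : Prop :=
  [/\ well_formed A,
      forall q : A, exists c w, init_trans_word A c w = q,
      forall c w, is_lcp (init_map A @` cylinder c w) (init_output_word A c w)
    & forall p q : A, rstate_map p = rstate_map q -> p = q].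

Definition drop_dotted (w : seq (letter n r)) : seq 'I_n :=
  pmap (fun l : letter n r => if l is inr a then Some a else None) w.

(* The transducer over X_n formed by the states other than q_0.  The dotted
   letters are forgotten, which only affects outputs at states of R.  None of
   them is in the core: by [well_formed] a cycle through a state of R stays in
   R, hence has an empty output, which is excluded. *)
Definition body A : transducer n :=
  @Transducer n A (@rtrans n r A) (fun x q => drop_dotted (routput x q)).

Definition finite_sync_representable (h : cantorR n r -> cantorR n r) : Prop :=
  exists A, [/\ well_formed A, finite_transducer A,
                strongly_synchronizing (body A) & represents A h].

End RTransducers.

(** * Groups *)

Definition grpB n r (g : cantorR n r -> cantorR n r) : Prop :=
  homeomorphism g /\
  exists g', [/\ cancel g g', cancel g' g,
                 finite_sync_representable g & finite_sync_representable g'].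

(* [T] is Core(A_g), up to strong isomorphism. *)
Definition is_core_of n r (g : cantorR n r -> cantorR n r) (T : transducer n) :
    Prop :=
  exists A : rtransducer n r,
    [/\ minimal A, represents A g & strong_iso (core (body A)) T].

(* O_{n,r}, O_n, L_n and H_n, as sets of transducers that are closed under
   strong isomorphism. *)
Definition grpOr (n r : nat) : set (transducer n) :=
  [set T | exists2 g : cantorR n r -> cantorR n r, grpB g & is_core_of g T].

Definition grpO (n : nat) : set (transducer n) :=
  [set T | exists2 r, (1 <= r < n)%N & grpOr r T].

Definition grpL (R : realType) (n : nat) : set (transducer n) :=
  [set T | grpO T /\ exists2 r, (1 <= r < n)%N &
     exists g : cantorR n r -> cantorR n r,
       [/\ grpB g, bi_lipschitz R g & is_core_of g T]].

Definition grpH (n : nat) : set (transducer n) :=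
  [set T | [/\ grpO T,
               forall x (q : T), size (output x q) = 1%N
             & exists q : T, homeomorphism (state_map q)]].

Section GroupTheory.
Context {n : nat}.
Implicit Types (G H : set (transducer n)) (T E : transducer n).

Definition is_identity G E : Prop :=
  G E /\ forall T, G T -> strong_iso (mulT E T) T /\ strong_iso (mulT T E) T.

(* [H] is a subgroup of the group [G] (with product [mulT], and strong
   isomorphism as equality). *)
Definition subgroup H G : Prop :=
  [/\ H `<=` G,
      exists2 E, is_identity G E & H E,
      forall T1 T2, H T1 -> H T2 -> H (mulT T1 T2)
    & forall T, H T -> exists2 T', H T' &
        is_identity G (mulT T T') /\ is_identity G (mulT T' T)].

Definition finite_order G T : Prop :=
  exists2 k, (0 < k)%N & is_identity G (powT T k).

End GroupTheory.

Arguments grpO n : clear implicits.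
Arguments grpL R n : clear implicits.
Arguments grpH n : clear implicits.

(* Main.v *)
(* An element of O_n is determined by the set of its state maps, which are the
   local actions of the homeomorphism g at all long enough words: writing
   g(u x) = mu_u F_u(x), with mu_u the longest common prefix of the image of the
   cone of u, strong synchronization means that F_u depends only on the last m
   letters of u.  This replaces transducers by maps of infinite words: the
   product of O_n is the composition of homeomorphisms, with local actions
   F2 o F1 up to a prefix.  The number of dotted letters can be taken to be n - 1
   for all of O_n, as n - 1 copies of C_{n,r} make up C_{n,n-1}; hence products,
   identity and inverses can be computed in one group of homeomorphisms.

   L_n is the set of the T in O_n for which the lengths of the input and of the
   output differ by a bounded amount, and H_n the set of those in which every
   state permutes the letters; equivalently, g is bi-Lipschitz, resp. acts on
   small cones as a bijective isometry followed by a change of prefix.  Both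
   conditions on g are stable under composition and inversion.

   Examples, on C_{n,1}.  Exchanging the blocks 1 and 10 in the factorization of
   words into blocks 1 0^k is an involution which doubles the length of 11...1.
   Two involutions with anticipation move an isolated 1 among zeros to the right
   and fix 111, so that no power of their product is trivial on germs.  For n > 2,
   exchanging 0 and 1 after each 2, then 1 and 2 after each 0, moves the last
   letter of 2111... other than 1 by two places. *)
Require Import Defs.
From mathcomp Require Import all_boot all_order all_algebra zify.
From mathcomp Require Import all_classical all_reals topology.

Set Implicit Arguments.
Unset Strict Implicit.
Unset Printing Implicit Defensive.

Local Open Scope classical_set_scope.
Local Open Scope nat_scope.

(** * Infinite words *)

(** Everything rests on one normal form. Call a map reduced when its values do not all begin with
    the same letter; then a decomposition of a map into a prefix and a reduced map is unique. Hence
    a transducer with reduced, pairwise distinct state maps can be rebuilt from the set of these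
    maps, outputs and transitions included, and [core_spec] records only that set. For the identity
    this set is {id}, whatever the number of dotted letters. The obstacle in the product is that a
    state may write nothing for a while, so that a word that synchronizes the first factor may give
    the second one nothing to read. Compactness removes it: the maps are uniformly continuous, so
    that enough letters read force any wanted number of letters written, independently of what came
    before. The same argument for the inverse map bounds how long a state can hide the first
    difference of two inputs, which turns bi-Lipschitz elements into transducers of bounded delay.
    Infinite order is proved by following two points of one small cone: if a power were trivial,
    both would undergo the same change of prefix. *)

Section Streams.
Context {T : Type}.
Implicit Types (x y u : nat -> T) (v w : seq T).

(** The default of [nth] is the letter of [x] at the shifted place, so that one formula covers both
    ranges and no letter of [T] has to be chosen. *)
Definition cats w x : nat -> T := fun i => nth (x (i - size w)) w i.
Definition drops k x : nat -> T := fun i => x (k + i).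

Lemma cats_nil x : cats [::] x = x.
Proof. by apply: funext => i; rewrite /cats nth_nil subn0. Qed.

Lemma cats_cat v w x : cats (v ++ w) x = cats v (cats w x).
Proof.
apply: funext => i; rewrite /cats nth_cat size_cat subnDA.
case: ltnP => h; last by rewrite [RHS]nth_default.
exact: set_nth_default.
Qed.

Lemma cats_lt w x d i : i < size w -> cats w x i = nth d w i.
Proof. by move=> h; apply: set_nth_default. Qed.

Lemma cats_add w x i : cats w x (size w + i) = x i.
Proof. by rewrite /cats nth_default ?leq_addr// addKn. Qed.

Lemma cats_size w x : cats w x (size w) = x 0.
Proof. by rewrite -{1}(addn0 (size w)) cats_add. Qed.

Lemma cats_ge w x i : size w <= i -> cats w x i = x (i - size w).
Proof. by move=> h; rewrite /cats nth_default. Qed.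

Lemma drops_cats w x : drops (size w) (cats w x) = x.
Proof. by apply: funext => i; rewrite /drops cats_add. Qed.

Lemma cats_inj w : injective (cats w).
Proof. by move=> x y e; rewrite -(drops_cats w x) e drops_cats. Qed.

Lemma cats_mkseq_drops k x : cats (mkseq x k) (drops k x) = x.
Proof.
apply: funext => i; have [h|h] := ltnP i k.
  by rewrite (cats_lt _ (x 0)) ?size_mkseq// nth_mkseq.
by rewrite cats_ge size_mkseq// /drops subnKC.
Qed.

Lemma mkseq_cats w x k : mkseq (cats w x) (size w + k) = w ++ mkseq x k.
Proof.
apply: (@eq_from_nth _ (x 0)); first by rewrite size_cat !size_mkseq.
move=> i; rewrite size_mkseq => h; rewrite nth_mkseq// nth_cat.
case: ltnP => h'; first exact: cats_lt.
by rewrite cats_ge// nth_mkseq// ltn_subLR.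
Qed.

Lemma mkseq_cats_size w x : mkseq (cats w x) (size w) = w.
Proof. by rewrite -(addn0 (size w)) mkseq_cats /mkseq /= cats0. Qed.

Lemma mkseqD x k l : mkseq x (k + l) = mkseq x k ++ mkseq (drops k x) l.
Proof.
by have := mkseq_cats (mkseq x k) (drops k x) l; rewrite size_mkseq cats_mkseq_drops.
Qed.

Lemma prefix_split w x : mkseq x (size w) = w -> x = cats w (drops (size w) x).
Proof. by move=> e; rewrite -{1}e cats_mkseq_drops. Qed.

Lemma cats_take k w x : mkseq (cats w x) k = take k w \/ size w < k.
Proof.
have [h|h] := leqP k (size w); [left | by right].
have := mkseq_cats_size (take k w) (cats (drop k w) x).
by rewrite -cats_cat cat_take_drop size_takel.
Qed.

Lemma cats_eq_split v w x y : size v <= size w -> cats v x = cats w y ->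
  w = v ++ drop (size v) w /\ x = cats (drop (size v) w) y.
Proof.
move=> h e; have ev : take (size v) w = v.
  have := mkseq_cats_size v x; rewrite e; case: (cats_take (size v) w y) => [->//|].
  by rewrite ltnNge h.
have ew : w = v ++ drop (size v) w by rewrite -{1}(cat_take_drop (size v) w) ev.
by split=> //; apply: (@cats_inj v); rewrite e {1}ew cats_cat.
Qed.

Definition agree k x y := forall i, i < k -> x i = y i.

Lemma agreeW k l x y : k <= l -> agree l x y -> agree k x y.
Proof. by move=> h a i /leq_trans h'; apply: a; apply: h'. Qed.

Lemma agreeP k x y : agree k x y <-> mkseq x k = mkseq y k.
Proof.
split=> [h|e i h]; last by rewrite -(nth_mkseq (x 0) x h) e nth_mkseq.
apply: (@eq_from_nth _ (x 0)); rewrite !size_mkseq // => i h'.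
by rewrite !nth_mkseq // h.
Qed.

Lemma agree_cats k w x y : agree k x y -> agree (size w + k) (cats w x) (cats w y).
Proof. by move/agreeP => e; apply/agreeP; rewrite !mkseq_cats e. Qed.

Lemma agree_catsE k w x y : agree (size w + k) (cats w x) (cats w y) -> agree k x y.
Proof.
by move=> h i ik; have := h (size w + i); rewrite !cats_add; apply; rewrite ltn_add2l.
Qed.

Lemma agree_prefix w x y : agree (size w) (cats w x) (cats w y).
Proof. by apply/agreeP; rewrite !mkseq_cats_size. Qed.

Lemma agree_split k x y : agree k x y ->
  exists w, [/\ size w = k, x = cats w (drops k x) & y = cats w (drops k y)].
Proof.
move/agreeP => e; exists (mkseq x k); rewrite size_mkseq cats_mkseq_drops.
by split=> //; rewrite e cats_mkseq_drops.
Qed.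

Lemma agree_sym k x y : agree k x y -> agree k y x.
Proof. by move=> h i /h. Qed.

Lemma agree_trans k x y u : agree k x y -> agree k y u -> agree k x u.
Proof. by move=> h h' i ik; rewrite h// h'. Qed.

Lemma agree_all x y : (forall k, agree k x y) -> x = y.
Proof. by move=> h; apply: funext => i; apply: (h i.+1). Qed.

Lemma neq_diff x y : x <> y -> exists2 k, agree k x y & x k <> y k.
Proof.
move=> ne; have ex : exists k, `[< x k <> y k >].
  apply: contrapT => h; apply: ne; apply: funext => i; apply: contrapT => h'.
  by apply: h; exists i; apply/asboolP.
case: (ex_minnP ex) => k /asboolP xk min; exists k => // i ik.
apply: contrapT => h; have := min i; rewrite asboolT// => /(_ isT).
by rewrite leqNgt ik.
Qed.

Lemma mkseq_map (S : Type) (f : T -> S) x k :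
  mkseq (f \o x) k = map f (mkseq x k).
Proof. by rewrite /mkseq -map_comp. Qed.

End Streams.

Lemma comp_cats (S T : Type) (f : T -> S) w (x : nat -> T) :
  f \o cats w x = cats (map f w) (f \o x).
Proof.
apply: funext => i; rewrite /= /cats size_map.
have [h|h] := ltnP i (size w); first by rewrite (nth_map (x (i - size w))).
by rewrite !nth_default ?size_map.
Qed.

Section Prefixes.
Context {T : eqType}.
Implicit Types (u : nat -> T).

Lemma limit_word_eq (d : T) (f : nat -> seq T) u :
  (forall k, mkseq u (size (f k)) = f k) ->
  (forall i, exists k, i < size (f k)) -> limit_word d f = u.
Proof.
move=> pre inf; apply: funext => i; rewrite /limit_word.
case: xgetP => [k _ /= h|]; last by case: (inf i) => k h /(_ k).
by rewrite -(pre k) nth_mkseq.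
Qed.

Lemma limit_word_prefix (d : T) (f : nat -> seq T) :
  (forall i k, i <= k -> prefix (f i) (f k)) ->
  (forall i, exists k, i < size (f k)) ->
  forall k, mkseq (limit_word d f) (size (f k)) = f k.
Proof.
move=> mono inf k; apply: (@eq_from_nth _ d); rewrite size_mkseq // => i h.
rewrite nth_mkseq // /limit_word.
case: xgetP => [l _ /= h'|]; last by case: (inf i) => l h' /(_ l).
have key a b : i < size (f a) -> a <= b -> nth d (f a) i = nth d (f b) i.
  by move=> ha /mono /prefixP[s ->]; rewrite nth_cat ha.
by case: (leqP k l) => [hkl|/ltnW hkl]; [symmetry|]; apply: key.
Qed.

Lemma prefix_mkseq u k l : k <= l -> prefix (mkseq u k) (mkseq u l).
Proof. by move=> /subnKC <-; rewrite mkseqD prefix_prefix. Qed.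

Lemma prefix_of_stream u v w : mkseq u (size v) = v -> mkseq u (size w) = w ->
  size v <= size w -> prefix v w.
Proof. by move=> <- <-; rewrite !size_mkseq; apply: prefix_mkseq. Qed.

(** If all words of [A] had the same letter after [w], it could be appended to [w]; conversely, no
    longer common prefix survives two words that differ there. *)
Lemma is_lcpP (A : set (nat -> T)) w : A !=set0 ->
  is_lcp A w <-> (forall u, A u -> mkseq u (size w) = w) /\
                 (exists u v, [/\ A u, A v & u (size w) <> v (size w)]).
Proof.
move=> [u0 Au0]; split=> [[pre max]|[pre [u [v [Au Av ne]]]]]; split=> //.
  apply: contrapT => h.
  have : prefix (rcons w (u0 (size w))) w.
    apply: max => u Au; rewrite size_rcons mkseqS (pre u Au).
    congr rcons.
    by apply: contrapT => h'; apply: h; exists u, u0.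
  by move/size_prefix; rewrite size_rcons ltnn.
move=> s pres; have [h|h] := leqP (size s) (size w).
  by apply: (prefix_of_stream (pres u Au) (pre u Au) h).
have [] := ne; have : agree (size s) u v by apply/agreeP; rewrite !pres.
by apply.
Qed.

End Prefixes.

(** * Reduced maps, compactness and topology *)

Section Reduced.
Context {X T : Type}.
Implicit Types (F : X -> nat -> T) (w : seq T).

(** The counterpart, for state maps, of having no incomplete response: the longest common prefix of
    the image is empty. *)
Definition reduced F := exists x y, F x 0 <> F y 0.

Lemma reduce_ex F : (exists x y, F x <> F y) ->
  exists w F', (forall x, F x = cats w (F' x)) /\ reduced F'.
Proof.
move=> [x [y nxy]].
have ex : exists k, `[< exists x y, F x k <> F y k >].
  by case: (neq_diff nxy) => k _ ne; exists k; apply/asboolP; exists x, y.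
case: (ex_minnP ex) => k /asboolP[x' [y' ne]] min.
exists (mkseq (F x') k), (fun u => drops k (F u)); split; last first.
  by exists x', y'; rewrite /drops addn0.
move=> u; rewrite -{1}(cats_mkseq_drops k (F u)); congr cats.
apply/agreeP => i ik; apply: contrapT => h.
by have := min i; rewrite leqNgt ik asboolT//; [move=> /(_ isT)|exists u, x'].
Qed.

(** If [w] were shorter than [w'], all values of [F] would begin with the next letter of [w']. *)
Lemma reduced_factor F F' w w' : reduced F ->
  (forall x, cats w (F x) = cats w' (F' x)) ->
  w = w' ++ drop (size w') w /\ forall x, F' x = cats (drop (size w') w) (F x).
Proof.
move=> [x [y ne]] e.
have h : size w' <= size w.
  rewrite leqNgt; apply/negP => h; apply: ne.
  have [_ ->] := cats_eq_split (ltnW h) (e x).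
  have [_ ->] := cats_eq_split (ltnW h) (e y).
  have : 0 < size (drop (size w) w') by rewrite size_drop subn_gt0.
  by case: (drop _ _).
split=> [|u]; first by case: (cats_eq_split h (esym (e x))).
by case: (cats_eq_split h (esym (e u))).
Qed.

Lemma reduced_uniq F F' w w' : reduced F -> reduced F' ->
  (forall x, cats w (F x) = cats w' (F' x)) -> w = w' /\ F = F'.
Proof.
move=> rF rF' e.
have [e1 e2] := reduced_factor rF e.
have [e1' e2'] := reduced_factor rF' (fun x => esym (e x)).
have ew : w = w'.
  have s : size w = size w'.
    by apply/eqP; rewrite eqn_leq {1}e1' e1 !size_cat !leq_addr.
  by move: e1; rewrite -s drop_size cats0.
split=> //; apply: funext => x; apply: (@cats_inj _ w).
by rewrite e ew.
Qed.


End Reduced.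

Lemma is_lcp_image (X : Type) (T : eqType) (F : X -> nat -> T) A w : A !=set0 ->
  is_lcp (F @` A) w <->
  (forall x, A x -> mkseq (F x) (size w) = w) /\
  (exists x y, [/\ A x, A y & F x (size w) <> F y (size w)]).
Proof.
move=> [x0 Ax0]; rewrite is_lcpP; last by exists (F x0), x0.
split=> -[pre [u [v [Au Av ne]]]].
  case: Au ne => x Ax <-; case: Av => y Ay <- ne.
  by split; [move=> z Az; apply: pre; exists z | exists x, y].
split; first by move=> _ [z Az <-]; apply: pre.
exists (F u), (F v); split; [by exists u|by exists v|exact: ne].
Qed.

(** * Bounds over finitely many words, and Koenig's lemma *)

Section Finiteness.

Lemma fin_bound (I : finType) (P : I -> nat -> Prop) :
  (forall i k l, k <= l -> P i k -> P i l) ->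
  (forall i, exists k, P i k) -> exists K, forall i, P i K.
Proof.
move=> mono /choice[f Pf]; exists (\max_i f i) => i.
by apply: mono (Pf i); apply: leq_bigmax.
Qed.

Lemma word_bound n m (P : seq 'I_n -> nat -> Prop) :
  (forall w k l, k <= l -> P w k -> P w l) ->
  (forall w, size w = m -> exists k, P w k) ->
  exists K, forall w, size w = m -> P w K.
Proof.
move=> mono ex; have [K hK] : exists K, forall t : m.-tuple 'I_n, P t K.
  by apply: fin_bound => [i k l|t]; [apply: mono | apply: ex; rewrite size_tuple].
by exists K => w /eqP h; have := hK (Tuple h).
Qed.

Lemma koenig n (P : seq 'I_n -> Prop) :
  (forall w v, P (w ++ v) -> P w) -> (forall k, exists2 w, size w = k & P w) ->
  exists x : nat -> 'I_n, forall k, P (mkseq x k).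
Proof.
move=> clos long.
(* [Q w] says that the tree below [w] has words of every length. As the alphabet is finite, some
   child of [w] inherits this; the implication stands under the existential so that [choice] yields
   a total function. *)
pose Q w := forall k, exists2 v, size v = k & P (w ++ v).
have step w : exists a, Q w -> Q (rcons w a).
  apply: contrapT => h.
  have Qw : Q w.
    apply: contrapT => h'; case: (long 1) => -[|a s] // _ _.
    by apply: h; exists a.
  have {}h a : exists k, forall v, size v = k -> ~ P (rcons w a ++ v).
    apply: contrapT => h'; apply: h; exists a => _ k; apply: contrapT => h.
    by apply: h'; exists k => v sv Pv; apply: h; exists v.
  case: (@fin_bound _ (fun a k => forall v, size v = k -> ~ P (rcons w a ++ v))) => //.
    move=> a k l kl hk v sv; rewrite -(cat_take_drop k v) catA => /clos.
    by apply: hk; rewrite size_takel// sv.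
  move=> K hK; case: (Qw K.+1) => -[|a v] // [sv] Pv.
  by apply: (hK a v sv); rewrite cat_rcons.
have [f hf] := choice step.
pose s k := iter k (fun w => rcons w (f w)) [::].
have es k : mkseq (fun i => f (s i)) k = s k.
  by elim: k => // k IH; rewrite mkseqS IH.
exists (fun i => f (s i)) => k; rewrite es.
suff /(_ 0)[v _] : Q (s k) by apply: clos.
elim: k => [|k IH]; last exact: hf.
by move=> k; case: (long k) => w; exists w.
Qed.

End Finiteness.

(* [cantorR n r], [letters] and [state_map] are restated below with plain function
   types: the copies of ['I_n] with the discrete topology, which are convertible
   to ['I_n] but not syntactically equal to it, would get in the way of
   rewriting. *)
Definition pnt n r : Type := ('I_r * (nat -> 'I_n))%type.

Definition pletters n r (z : pnt n r) : nat -> letter n r :=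
  fun k => if k is j.+1 then inr (z.2 j) else inl z.1.

Section Points.
Context {n r : nat}.
Implicit Types (z : pnt n r).

Lemma plettersE z : @letters n r z = pletters z. Proof. by []. Qed.

Lemma pletters_pair c (x : nat -> 'I_n) :
  pletters ((c, x) : pnt n r) = cats [:: inl c] (inr \o x).
Proof. by apply: funext => -[|i] //; rewrite /cats /= subSS subn0; case: i. Qed.

Lemma pletters_cats c w (x : nat -> 'I_n) :
  pletters ((c, cats w x) : pnt n r) = cats (inl c :: map inr w) (inr \o x).
Proof. by rewrite pletters_pair comp_cats -cats_cat. Qed.

Lemma pletters_inj : injective (@pletters n r).
Proof.
move=> [c x] [d y] e; congr pair; first by have := congr1 (@^~ 0) e => -[].
by apply: funext => i; have := congr1 (@^~ i.+1) e => -[].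
Qed.

Lemma agree_plettersS k c d (x y : nat -> 'I_n) :
  agree k.+1 (pletters ((c, x) : pnt n r)) (pletters ((d, y) : pnt n r)) <->
  c = d /\ agree k x y.
Proof.
split=> [h|[-> h] [|i] // ik /=]; last by rewrite h.
split; first by have := h 0 isT => -[].
by move=> i ik; have := h i.+1 ik => -[].
Qed.

End Points.

(** * Continuity in terms of common prefixes *)

Definition pcont n r (g : pnt n r -> pnt n r) := forall z N, exists K, forall z',
  agree K (pletters z) (pletters z') -> agree N (pletters (g z)) (pletters (g z')).

Definition ucont n r (g : pnt n r -> pnt n r) := forall N, exists K, forall z z',
  agree K (pletters z) (pletters z') -> agree N (pletters (g z)) (pletters (g z')).

Section Topology.

Lemma nbhs_cantorP n (x : cantor n) (A : set (cantor n)) :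
  nbhs x A <-> exists K, forall y : cantor n, agree K (x : nat -> 'I_n) y -> A y.
Proof.
split=> [nA|[K hK]].
  (* The sets containing a cylinder around [x] form a filter that converges to [x] coordinatewise,
     hence in the product topology; so it contains every neighbourhood of [x]. *)
  pose F : set_system (cantor n) :=
    [set B | exists K, forall y, agree K (x : nat -> 'I_n) y -> B y].
  have FF : Filter F.
    split=> [|B C [K hK] [L hL]|B C BC [K hK]]; first by exists 0.
    - by exists (maxn K L) => y h; split; [apply: hK|apply: hL];
        apply: agreeW h; rewrite ?leq_maxl ?leq_maxr.
    - by exists K => y /hK /BC.
  suff : {ptws, F --> x} by move=> /(_ A nA).
  apply/(@pointwise_cvgP _ (discrete_topology 'I_n)) => i.
  apply/discrete_cvg; exists i.+1 => y h; exact: (esym (h i (ltnSn i))).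
have : nbhs x [set y : cantor n | agree K (x : nat -> 'I_n) y].
  elim: K {hK} => [|K IH]; first by apply: filterS filterT => y _ i.
  have : nbhs x [set y : cantor n | y K = x K].
    have := @proj_continuous nat (fun _ => discrete_topology 'I_n) K x.
    by move=> /(_ [set x K] (discrete_set1 _)).
  move/(filterI IH); apply: filterS => y [/= h e] i.
  by rewrite ltnS leq_eqVlt => /orP[/eqP->|/h//].
by apply: filterS => y /hK.
Qed.

Lemma nbhs_cantorRP n r (z : cantorR n r) (A : set (cantorR n r)) :
  nbhs z A <-> exists K, forall z' : pnt n r, agree K (pletters z) (pletters z') -> A z'.
Proof.
case: z => c x; split=> [[[B C] [/= nB nC] BC]|[K hK]].
  case/nbhs_cantorP: nC => K hK; exists K.+1 => -[d y] /agree_plettersS[e h].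
  by apply: BC; split=> /=; [rewrite -e; apply: nbhs_singleton nB | apply: hK].
exists ([set c], [set y : cantor n | agree K (x : nat -> 'I_n) y]).
  split=> /=; first exact: discrete_set1.
  by apply/nbhs_cantorP; exists K.
move=> [d y] [/= -> h]; apply: hK; apply: (agreeW (leqnSn K)).
exact/agree_plettersS.
Qed.

Lemma continuous_pcont n r (g : pnt n r -> pnt n r) :
  continuous (g : cantorR n r -> cantorR n r) <-> pcont g.
Proof.
split=> [cg z N|pg z A /= /nbhs_cantorRP[N hN]].
  have /cg : nbhs (g z : cantorR n r) [set z' | agree N (pletters (g z)) (pletters z')].
    by apply/nbhs_cantorRP; exists N.
  by move/nbhs_cantorRP.
by case: (pg z N) => K hK; apply/nbhs_cantorRP; exists K => z' /hK /hN.
Qed.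

Lemma continuous_cantor n (f : (nat -> 'I_n) -> nat -> 'I_n) :
  (forall x N, exists K, forall y, agree K x y -> agree N (f x) (f y)) ->
  continuous (f : cantor n -> cantor n).
Proof.
move=> pf x A /= /nbhs_cantorP[N hN].
by case: (pf x N) => K hK; apply/nbhs_cantorP; exists K => y /hK /hN.
Qed.

Lemma ucont_pcont n r (g : pnt n r -> pnt n r) : ucont g -> pcont g.
Proof. by move=> ug z N; case: (ug N) => K hK; exists K => z'; apply: hK. Qed.

(** Compactness through Koenig's lemma: for a fixed dotted letter, if no [K] served for [N], the
    words whose cone contains two points with images differing before place [N] would have an
    infinite branch, at which continuity fails. *)
Lemma pcont_ucont n r (g : pnt n r -> pnt n r) : pcont g -> ucont g.
Proof.
move=> pg N.
suff /fin_bound[|K hK] : forall c : 'I_r, exists K, forall x y : nat -> 'I_n,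
    agree K x y -> agree N (pletters (g (c, x))) (pletters (g (c, y))).
- by move=> c k l kl h x y /(agreeW kl) /h.
- by exists K.+1 => -[c x] [d y] /agree_plettersS[<-]; apply: hK.
move=> c.
pose bad w := exists x y : nat -> 'I_n,
  ~ agree N (pletters (g (c, cats w x))) (pletters (g (c, cats w y))).
apply: contrapT => h.
have [w v [x [y b]]|k|x hx] := @koenig n bad.
- by exists (cats v x), (cats v y); rewrite -!cats_cat.
- apply: contrapT => h'; apply: h; exists k => x y /agree_split[w [sw -> ->]].
  by apply: contrapT => b; apply: h'; exists w => //; exists (drops k x), (drops k y).
have [K hK] := pg (c, x) N.
case: (hx K) => y [y']; apply; have key u : agree K.+1 (pletters ((c, x) : pnt n r))
    (pletters ((c, cats (mkseq x K) u) : pnt n r)).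
  apply/agree_plettersS; split=> //; rewrite -{1}(cats_mkseq_drops K x).
  by rewrite -{1}(size_mkseq x K); apply: agree_prefix.
by apply: (agree_trans (agree_sym (hK _ _)) (hK _ _)); apply: agreeW (key _).
Qed.

End Topology.

(** * Local actions *)

Notation smap n := ((nat -> 'I_n) -> nat -> 'I_n).

Definition local_at n r (g : pnt n r -> pnt n r) c w d mu (F : smap n) :=
  forall x, g (c, cats w x) = (d, cats mu (F x)).

Definition local_sync n r (g : pnt n r -> pnt n r) := exists m, forall v,
  size v = m -> exists F, forall c w, exists d mu, local_at g c (w ++ v) d mu F.

(* The state maps of Core(A_g) are the maps F with [in_core g v F] for some v. *)
Definition in_core n r (g : pnt n r -> pnt n r) v F := reduced F /\
  forall c w, exists d mu, local_at g c (w ++ v) d mu F.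

Definition germs n r (g : pnt n r -> pnt n r) : set (smap n) :=
  [set F | exists v, in_core g v F].

(** The inverse is carried along because [grpB] requires synchronization on both sides;
    [grpB_bisync] proves the equivalence. *)
Definition bisync n r (g g' : pnt n r -> pnt n r) :=
  [/\ cancel g g', cancel g' g, ucont g & ucont g'] /\
  (local_sync g /\ local_sync g').

Lemma ord_neq n : 1 < n -> exists a b : 'I_n, a <> b.
Proof.
by case: n => [|[|n]] // _; exists ord0, ord_max => /(congr1 val).
Qed.

Section LocalActions.
Context {n r : nat} (n1 : 1 < n) (r0 : 0 < r).
Implicit Types (g : pnt n r -> pnt n r) (F : smap n) (u v w : seq 'I_n).

Lemma section_ex (T : Type) (F : (nat -> 'I_n) -> nat -> T) w : injective F ->
  exists (o : seq T) (F' : (nat -> 'I_n) -> nat -> T),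
    (forall x, F (cats w x) = cats o (F' x)) /\ reduced F'.
Proof.
move=> iF; apply: (@reduce_ex _ _ (fun x => F (cats w x))).
have [a [b ab]] := ord_neq n1.
exists (fun=> a), (fun=> b) => /iF /cats_inj /(congr1 (@^~ 0)) //.
Qed.

Lemma local_cat g c w d mu F v o F' : local_at g c w d mu F ->
  (forall x, F (cats v x) = cats o (F' x)) ->
  local_at g c (w ++ v) d (mu ++ o) F'.
Proof. by move=> l e x; rewrite cats_cat l e cats_cat. Qed.

Lemma local_uniq g c w d mu F d' mu' F' : local_at g c w d mu F ->
  local_at g c w d' mu' F' -> reduced F -> reduced F' ->
  [/\ d = d', mu = mu' & F = F'].
Proof.
move=> l l' rF rF'.
have e x : d = d' /\ cats mu (F x) = cats mu' (F' x).
  by have := l x; rewrite l' => -[-> ->].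
have [x _] := rF; have [dd _] := e x.
by have [] := reduced_uniq rF rF' (fun y => (e y).2).
Qed.

Lemma local_inj g c w d mu F : injective g -> local_at g c w d mu F -> injective F.
Proof.
move=> ig l x y e; have : g (c, cats w x) = g (c, cats w y) by rewrite !l e.
by move/ig => [/cats_inj].
Qed.

Lemma in_core_inj g v F : injective g -> in_core g v F -> injective F.
Proof.
by move=> ig [_ /(_ (Ordinal r0) [::])[d [mu l]]]; apply: local_inj ig l.
Qed.

Lemma germs_inj g F : injective g -> germs g F -> injective F.
Proof. by move=> ig [v]; apply: in_core_inj. Qed.

Lemma in_core_catl g u v F : in_core g v F -> in_core g (u ++ v) F.
Proof. by case=> rF l; split=> // c w; rewrite catA. Qed.

Lemma in_core_catr g v F w o F' : in_core g v F ->
  (forall x, F (cats w x) = cats o (F' x)) -> reduced F' -> in_core g (v ++ w) F'.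
Proof.
case=> _ l e rF'; split=> // c u; have [d [mu l']] := l c u.
by exists d, (mu ++ o); rewrite catA; apply: local_cat l' e.
Qed.

Lemma in_core_uniq g v F F' : in_core g v F -> in_core g v F' -> F = F'.
Proof.
move=> [rF l] [rF' l'].
have [d [mu h]] := l (Ordinal r0) [::]; have [d' [mu' h']] := l' (Ordinal r0) [::].
by have [] := local_uniq h h' rF rF'.
Qed.

(** The map given by [local_sync] need not be reduced: its common prefix is moved into [mu]. For a
    longer [v], only the last [m] letters are used. *)
Lemma local_sync_core g : injective g -> local_sync g ->
  exists m, forall v, m <= size v -> exists F, in_core g v F.
Proof.
move=> ig [m hm]; exists m => v mv.
have [F l] : exists F, forall c w, exists d mu, local_at g c (w ++ v) d mu F.
  have [|F l] := hm (drop (size v - m) v); first by rewrite size_drop subKn.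
  exists F => c w; rewrite -(cat_take_drop (size v - m) v) catA; exact: l.
have iF : injective F.
  by have [d [mu l']] := l (Ordinal r0) [::]; apply: local_inj ig l'.
have [o [F' [e rF']]] := section_ex [::] iF; exists F'; split=> // c w.
have [d [mu l']] := l c w; exists d, (mu ++ o).
by rewrite -(cats0 (w ++ v)); apply: local_cat l' e.
Qed.

Lemma core_local_sync g m : (forall v, size v = m -> exists F, in_core g v F) ->
  local_sync g.
Proof. by move=> h; exists m => v /h[F [_ l]]; exists F. Qed.

(** A long cone has a small image by uniform continuity, and since [F] is reduced, [mu] is the whole
    common prefix of that image. *)
Lemma local_long g : ucont g -> forall N, exists K, forall c w d mu F,
  K <= size w -> local_at g c w d mu F -> reduced F -> N <= size mu.
Proof.
move=> ug N; case: (ug N.+1) => K hK; exists K => c w d mu F kw l [x [y ne]].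
rewrite leqNgt; apply/negP => h.
have : agree N.+1 (pletters (g (c, cats w x))) (pletters (g (c, cats w y))).
  by apply: hK; rewrite !pletters_cats; apply: (agreeW _ (@agree_prefix _ _ _ _));
    rewrite /= size_map ltnW.
rewrite !l => /agree_plettersS[_] /(_ (size mu) h).
by rewrite !cats_size.
Qed.

Lemma core_mu_bound g m : (forall v, size v = m -> exists F, in_core g v F) ->
  exists M, forall v, size v = m -> exists F, in_core g v F /\
    forall c, exists d mu, local_at g c v d mu F /\ size mu <= M.
Proof.
move=> hm.
pose P v k := exists F, in_core g v F /\
    forall c, exists d mu, local_at g c v d mu F /\ size mu <= k.
have [w k l kl [F [h h']]|v sv|M hM] := @word_bound n m P; last by exists M.
  exists F; split=> // c; have [d [mu [h1 h2]]] := h' c.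
  by exists d, mu; split=> //; apply: leq_trans kl.
have [F hF] := hm v sv.
have [|c|K hK] := @fin_bound 'I_r
    (fun c k => exists d mu, local_at g c v d mu F /\ size mu <= k).
- move=> c k l kl [d [mu [h1 h2]]].
  by exists d, mu; split=> //; apply: leq_trans kl.
- by have [d [mu l]] := hF.2 c [::]; exists (size mu), d, mu.
by exists K, F.
Qed.

(** At least [N + M] letters are written on [v1 ++ v2], and at most [M] of them on [v1], so that at
    least [N] remain for [o]. The word [o] is determined by [v1] and [v2], whatever was read
    before. *)
Lemma out_long g : injective g -> ucont g -> local_sync g ->
  forall N, exists m K, forall v1 v2, size v1 = m -> size v2 = K ->
  exists F1 o F', [/\ in_core g v1 F1, forall x, F1 (cats v2 x) = cats o (F' x),
    reduced F' & N <= size o].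
Proof.
move=> ig ug lg N; have [m hm] := local_sync_core ig lg.
have [M hM] := @core_mu_bound g m (fun v e => hm v (eq_leq (esym e))).
have [K hK] := local_long ug (N + M).
exists m, K => v1 v2 s1 s2; have [F1 [c1 l1]] := hM v1 s1.
have [o [F' [e rF']]] := section_ex v2 (in_core_inj ig c1).
exists F1, o, F'; split=> //; have [d [mu [l sl]]] := l1 (Ordinal r0).
have := hK _ _ _ _ _ _ (local_cat l e) rF'.
rewrite !size_cat s2 leq_addl => /(_ isT) h; lia.
Qed.

(** The first [m] letters synchronize [g1]; the next [K] make it write a word [o] that no longer
    depends on the past and is long enough to synchronize [g2]. *)
Lemma local_sync_comp g1 g2 : injective g1 -> injective g2 -> ucont g1 ->
  local_sync g1 -> local_sync g2 -> local_sync (g2 \o g1).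
Proof.
move=> i1 i2 u1 l1 l2; have [m2 h2] := local_sync_core i2 l2.
have [m [K h]] := out_long i1 u1 l1 m2; exists (m + K) => v sv.
have [||F1 [o [F' [c1 e1 _ so]]]] := h (take m v) (drop m v).
- by rewrite size_takel// sv leq_addr.
- by rewrite size_drop sv addKn.
have [F2 [_ c2]] := h2 o so.
exists (fun x => F2 (F' x)) => c w; have [d [mu l]] := c1.2 c w.
have [d' [mu' l']] := c2 d mu; exists d', mu' => x.
by rewrite /= -(cat_take_drop m v) catA (local_cat l e1) l'.
Qed.

Lemma bisync_inj g g' : bisync g g' -> injective g.
Proof. by case=> -[/can_inj]. Qed.

Lemma bisync_sym g g' : bisync g g' -> bisync g' g.
Proof. by case=> -[? ? ? ?] [? ?]; split. Qed.

Lemma ucont_comp g1 g2 : ucont g1 -> ucont g2 -> ucont (g2 \o g1).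
Proof.
move=> u1 u2 N; have [K hK] := u2 N; have [L hL] := u1 K.
by exists L => z z' /hL /hK.
Qed.

Lemma bisync_comp g1 g1' g2 g2' : bisync g1 g1' -> bisync g2 g2' ->
  bisync (g2 \o g1) (g1' \o g2').
Proof.
move=> h1 h2; have [i1 i1'] := (bisync_inj h1, bisync_inj (bisync_sym h1)).
have [i2 i2'] := (bisync_inj h2, bisync_inj (bisync_sym h2)).
case: h1 => -[? ? ? ?] [? ?]; case: h2 => -[? ? ? ?] [? ?].
split; last by split; apply: local_sync_comp.
by split; [apply: can_comp|apply: can_comp|apply: ucont_comp|apply: ucont_comp].
Qed.

Lemma bisync_id : bisync (id : pnt n r -> pnt n r) id.
Proof.
split; first by split=> //; move=> N; exists N.
by split; exists 0 => v _; exists id => c w; exists c, (w ++ v).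
Qed.

Lemma reduced_id : reduced (id : smap n).
Proof. by have [a [b ab]] := ord_neq n1; exists (fun=> a), (fun=> b). Qed.

Lemma germs_id : germs (id : pnt n r -> pnt n r) = [set id].
Proof.
apply/seteqP; split=> [F [v [rF /(_ (Ordinal r0) [::])[d [mu l]]]]|_ ->] /=.
  have l' : local_at (id : pnt n r -> pnt n r) (Ordinal r0) v (Ordinal r0) v id by [].
  by have [] := local_uniq l l' rF reduced_id.
by exists [::]; split=> [|c w]; [apply: reduced_id | exists c, (w ++ [::])].
Qed.

End LocalActions.

(** * Transducers and their state maps *)

Definition stmap n (T : transducer n) (q : T) : smap n := state_map q.

Definition infinite_out n (T : transducer n) :=
  forall (q : T) (x : nat -> 'I_n) i,
    exists k, i < size (output_word (mkseq x k) q).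

Definition well_reduced n (T : transducer n) :=
  [/\ infinite_out T, forall q : T, reduced (stmap q) & injective (@stmap n T)].

(** By [well_reduced_iso] this determines [T] up to strong isomorphism, and by [is_core_spec] it
    replaces [is_core_of], so that transducers for C_{n,r} can be forgotten afterwards. *)
Definition core_spec n r (g : pnt n r -> pnt n r) (T : transducer n) :=
  well_reduced T /\ range (@stmap n T) = germs g.

Section Transducers.
Context {n : nat}.
Implicit Types (T : transducer n) (u v w : seq 'I_n).

Lemma stream_eq (S : Type) (x y : nat -> S) :
  (forall i, exists s, [/\ i < size s, mkseq x (size s) = s & mkseq y (size s) = s]) ->
  x = y.
Proof.
move=> h; apply: funext => i; have [s [si ex ey]] := h i.
by have /agreeP : mkseq x (size s) = mkseq y (size s); [rewrite ex ey | apply].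
Qed.

Lemma trans_word_cat T u v (q : T) :
  trans_word (u ++ v) q = trans_word v (trans_word u q).
Proof. by rewrite /trans_word foldl_cat. Qed.

Lemma output_word_cat T u v (q : T) :
  output_word (u ++ v) q = output_word u q ++ output_word v (trans_word u q).
Proof. by elim: u q => [|a u IH] q //=; rewrite IH catA. Qed.

Lemma output_word1 T a (q : T) : output_word [:: a] q = output a q.
Proof. by rewrite /= cats0. Qed.

Lemma output_word_prefix T k l (q : T) (x : nat -> 'I_n) : k <= l ->
  prefix (output_word (mkseq x k) q) (output_word (mkseq x l) q).
Proof. by move=> /subnKC <-; rewrite mkseqD output_word_cat prefix_prefix. Qed.

Lemma stmap_prefix T (q : T) (x : nat -> 'I_n) k : infinite_out T ->
  let s := output_word (mkseq x k) q in mkseq (stmap q x) (size s) = s.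
Proof.
move=> inf /=; apply: (@limit_word_prefix 'I_n (x 0)
  (fun k => output_word (mkseq x k) q)) => [i j|]; last exact: inf.
exact: output_word_prefix.
Qed.

Lemma stmap_eq T (q : T) (x y : nat -> 'I_n) : infinite_out T ->
  (forall k, let s := output_word (mkseq x k) q in mkseq y (size s) = s) ->
  stmap q x = y.
Proof.
move=> inf h; apply: stream_eq => i; have [k hk] := inf q x i.
exists (output_word (mkseq x k) q); split=> //; exact: stmap_prefix.
Qed.

Lemma stmap_cat T (q : T) w (x : nat -> 'I_n) : infinite_out T ->
  stmap q (cats w x) = cats (output_word w q) (stmap (trans_word w q) x).
Proof.
move=> inf; apply: stream_eq => i; have [k hk] := inf (trans_word w q) x i.
exists (output_word w q ++ output_word (mkseq x k) (trans_word w q)).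
split; first by rewrite size_cat ltn_addl.
  by rewrite -output_word_cat -mkseq_cats; apply: stmap_prefix.
by rewrite size_cat mkseq_cats stmap_prefix.
Qed.

(** Reading [w] splits the state map on the cone of [w] into a written prefix and a reduced state
    map, and such a splitting is unique. *)
Lemma well_reduced_det T (q : T) w o F : infinite_out T ->
  (forall q : T, reduced (stmap q)) -> reduced F ->
  (forall x, stmap q (cats w x) = cats o (F x)) ->
  output_word w q = o /\ stmap (trans_word w q) = F.
Proof.
move=> inf rT rF e; apply: reduced_uniq (rT _) rF _ => x.
by rewrite -e stmap_cat.
Qed.

Lemma iso_spec T1 T2 : strong_iso T1 T2 -> well_reduced T1 ->
  well_reduced T2 /\ range (@stmap n T1) = range (@stmap n T2).
Proof.
move=> [f [[f' fK f'K] ft fo]] [inf red inj].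
have eo w (q : T1) : output_word w (f q) = output_word w q.
  by elim: w q => //= a w IH q; rewrite fo -ft IH.
have es (q : T1) : stmap (f q) = stmap q.
  apply: funext => x; rewrite /stmap /state_map; congr limit_word.
  by apply: funext => k; rewrite eo.
split; first split.
- by move=> q x i; rewrite -(f'K q); have [k] := inf (f' q) x i; exists k; rewrite eo.
- by move=> q; rewrite -(f'K q) es.
- move=> p q; rewrite -(f'K p) -(f'K q) !es => /inj -> //.
by apply/seteqP; split=> _ [q _ <-]; [exists (f q) | exists (f' q)] => //;
  rewrite -es // f'K.
Qed.

(** States are matched by their maps; by [well_reduced_det] the map of a state determines its
    outputs and the maps of the next states. *)
Lemma well_reduced_iso T1 T2 : well_reduced T1 -> well_reduced T2 ->
  range (@stmap n T1) = range (@stmap n T2) -> strong_iso T1 T2.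
Proof.
move=> g1 g2 e.
have /choice[f hf] (q : T1) : exists p : T2, stmap p = stmap q.
  have : range (@stmap n T1) (stmap q) by exists q.
  by rewrite e => -[p _ <-]; exists p.
have /choice[f' hf'] (q : T2) : exists p : T1, stmap p = stmap q.
  have : range (@stmap n T2) (stmap q) by exists q.
  by rewrite -e => -[p _ <-]; exists p.
have [[inf1 r1 i1] [inf2 r2 i2]] := (g1, g2).
have key a (q : T1) : output a (f q) = output a q /\
    stmap (trans a (f q)) = stmap (trans a q).
  rewrite -!output_word1.
  apply: (@well_reduced_det T2 (f q) [:: a] _ (stmap (trans a q)) inf2 r2 (r1 _)) => x.
  by rewrite hf stmap_cat.
exists f; split.
- by exists f' => q; [apply: i1|apply: i2]; rewrite ?hf' ?hf // hf hf'.
- by move=> a q; apply: i2; rewrite hf (key a q).2.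
- by move=> a q; rewrite (key a q).1.
Qed.

Lemma strong_iso_sym T1 T2 : strong_iso T1 T2 -> strong_iso T2 T1.
Proof.
move=> [f [[f' fK f'K] ft fo]]; exists f'; split.
- by exists f.
- by move=> a q; apply: (can_inj fK); rewrite ft !f'K.
- by move=> a q; rewrite -fo f'K.
Qed.

Lemma strong_iso_trans T1 T2 T3 :
  strong_iso T1 T2 -> strong_iso T2 T3 -> strong_iso T1 T3.
Proof.
move=> [f [bf ft fo]] [h [bh ht ho]]; exists (h \o f); split.
- exact: bij_comp.
- by move=> a q; rewrite /= ft ht.
- by move=> a q; rewrite /= ho fo.
Qed.

Lemma sync_atW T m k : m <= k -> sync_at T m -> sync_at T k.
Proof.
move=> mk sm w sw p q; rewrite -(cat_take_drop m w) !trans_word_cat.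
by rewrite (sm _ _ p q) // size_takel // sw.
Qed.

Lemma core_output_word T w (q : core T) : output_word w q = output_word w (sval q).
Proof. by elim: w q => //= a w IH q; rewrite IH. Qed.

Lemma core_stmap T (q : core T) : stmap q = stmap (sval q).
Proof.
apply: funext => x; rewrite /stmap /state_map; congr limit_word.
by apply: funext => k; rewrite core_output_word.
Qed.


End Transducers.

(** * The product of transducers *)

Section Product.
Context {n : nat} (n1 : 1 < n).
Implicit Types (T : transducer n) (u v w : seq 'I_n).

Lemma full_product_trans T1 T2 w (s : full_product T1 T2) :
  trans_word w s = (trans_word w s.1, trans_word (output_word w s.1) s.2).
Proof.
elim: w s => [|a w IH] [p q] //=.
by rewrite [LHS]IH /= trans_word_cat.
Qed.

Lemma full_product_output T1 T2 w (s : full_product T1 T2) :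
  output_word w s = output_word (output_word w s.1) s.2.
Proof.
elim: w s => [|a w IH] [p q] //=.
by rewrite [X in _ ++ X]IH /= -output_word_cat.
Qed.

Lemma full_product_prefix T1 T2 (s : full_product T1 T2) (x : nat -> 'I_n) k : infinite_out T1 ->
  exists j, output_word (mkseq x k) s = output_word (mkseq (stmap s.1 x) j) s.2 /\
    j = size (output_word (mkseq x k) s.1).
Proof.
move=> inf; exists (size (output_word (mkseq x k) s.1)); split=> //.
by rewrite full_product_output stmap_prefix.
Qed.

Lemma full_product_infinite T1 T2 : infinite_out T1 -> infinite_out T2 ->
  infinite_out (full_product T1 T2).
Proof.
move=> i1 i2 s x i; have [k hk] := i2 s.2 (stmap s.1 x) i.
have [l hl] := i1 s.1 x k; exists l.
have [j [-> ->]] := full_product_prefix s x l i1.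
apply: (leq_trans hk).
exact: size_prefix (output_word_prefix _ _ (ltnW hl)).
Qed.

Lemma full_product_stmap T1 T2 (s : full_product T1 T2) : infinite_out T1 -> infinite_out T2 ->
  stmap s = stmap s.2 \o stmap s.1.
Proof.
move=> i1 i2; apply: funext => x; apply: stmap_eq; first exact: full_product_infinite.
move=> k /=; have [j [-> _]] := full_product_prefix s x k i1.
exact: stmap_prefix.
Qed.

Section RemoveIncomplete.
Context (T : transducer n) (inf : infinite_out T)
  (inj : forall q : T, injective (stmap q)).

Lemma common_outputP (s : T) : exists F,
  (forall x, stmap s x = cats (common_output s) (F x)) /\ reduced F.
Proof.
have [o [F [e [x [y ne]]]]] := section_ex n1 [::] (inj (q := s)).
have : is_lcp (range (stmap s)) o.
  apply/is_lcp_image; first by exists x.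
  split=> [u _|]; first by rewrite -(cats_nil u) e mkseq_cats_size.
  by exists x, y; split=> //; rewrite -(cats_nil x) -(cats_nil y) !e !cats_size.
move=> h; have : is_lcp (range (stmap s)) (common_output s).
  exact: (@xgetPex _ [::] [set w | is_lcp (range (stmap s)) w] (ex_intro _ o h)).
move/is_lcp_image => [|pre [x' [y' [_ _ ne']]]]; first by exists x.
exists (fun x => drops (size (common_output s)) (stmap s x)).
split=> [u|]; first by rewrite -prefix_split // pre.
by exists x', y'; rewrite /drops addn0.
Qed.

(** The words e_s telescope along [w]. Dropping e_s loses nothing, because it is a prefix of the old
    output followed by the word e of the next state; this is [reduced_factor]. *)
Lemma remove_incomplete_out w (s : T) :
  common_output s ++ output_word w (s : remove_incomplete T) =
  output_word w s ++ common_output (trans_word w s).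
Proof.
elim: w s => [|a w IH] s; first by rewrite /= cats0.
rewrite /= catA.
have [F [e rF]] := common_outputP (trans a s).
have [F' [e' _]] := common_outputP s.
have e1 x : cats (output a s ++ common_output (trans a s)) (F x) =
    cats (common_output s) (F' (cats [:: a] x)).
  by rewrite -e' stmap_cat // output_word1 cats_cat -e.
have [e2 _] := reduced_factor rF e1.
by rewrite -e2 -catA IH catA.
Qed.

Lemma remove_incomplete_trans w (s : T) :
  trans_word w (s : remove_incomplete T) = trans_word w s.
Proof. by elim: w s => //= a w IH s; apply: IH. Qed.

Lemma remove_incomplete_infinite : infinite_out (remove_incomplete T).
Proof.
move=> s x i; have [k hk] := inf s x (i + size (@common_output n T s)); exists k.
have /(congr1 size) := remove_incomplete_out (mkseq x k) s.
rewrite !size_cat; lia.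
Qed.

Lemma remove_incomplete_stmap (s : T) :
  reduced (stmap (s : remove_incomplete T)) /\
  forall x, stmap s x = cats (common_output s) (stmap (s : remove_incomplete T) x).
Proof.
have [F [e rF]] := common_outputP s.
suff -> : stmap (s : remove_incomplete T) = F by [].
apply: funext => x; apply: stmap_eq; first exact: remove_incomplete_infinite.
move=> k; set t := output_word _ _.
have pre : mkseq (stmap s x) (size (common_output s) + size t) = common_output s ++ t.
  rewrite -size_cat remove_incomplete_out -remove_incomplete_trans.
  have [F' [e' _]] := common_outputP (trans_word (mkseq x k) s).
  rewrite remove_incomplete_trans -{1}(cats_mkseq_drops k x) stmap_cat // e'.
  by rewrite -cats_cat mkseq_cats_size.
move: pre; rewrite e mkseq_cats => /(congr1 (drop (size (common_output s)))).
by rewrite !drop_size_cat.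
Qed.

End RemoveIncomplete.

Section Identify.
Context (T : transducer n) (inf : infinite_out T)
  (red : forall q : T, reduced (stmap q)).

Definition class_of (q : T) : identify_states T :=
  exist _ (same_map q) (ex_intro _ _ erefl).

Definition rep (C : identify_states T) : T := sval (cid (svalP C)).

Lemma rep_class C : class_of (rep C) = C.
Proof. by case: C => C hC; apply: eq_exist; rewrite /rep; case: cid => q /= ->. Qed.

Lemma stmap_rep_class q : stmap (rep (class_of q)) = stmap q.
Proof.
rewrite /rep; case: cid => p /= e.
have : same_map p q by rewrite -e.
by [].
Qed.

(** The representative may change after each letter, but states with equal maps write the same
    words, by [well_reduced_det]. *)
Lemma identify_output w C : output_word w C = output_word w (rep C).
Proof.
elim: w C => //= a w IH C; congr cat; rewrite IH.
have e := stmap_rep_class (trans a (rep C)).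
have [] := @well_reduced_det _ T (rep (class_of (trans a (rep C)))) w
   (output_word w (trans a (rep C))) (stmap (trans_word w (trans a (rep C))))
   inf red (red _) => // x.
by rewrite e stmap_cat.
Qed.

Lemma identify_stmap C : stmap C = stmap (rep C).
Proof.
apply: funext => x; rewrite /stmap /state_map; congr limit_word.
by apply: funext => k; rewrite identify_output.
Qed.

Lemma identify_well_reduced : well_reduced (identify_states T).
Proof.
split.
- by move=> C x i; have [k] := inf (rep C) x i; exists k; rewrite identify_output.
- by move=> C; rewrite identify_stmap.
move=> C D; rewrite !identify_stmap => e.
rewrite -(rep_class C) -(rep_class D); apply: eq_exist.
by rewrite /same_map -![state_map _]/(stmap _) e.
Qed.

Lemma identify_range : range (@stmap n (identify_states T)) = range (@stmap n T).
Proof.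
apply/seteqP; split=> _ [q _ <-]; first by exists (rep q); rewrite ?identify_stmap.
by exists (class_of q); rewrite // identify_stmap stmap_rep_class.
Qed.

End Identify.

Lemma core_well_reduced T : infinite_out T -> (forall q : T, reduced (stmap q)) ->
  infinite_out (core T) /\ forall q : core T, reduced (stmap q).
Proof.
move=> inf red; split=> [q x i|q]; last by rewrite core_stmap.
by have [k] := inf (sval q) x i; exists k; rewrite core_output_word.
Qed.

Context {r : nat} (r0 : 0 < r).
Implicit Types (g : pnt n r -> pnt n r).

(** The map of [p] is itself a germ at some [u]; after reading [v] it becomes the germ at [u ++ v],
    which [v] alone determines. *)
Lemma spec_trans g T v F (p : T) : core_spec g T -> in_core g v F ->
  stmap (trans_word v p) = F.
Proof.
move=> [[inf red inj] e] c; have : germs g (stmap p) by rewrite -e; exists p.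
case=> u cu; apply: (in_core_uniq r0 _ (in_core_catl u c)).
by apply: (in_core_catr cu) => // x; apply: stmap_cat.
Qed.

Lemma spec_inj g T (p : T) : injective g -> core_spec g T -> injective (stmap p).
Proof.
move=> ig [_ e]; apply: (germs_inj r0 ig).
by rewrite -e; exists p.
Qed.

(** The bridge from transducers to maps: steps (a) to (d) of the product of cores compute the core
    of a composition, the left factor acting first. *)
Lemma mulT_spec g1 g1' g2 g2' T1 T2 : bisync g1 g1' -> bisync g2 g2' ->
  core_spec g1 T1 -> core_spec g2 T2 -> core_spec (g2 \o g1) (mulT T1 T2).
Proof.
move=> N1 N2 S1 S2; have [i1 i2] := (bisync_inj N1, bisync_inj N2).
have [[f1 red1 inj1] e1] := S1; have [[f2 red2 inj2] e2] := S2.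
have [[_ _ u1 _] [l1 _]] := N1; have [[_ _ u2 _] [l2 _]] := N2.
have [m2 h2] := local_sync_core n1 r0 i2 l2.
have [m [K hK]] := out_long n1 r0 i1 u1 l1 m2.
set P := full_product T1 T2; set Q := remove_incomplete P.
have Pinf : infinite_out P by apply: full_product_infinite.
have Pinj (s : P) : injective (stmap s).
  by rewrite full_product_stmap //; apply: inj_comp; [exact: spec_inj i2 S2|exact: spec_inj i1 S1].
have Qinf := remove_incomplete_infinite Pinf Pinj.
have Qst := remove_incomplete_stmap Pinf Pinj.
have Qred (s : Q) : reduced (stmap s) := (Qst s).1.
have [Cinf Cred] := core_well_reduced Qinf Qred.
(* Words of length [m + K] synchronize the full product, and the map of the state reached is, up to
   a prefix, the local action of the composition. *)
have syncP v : size v = m + K -> exists s : P, (forall s' : P, trans_word v s' = s) /\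
    forall c w, exists d mu, local_at (g2 \o g1) c (w ++ v) d mu (stmap s).
  move=> sv.
  have [||F1 [o [F' [c1 eF rF' so]]]] := hK (take m v) (drop m v).
  - by rewrite size_takel// sv leq_addr.
  - by rewrite size_drop sv addKn.
  have [F2 c2] := h2 o so.
  (* For the second component: after [m] letters the first component has map [F1], so that it writes
     [o] on the next [K] letters, and [o] synchronizes [T2]. *)
  have det (s : P) : stmap (trans_word v s).1 = F' /\ stmap (trans_word v s).2 = F2.
    rewrite full_product_trans /=; split.
      by apply: spec_trans S1 _; rewrite -(cat_take_drop m v); apply: in_core_catr c1 _ _.
    rewrite -(cat_take_drop m v) output_word_cat trans_word_cat.
    have est := spec_trans s.1 S1 c1.
    have [-> _] := @well_reduced_det _ T1 (trans_word (take m v) s.1) (drop m v) o F' f1 red1 rF'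
      (fun x => etrans (congr1 (@^~ _) est) (eF x)).
    exact: spec_trans S2 c2.
  have [p _ ep] : range (@stmap n T1) F'.
    by rewrite e1; exists v; rewrite -(cat_take_drop m v); apply: in_core_catr c1 _ _.
  have [q _ eq] : range (@stmap n T2) F2 by rewrite e2; exists o.
  exists (p, q); split.
    move=> s; have [d1 d2] := det s; rewrite (surjective_pairing (trans_word v s)).
    by congr pair; [apply: inj1|apply: inj2]; rewrite ?d1 ?d2.
  move=> c w; rewrite full_product_stmap //= ep eq.
  have [d [mu l]] := c1.2 c w.
  have [d' [mu' l']] := c2.2 d mu; exists d', mu' => x.
  by rewrite /= -(cat_take_drop m v) catA (local_cat l eF) l'.
have syncQ : sync_at Q (m + K).
  move=> w sw p q; rewrite !remove_incomplete_trans.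
  by have [s [hs _]] := syncP w sw; rewrite !hs.
(* One synchronizing word [v0], leading to [s], serves for both inclusions: core states are reached
   from [s], and germs are compared on the cones of words [v0 ++ w]. *)
have a0 : 'I_n by apply: Ordinal (ltnW n1).
have s0 : size (nseq (m + K) a0) = m + K by rewrite size_nseq.
have [s [hs ls]] := syncP _ s0; move: (nseq _ _) s0 hs ls => v0 s0 hs ls.
have ext w c u : exists d mu,
    local_at (g2 \o g1) c (u ++ v0 ++ w) d mu (stmap (trans_word w s : Q)).
  have [d [mu l]] := ls c u; rewrite catA.
  exists d, (mu ++ (output_word w s ++ @common_output _ P (trans_word w s))).
  by apply: local_cat l _ => x; rewrite stmap_cat // (Qst (trans_word w s)).2 cats_cat.
split; first exact: identify_well_reduced.
rewrite identify_range //; apply/seteqP; split=> [_ [[q cq] _ <-]|F [v c]].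
  rewrite core_stmap /=; have [m' _ [w _ hw]] := cq.
  exists (v0 ++ w); split=> // c u; have [d [mu l]] := ext w c u.
  exists d, mu; suff <- : trans_word w (s : P) = q by [].
  by rewrite -(hw s) remove_incomplete_trans.
have cs : core_state (trans_word v s : Q).
  exists (size (v0 ++ v)); first by apply: sync_atW syncQ; rewrite size_cat s0 leq_addr.
  exists (v0 ++ v) => // p.
  by rewrite remove_incomplete_trans trans_word_cat hs.
exists (exist _ _ cs) => //; rewrite core_stmap /=.
have [d [mu l]] := ext v (Ordinal r0) [::].
have [d' [mu' l']] := c.2 (Ordinal r0) v0.
by have [] := local_uniq l l' (Qred _) c.1.
Qed.

End Product.

(** * Minimal transducers and cores *)

Section Sections.
Context {n : nat} (n1 : 1 < n) {T : choiceType}.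
Implicit Types (F : (nat -> 'I_n) -> nat -> T) (u v w : seq 'I_n).

(** With [lnext], this gives the word written and the state reached on reading [w] when the states
    are the reduced maps themselves. For injective [F] it is the longest common prefix of the image
    of the cone of [w]. *)
Definition lout w F : seq T :=
  xget [::] [set o | exists F', (forall x, F (cats w x) = cats o (F' x)) /\ reduced F'].

Definition lnext w F := fun x => drops (size (lout w F)) (F (cats w x)).

Lemma section_uniq F w o F' : (forall x, F (cats w x) = cats o (F' x)) -> reduced F' ->
  lout w F = o /\ lnext w F = F'.
Proof.
move=> e rF'; have [F2 [e2 r2]] : [set o | exists F',
    (forall x, F (cats w x) = cats o (F' x)) /\ reduced F'] (lout w F).
  by apply: xgetPex; exists o, F'.
have [eo e3] := reduced_uniq r2 rF' (fun x => etrans (esym (e2 x)) (e x)).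
split=> //; apply: funext => x.
by rewrite /lnext eo e drops_cats.
Qed.

Lemma sectionP F w : injective F -> [/\ (forall x, F (cats w x) = cats (lout w F) (lnext w F x)),
  reduced (lnext w F) & injective (lnext w F)].
Proof.
move=> iF; have [o [F' [e rF']]] := section_ex n1 w iF.
have [-> ->] := section_uniq e rF'; split=> // x y exy.
by apply: (@cats_inj _ w); apply: iF; rewrite !e exy.
Qed.

Lemma section_cat F u v : injective F ->
  lout (u ++ v) F = lout u F ++ lout v (lnext u F) /\
  lnext (u ++ v) F = lnext v (lnext u F).
Proof.
move=> iF; have [e _ iF1] := sectionP u iF; have [e1 r1 _] := sectionP v iF1.
by apply: section_uniq => // x; rewrite cats_cat e e1 cats_cat.
Qed.

Lemma section_nil F : reduced F -> lout [::] F = [::] /\ lnext [::] F = F.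
Proof. by move=> rF; apply: section_uniq => // x; rewrite !cats_nil. Qed.

End Sections.

(** This dichotomy separates the states of R, where nothing has been written yet, from those of S,
    where the dotted letter has been. *)
Lemma pletters_split n r (z : pnt n r) o u : pletters z = cats o u ->
  (o = [::] /\ u = pletters z) \/
  (exists v, o = inl z.1 :: map inr v /\ u = inr \o drops (size v) z.2).
Proof.
case: o => [|a o] e; first by left; split; rewrite ?e ?cats_nil.
right; exists (mkseq z.2 (size o)); rewrite size_mkseq.
move: e; case: z => c x /=; rewrite -{1}(cats_mkseq_drops (size o) x) pletters_cats => e.
have sz : size (inl c :: map inr (mkseq x (size o))) = size (a :: o) :> nat.
  by rewrite /= size_map size_mkseq.
have [e1 ->] := cats_eq_split (eq_leq (esym sz)) (esym e).
have d0 : drop (size (a :: o)) (inl c :: map inr (mkseq x (size o)) : seq (letter n r)) = [::].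
  by rewrite -sz drop_size.
by rewrite d0 cats_nil; rewrite d0 cats0 in e1.
Qed.

Section Minimal.
Context {n r : nat} (n1 : 1 < n) (r0 : 0 < r) (g : pnt n r -> pnt n r).
Hypotheses (ig : injective g) (cg : pcont g).
Implicit Types (u v w : seq 'I_n).

Definition word_map c : (nat -> 'I_n) -> nat -> letter n r :=
  fun x => pletters (g (c, x)).
Notation G := word_map.

Lemma word_map_inj c : injective (G c).
Proof. by move=> x y /pletters_inj /ig []. Qed.

(** The images of the points of the cone of [mkseq x k] differ right after their common prefix, but
    by continuity they agree on [i.+1] letters when [k] is large. *)
Lemma lout_long c x i : exists k, i < size (lout (mkseq x k) (G c)).
Proof.
have [K hK] := cg (c, x) i.+1; exists K; rewrite ltnNge; apply/negP => h.
have [e [y [y' ne]] _] := sectionP n1 (mkseq x K) (@word_map_inj c).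
have key y0 : agree i.+1 (G c x) (G c (cats (mkseq x K) y0)).
  apply: hK; apply: (agreeW (leqnSn K)); apply/agree_plettersS; split=> //.
  by rewrite -{1}(cats_mkseq_drops K x) -{1}(size_mkseq x K); apply: agree_prefix.
have := agree_trans (agree_sym (key y)) (key y') (i := size (lout (mkseq x K) (G c))).
by rewrite !e !cats_size ltnS => /(_ h).
Qed.


Lemma lout_long_cat c w x i : exists k, i < size (lout (w ++ mkseq x k) (G c)).
Proof.
have [k hk] := lout_long c (cats w x) i; exists k; apply: (leq_trans hk).
rewrite -mkseq_cats addnC mkseqD.
have [-> _] := section_cat n1 (mkseq (cats w x) k) (mkseq (drops k (cats w x)) (size w))
  (@word_map_inj c).
by rewrite size_cat leq_addr.
Qed.

Lemma lout_prefix c w x k :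
  let o := lout (mkseq x k) (lnext w (G c)) in mkseq (lnext w (G c) x) (size o) = o.
Proof.
have [_ _ i1] := sectionP n1 w (@word_map_inj c).
have [e _ _] := sectionP n1 (mkseq x k) i1.
by rewrite /= -{1}(cats_mkseq_drops k x) e mkseq_cats_size.
Qed.

Lemma lout_infinite c w x i : exists k, i < size (lout (mkseq x k) (lnext w (G c))).
Proof.
have [k] := lout_long_cat c w x (i + size (lout w (G c))); exists k.
have [e _] := section_cat n1 w (mkseq x k) (@word_map_inj c); move: p.
by rewrite e size_cat; lia.
Qed.

(* The local maps themselves would live in too large a universe to be the
   states of a transducer; they are replaced by natural numbers. *)
Definition code (F : (nat -> 'I_n) -> nat -> letter n r) : nat :=
  pickle (xget (Ordinal r0, [::]) [set cw | F = lnext cw.2 (G cw.1)]).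

Definition local_states := {k : nat | exists c w, k = code (lnext w (G c))}.

Definition loc (q : local_states) : (nat -> 'I_n) -> nat -> letter n r :=
  let cw := odflt (Ordinal r0, [::]) (unpickle (sval q)) in lnext cw.2 (G cw.1).

Definition mk_state F (h : exists c w, F = lnext w (G c)) : local_states :=
  exist _ (code F) (let: ex_intro c (ex_intro w e) := h in
    ex_intro _ c (ex_intro _ w (congr1 code e))).

Lemma code_spec F : (exists c w, F = lnext w (G c)) ->
  exists cw, code F = pickle cw /\ F = lnext cw.2 (G cw.1).
Proof.
move=> [c [w e]]; exists (xget (Ordinal r0, [::]) [set cw | F = lnext cw.2 (G cw.1)]).
by split=> //; apply: (@xgetPex _ _ [set cw | F = lnext cw.2 (G cw.1)]); exists (c, w).
Qed.

Lemma loc_mk F (h : exists c w, F = lnext w (G c)) : loc (mk_state h) = F.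
Proof. by have [cw [e eF]] := code_spec h; rewrite /loc /= e pickleK /= -eF. Qed.

Lemma code_loc (q : local_states) : sval q = code (loc q).
Proof.
case: q => k [c [w e]] /=; rewrite /loc /= e.
have [|cw [e' eF]] := @code_spec (lnext w (G c)); first by exists c, w.
by rewrite e' pickleK /= -eF e'.
Qed.

(** The pair chosen by [xget] depends only on the map, so that equal maps have equal codes. *)
Lemma loc_inj : injective loc.
Proof. by move=> p q e; apply: eq_sig_hprop => [?|]; [exact: Prop_irrelevance|rewrite !code_loc e]. Qed.

Lemma min_st (q : local_states) : exists c w, loc q = lnext w (G c).
Proof. by do 2!eexists; rewrite /loc. Qed.

Lemma local_states_next a (q : local_states) :
  exists c w, lnext [:: a] (loc q) = lnext w (G c).
Proof.
have [c [w ->]] := min_st q; exists c, (w ++ [:: a]).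
by have [_ ->] := section_cat n1 w [:: a] (@word_map_inj c).
Qed.

(** R consists of the states where the dotted letter is still to be written: their maps take values
    that begin with a dotted letter. *)
Definition min_rtransducer : rtransducer n r :=
  @RTransducer n r local_states
    [set q | exists x d, loc q x 0 = inl d]
    (fun c => mk_state (ex_intro _ c (ex_intro _ [::] erefl) : exists d w, lnext [::] (G c) = lnext w (G d)))
    (fun c => lout [::] (G c))
    (fun a q => mk_state (local_states_next a q))
    (fun a q => lout [:: a] (loc q)).
Notation M := min_rtransducer.

Lemma loc_init c : loc (init_trans M c) = lnext [::] (G c).
Proof. exact: loc_mk. Qed.

Lemma loc_next a (q : M) : loc (rtrans a q) = lnext [:: a] (loc q).
Proof. exact: loc_mk. Qed.

Lemma min_red (q : M) : reduced (loc q) /\ injective (loc q).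
Proof. by have [c [w ->]] := min_st q; have [] := sectionP n1 w (@word_map_inj c). Qed.

Lemma min_word (q : M) w :
  routput_word w q = lout w (loc q) /\ loc (rtrans_word w q) = lnext w (loc q).
Proof.
elim: w q => [|a w IH] q; first by have [-> ->] := section_nil (min_red q).1.
have [/= -> ->] := IH (rtrans a q).
by rewrite loc_next -cat1s; have [-> ->] := section_cat n1 [:: a] w (min_red q).2.
Qed.

Lemma min_init c w :
  init_output_word M c w = lout w (G c) /\ loc (init_trans_word M c w) = lnext w (G c).
Proof.
rewrite /init_output_word /init_trans_word.
have [-> ->] := min_word (init_trans M c) w.
by rewrite loc_init; have [-> ->] := section_cat n1 [::] w (@word_map_inj c).
Qed.

Lemma min_inR (q : M) c w : loc q = lnext w (G c) ->
  (inR q /\ lout w (G c) = [::]) \/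
  (~ inR q /\ exists d v, lout w (G c) = inl d :: map inr v).
Proof.
move=> eq; have [e _ _] := sectionP n1 w (@word_map_inj c).
have hx (x : nat -> 'I_n) : pletters (g (c, cats w x)) = cats (lout w (G c)) (loc q x).
  by rewrite eq -e.
have [a _] := ord_neq n1; have := pletters_split (hx (fun=> a)).
case=> [[eo eu]|[v [eo eu]]]; [left|right]; split=> //.
- by exists (fun=> a), (g (c, cats w (fun=> a))).1; rewrite eu.
- move=> [x [d]]; have := hx x; case/pletters_split => [[]|[v' [_ ->]] //].
  by rewrite eo.
- by exists (g (c, cats w (fun=> a))).1, v.
Qed.

Lemma min_infinite (q : M) x i : exists k, i < size (routput_word (mkseq x k) q).
Proof.
have [c [w e]] := min_st q.
by have [k hk] := lout_infinite c w x i; exists k; rewrite (min_word q _).1 e.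
Qed.

Lemma min_rstate_map (q : M) : rstate_map q = loc q.
Proof.
apply: funext => x; apply: limit_word_eq => [k|i]; last exact: min_infinite.
by rewrite (min_word q _).1; have [c [w ->]] := min_st q; apply: lout_prefix.
Qed.

Lemma min_represents : represents M g.
Proof.
move=> [c x]; apply: limit_word_eq => [k|i] /=.
  rewrite (min_init c _).1; have [e _ _] := sectionP n1 (mkseq x k) (@word_map_inj c).
  rewrite plettersE -[pletters (g _)]/(G c x) -{1}(cats_mkseq_drops k x).
  by rewrite e mkseq_cats_size.
by have [k hk] := lout_long c x i; exists k; rewrite (min_init c _).1.
Qed.

Lemma min_well_formed : finite_set [set: M] -> well_formed M.
Proof.
move=> fin; split.
  by split; [apply: sub_finite_set fin|apply: finite_set_countable; apply: sub_finite_set fin].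
have nx (q : M) a c w : loc q = lnext w (G c) ->
    loc (rtrans a q) = lnext (w ++ [:: a]) (G c) /\
    lout (w ++ [:: a]) (G c) = lout w (G c) ++ routput a q.
  by rewrite loc_next /= => ->; have [-> ->] := section_cat n1 w [:: a] (@word_map_inj c).
split; [split|split| | |].
- by move=> c; have [[]|[]] := @min_inR (init_trans M c) c [::] (loc_init c).
- move=> a q; have [c [w e]] := min_st q; have [e1 e2] := nx q a c w e.
  have [[_ e3] _|[? _] //] := min_inR e1.
  have : size (lout w (G c) ++ routput a q) = 0 by rewrite -e2 e3.
  rewrite size_cat => /eqP; rewrite addn_eq0 => /andP[/nilP h /nilP ->].
  by split=> //; have [[] //|[_ [d [v]]]] := min_inR e; rewrite h.
- move=> c h; have [[] //|[_ [d [v e]]]] := @min_inR (init_trans M c) c [::] (loc_init c).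
  by exists d, v; rewrite -e.
- move=> a q hq hr; have [c [w e]] := min_st q; have [e1 e2] := nx q a c w e.
  have [[? _] //|[_ [d [v]]]] := min_inR e1; rewrite e2.
  by have [[_ ->]|[? _] //] := min_inR e => /= ->; exists d, v.
- move=> a q hq; have [c [w e]] := min_st q; have [e1 e2] := nx q a c w e.
  have [[? _] //|[_ [d [v e3]]]] := min_inR e.
  have [[_ e4]|[h [d' [v' e4]]]] := min_inR e1; first by rewrite e4 e3 in e2.
  split=> //; exists (drop (size v) v').
  move: e2; rewrite e4 e3 => -[_ /(congr1 (drop (size v)))].
  by rewrite map_drop => ->; rewrite drop_size_cat ?size_map.
(* A loop [u] with empty output would give [cats u x = x] for all [x], by injectivity of the state
   map; then all [x] would begin with the first letter of [u]. *)
- move=> u q u0 e; rewrite (min_word q u).1 => h.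
  have [es _ _] := sectionP n1 u (min_red q).2.
  have fx x : cats u x = x.
    apply: (min_red q).2; rewrite es h cats_nil -(min_word q u).2.
    by rewrite [rtrans_word _ _]e.
  have [a [b ab]] := ord_neq n1; apply: ab.
  have := congr1 (@^~ 0) (fx (fun=> a)); have := congr1 (@^~ 0) (fx (fun=> b)).
  by case: u u0 {e h es fx} => //= c u _; rewrite /cats /= => <- <-.
- by move=> q x _ i; apply: min_infinite.
Qed.

Lemma min_minimal : finite_set [set: M] -> minimal M.
Proof.
move=> fin; split; first exact: min_well_formed.
- move=> q; have [c [w e]] := min_st q; exists c, w.
  by apply: loc_inj; rewrite (min_init c w).2.
- move=> c w; rewrite (min_init c w).1.
  have -> : init_map M = (fun z => pletters (g z)) by apply: funext; apply: min_represents.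
  have [e [x [y ne]] _] := sectionP n1 w (@word_map_inj c).
  have inc (z : nat -> 'I_n) : cylinder c w (c, cats w z : nat -> 'I_n) by split=> //=; apply: mkseq_cats_size.
  apply/is_lcp_image; first by exists (c, cats w x).
  split.
    move=> [c' u] [/= -> eu]; rewrite (prefix_split eu).
    by rewrite -[pletters _]/(G c (cats w _)) e mkseq_cats_size.
  exists (c, cats w x), (c, cats w y); split=> //.
  by rewrite -![pletters _]/(G c (cats w _)) !e !cats_size.
- by move=> p q; rewrite !min_rstate_map => /loc_inj.
Qed.

Hypothesis lg : local_sync g.

Lemma lnext_core v F c w : in_core g v F -> lnext (w ++ v) (G c) = (fun x => inr \o F x).
Proof.
move=> [[x [y ne]] /(_ c w)[d [mu l]]].
have [] := @section_uniq n _ (G c) (w ++ v) (inl d :: map inr mu) (fun x => inr \o F x) => //.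
  by move=> u; rewrite /G l pletters_cats.
by exists x, y => -[].
Qed.

(** The words of length at most [m] already reach all states, as the local map at a longer word
    depends only on its last [m] letters. *)
Lemma min_finite : finite_set [set: M].
Proof.
have [m hm] := local_sync_core n1 r0 ig lg.
pose I := ('I_r * {k : 'I_m.+1 & k.-tuple 'I_n})%type.
pose f (i : I) : M := mk_state (ex_intro _ i.1 (ex_intro _ (tval (tagged i.2)) erefl) :
  exists c w, lnext (tagged i.2) (G i.1) = lnext w (G c)).
have short c w : size w <= m -> exists i, loc (f i) = lnext w (G c).
  move=> sw; have lt : size w < m.+1 by rewrite ltnS.
  exists (c, Tagged (fun k : 'I_m.+1 => k.-tuple 'I_n)
    (Tuple (eqxx _ : size w == Ordinal lt))).
  by rewrite loc_mk.
suff -> : [set: M] = range f by apply: finite_image; apply: finite_finset.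
apply/seteqP; split=> // q _; have [c [w e]] := min_st q.
suff [i hi] : exists i, loc (f i) = loc q by exists i => //; apply: loc_inj.
rewrite e; have [sw|sw] := leqP (size w) m; first exact: short.
rewrite -(cat_take_drop (size w - m) w).
have sd : size (drop (size w - m) w) = m by rewrite size_drop subKn// ltnW.
have [F' cF] := hm _ (eq_leq (esym sd)).
rewrite (lnext_core _ _ cF); have [|i hi] := short c (drop (size w - m) w); first by rewrite sd.
by exists i; rewrite hi -[drop _ w]cat0s (lnext_core _ _ cF).
Qed.

Lemma min_sync : strongly_synchronizing (body M).
Proof.
have [m hm] := local_sync_core n1 r0 ig lg.
exists m => v sv p q; have [F cF] := hm v (eq_leq (esym sv)).
have key (s : M) : loc (rtrans_word v s) = (fun x => inr \o F x).
  rewrite (min_word s v).2; have [c [w ->]] := min_st s.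
  have [_ <-] := section_cat n1 w v (@word_map_inj c).
  exact: lnext_core.
by apply: loc_inj; rewrite -![trans_word _ _]/(rtrans_word _ _) !key.
Qed.

Lemma bisync_representable : finite_sync_representable g.
Proof.
exists M; split; [exact: min_well_formed min_finite|exact: min_finite|exact: min_sync|].
exact: min_represents.
Qed.

End Minimal.

(** * Transducers for C_{n,r}: outputs and the dotted letter *)

Section WellFormed.
Context {n r : nat} (A : rtransducer n r).
Implicit Types (u v w : seq 'I_n).

Lemma rtrans_word_cat u v (q : A) : rtrans_word (u ++ v) q = rtrans_word v (rtrans_word u q).
Proof. by rewrite /rtrans_word foldl_cat. Qed.

Lemma routput_word_cat u v (q : A) :
  routput_word (u ++ v) q = routput_word u q ++ routput_word v (rtrans_word u q).
Proof. by elim: u q => [|a u IH] q //=; rewrite IH catA. Qed.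

Lemma init_output_word_cat c u v :
  init_output_word A c (u ++ v) = init_output_word A c u ++ routput_word v (init_trans_word A c u).
Proof. by rewrite /init_output_word routput_word_cat catA. Qed.

Lemma init_trans_word_cat c u v :
  init_trans_word A c (u ++ v) = rtrans_word v (init_trans_word A c u).
Proof. by rewrite /init_trans_word rtrans_word_cat. Qed.

Lemma drop_dotted_plain v : drop_dotted (map inr v : seq (letter n r)) = v.
Proof. by rewrite /drop_dotted map_pK. Qed.

Hypothesis wA : well_formed A.

Lemma inR_back w (q : A) : inR (rtrans_word w q) -> inR q /\ routput_word w q = [::].
Proof.
have [_ [[_ h] _ _ _ _]] := wA.
elim: w q => [|a w IH] q //= /IH[hq ->].
by have [hq' ->] := h a q hq.
Qed.

Lemma plain_state w (q : A) : ~ inR q -> ~ inR (rtrans_word w q) /\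
  routput_word w q = map inr (output_word w (q : body A)).
Proof.
have [_ [_ _ h _ _]] := wA.
elim: w q => [|a w IH] q hq //=; have [hq' [v e]] := h a q hq.
have [hw ->] := IH _ hq'; split=> //.
by rewrite e map_cat drop_dotted_plain.
Qed.

Lemma init_word_R c w :
  (inR (init_trans_word A c w) -> init_output_word A c w = [::]) /\
  (~ inR (init_trans_word A c w) -> dotted_word (init_output_word A c w)).
Proof.
have [_ [[h1 h1'] [h2 h2'] h3 _ _]] := wA.
elim/last_ind: w => [|w a [IH1 IH2]].
  by rewrite /init_trans_word /init_output_word /= cats0; split; [apply: h1|apply: h2].
rewrite -cats1 init_trans_word_cat init_output_word_cat /= cats0.
split=> [/h1'[hq ->]|hr]; first by rewrite cats0; apply: IH1.
have [hq|hq] := pselect (inR (init_trans_word A c w)).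
  by rewrite IH1 //; apply: h2'.
have [d [v ->]] := IH2 hq; have [_ [v' ->]] := h3 a _ hq.
by exists d, (v ++ v'); rewrite map_cat.
Qed.

Lemma plain_stmap (q : A) x k : ~ inR q ->
  let s := output_word (mkseq x k) (q : body A) in
  mkseq (stmap (q : body A) x) (size s) = s.
Proof.
move=> hq /=; have [_ [_ _ _ _ inf]] := wA.
apply: (@limit_word_prefix 'I_n (x 0)
  (fun k => output_word (mkseq x k) (q : body A))) => [i j|i].
  exact: output_word_prefix.
have [l] := inf q x hq i; exists l; move: p.
by rewrite (plain_state _ hq).2 size_map.
Qed.

(** A path ending in R has stayed in R and written nothing, which is forbidden for a loop. *)
Lemma sync_loop_plain v (q : A) : v <> [::] -> rtrans_word v q = q -> ~ inR q.
Proof.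
have [_ [_ _ _ h _]] := wA.
by move=> v0 e hq; apply: (h v q v0 e); apply: (inR_back _).2; rewrite e.
Qed.

Lemma init_map_plain c w (x : nat -> 'I_n) : ~ inR (init_trans_word A c w) ->
  init_map A (c, cats w x) = cats (init_output_word A c w)
    (inr \o stmap (init_trans_word A c w : body A) x).
Proof.
move=> hq; set q := init_trans_word A c w.
have key k : init_output_word A c (mkseq (cats w x) (size w + k)) =
    init_output_word A c w ++ map inr (output_word (mkseq x k) (q : body A)).
  by rewrite mkseq_cats init_output_word_cat (plain_state _ hq).2.
have inf i : exists k, i < size (output_word (mkseq x k) (q : body A)).
  have [_ [_ _ _ _ inf]] := wA; have [k] := inf q x hq i; exists k; move: p.
  by rewrite (plain_state _ hq).2 size_map.
have pre : forall k, let s := init_output_word A c (mkseq (cats w x) k) in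
    mkseq (init_map A (c, cats w x)) (size s) = s.
  apply: (@limit_word_prefix (letter n r) (inl c)
    (fun k => init_output_word A c (mkseq (cats w x) k))) => [i k ik|i].
    by rewrite -(subnKC ik) mkseqD init_output_word_cat prefix_prefix.
  have [k hk] := inf i; exists (size w + k).
  by rewrite key size_cat size_map ltn_addl.
apply: stream_eq => i; have [k hk] := inf i.
exists (init_output_word A c (mkseq (cats w x) (size w + k))); split.
- by rewrite key size_cat size_map ltn_addl.
- exact: pre.
- by rewrite key size_cat size_map mkseq_cats mkseq_map plain_stmap.
Qed.

End WellFormed.

Lemma representable_local_sync n r (r0 : 0 < r) (g : pnt n r -> pnt n r) :
  finite_sync_representable g -> local_sync g.
Proof.
(* The extra letter makes [v] nonempty: [v] is then a loop at the state [q] that it reaches from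
   everywhere, which puts [q] in S. *)
move=> [A [wA _ [m sm] rep]]; exists m.+1 => v sv.
have sm' : sync_at (body A) m.+1 by apply: sync_atW sm.
pose q := rtrans_word v (init_trans A (Ordinal r0)).
have hv p : rtrans_word v p = q by apply: sm'.
have hq : ~ inR q by apply: (sync_loop_plain wA _ (hv q)) => e; rewrite e in sv.
exists (stmap (q : body A)) => c w.
have eq : init_trans_word A c (w ++ v) = q by rewrite init_trans_word_cat hv.
have [|d [mu e]] := (init_word_R wA c (w ++ v)).2; first by rewrite eq.
exists d, mu => x; apply: pletters_inj; rewrite pletters_cats -plettersE -rep.
by rewrite init_map_plain // eq // e.
Qed.

Section MinimalCore.
Context {n r : nat} (n1 : 1 < n) (r0 : 0 < r) (g : pnt n r -> pnt n r).
Hypotheses (ig : injective g) (cg : pcont g) (lg : local_sync g).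
Implicit Types (u v w : seq 'I_n).

Section OneMinimal.
Context (A : rtransducer n r) (mA : minimal A) (rA : represents A g).

(** In any minimal transducer the outputs are the longest common prefixes by definition, and what
    remains of [g] is the state map. *)
Lemma minimal_word c w : init_output_word A c w = lout w (word_map g c) /\
  rstate_map (init_trans_word A c w) = lnext w (word_map g c).
Proof.
have [wA _ lcp _] := mA.
have eo u : init_output_word A c u = lout u (word_map g c).
  have := lcp c u; have -> : init_map A = (fun z => pletters (g z)) by apply: funext => z; apply: rA.
  have [a _] := ord_neq n1.
  have inc (z : nat -> 'I_n) : cylinder c u (c, cats u z : nat -> 'I_n).
    by split=> //=; apply: mkseq_cats_size.
  move/is_lcp_image => [|pre [[c1 x] [[c2 y] [[/= -> ex] [/= -> ey]]]]].
    by exists (c, cats u (fun=> a)).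
  rewrite (prefix_split ex) (prefix_split ey) => ne.
  pose F' := fun z => drops (size (init_output_word A c u)) (word_map g c (cats u z)).
  have [] := @section_uniq n _ (word_map g c) u (init_output_word A c u) F' => // [z|].
    by rewrite -prefix_split //; apply: (pre (c, cats u z)).
  by exists (drops (size u) x), (drops (size u) y); rewrite /F' /drops addn0.
split=> //; have iG := @word_map_inj n r g ig c.
have [e _ i1] := sectionP n1 w iG.
apply: funext => x; have ro k : routput_word (mkseq x k) (init_trans_word A c w) =
    lout (mkseq x k) (lnext w (word_map g c)).
  have := init_output_word_cat A c w (mkseq x k); rewrite !eo.
  have [-> _] := section_cat n1 w (mkseq x k) iG.
  by move/(congr1 (drop (size (lout w (word_map g c))))); rewrite !drop_size_cat.
apply: limit_word_eq => [k|i].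
  by rewrite ro; apply: (lout_prefix n1 ig).
by have [k hk] := lout_infinite n1 r0 ig cg c w x i; exists k; rewrite ro.
Qed.

Lemma minimal_in_core c w v F : in_core g v F ->
  [/\ rstate_map (init_trans_word A c (w ++ v)) = (fun x => inr \o F x),
      ~ inR (init_trans_word A c (w ++ v))
    & stmap (init_trans_word A c (w ++ v) : body A) = F].
Proof.
move=> cF; have [wA _ _ _] := mA.
set q := init_trans_word A c (w ++ v).
have [eo er] := minimal_word c (w ++ v).
have e := lnext_core c w cF.
have [d [mu l]] := cF.2 c w.
have eo' : init_output_word A c (w ++ v) = inl d :: map inr mu.
  rewrite eo; case: cF => -[x [y ne]] _.
  have [] := @section_uniq n _ (word_map g c) (w ++ v) (inl d :: map inr mu) (fun x => inr \o F x) => //.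
    by move=> u; rewrite /word_map l pletters_cats.
  by exists x, y => -[].
have hq : ~ inR q.
  by move=> /((init_word_R wA c (w ++ v)).1); rewrite eo'.
split=> //; first by rewrite er e.
apply: funext => x; have := @init_map_plain n r A wA c (w ++ v) x hq; rewrite rA plettersE l pletters_cats eo'.
by move/cats_inj => ex; apply: funext => i; have := congr1 (@^~ i) ex => -[].
Qed.

Lemma minimal_sync : exists m, sync_at (body A) m /\
  forall v, m <= size v -> exists F, in_core g v F.
Proof.
have [m hm] := local_sync_core n1 r0 ig lg.
exists m; split=> // v sv p q; have [F cF] := hm v (eq_leq (esym sv)).
have [_ reach _ inj] := mA; apply: inj.
have key (s : A) : rstate_map (rtrans_word v s) = (fun x => inr \o F x).
  have [c [w <-]] := reach s; rewrite -init_trans_word_cat.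
  by have [] := minimal_in_core c w cF.
by rewrite -![trans_word _ _]/(rtrans_word _ _) !key.
Qed.

Lemma minimal_core_spec : core_spec g (core (body A)).
Proof.
have [wA reach _ inj] := mA; have [m [sm hm]] := minimal_sync.
have [a0 _] := ord_neq n1.
have core_in (q : body A) : core_state q -> exists v F, [/\ in_core g v F,
    stmap q = F, rstate_map (q : A) = (fun x => inr \o F x) & ~ inR (q : A)].
  (* Padding on the left makes the word long enough to have a germ, without changing the state that
     [v] reaches from everywhere. *)
  move=> [m' _ [v _ hv]]; pose u := nseq m a0 ++ v.
  have [|F cF] := hm u; first by rewrite size_cat size_nseq leq_addr.
  exists u, F.
  have [e1 h e2] := minimal_in_core (Ordinal r0) [::] cF.
  have <- : init_trans_word A (Ordinal r0) u = q.
    by rewrite init_trans_word_cat; apply: hv.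
  by [].
split; first split.
- move=> [q cq] x i; have [v [F [_ _ _ hq]]] := core_in q cq.
  have [_ [_ _ _ _ inf]] := wA; have [k] := inf q x hq i; exists k; move: p.
  by rewrite (plain_state wA _ hq).2 size_map core_output_word.
- by move=> [q cq]; rewrite core_stmap /=; have [v [F [[rF _] -> _ _]]] := core_in q cq.
- move=> [p cp] [q cq]; rewrite !core_stmap /= => e.
  have [v [F [_ ep ep' _]]] := core_in p cp; have [v' [F' [_ eq eq' _]]] := core_in q cq.
  apply: eq_exist; apply: inj; rewrite ep' eq'.
  by rewrite -ep -eq e.
apply/seteqP; split=> [_ [[q cq] _ <-]|F [v cF]].
  by rewrite core_stmap /=; have [v [F [cF -> _ _]]] := core_in q cq; exists v.
pose u := nseq m a0 ++ v; have cu : in_core g u F by apply: in_core_catl.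
have [er hq es] := minimal_in_core (Ordinal r0) [::] cu.
set q := init_trans_word A _ _ in er hq es.
have mu : m <= size u by rewrite size_cat size_nseq leq_addr.
have cq : core_state (q : body A).
  exists (size u); first exact: sync_atW sm.
  exists u => // p; apply: inj; rewrite er; have [c [w <-]] := reach p.
  rewrite -[trans_word _ _]/(rtrans_word _ _) -init_trans_word_cat.
  by have [] := minimal_in_core c w cu.
by exists (exist _ q cq); rewrite // core_stmap.
Qed.

End OneMinimal.

Lemma is_core_spec T : is_core_of g T <-> core_spec g T.
Proof.
split=> [[A [mA rA iso]]|[gT eT]].
  have [gC eC] := minimal_core_spec mA rA.
  by have [gT e] := iso_spec iso gC; split; rewrite // -e.
pose M := min_rtransducer n1 r0 ig.
have mM : minimal M by apply: min_minimal => //; apply: min_finite.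
have rM : represents M g by apply: min_represents.
exists M; split=> //; have [gC eC] := minimal_core_spec mM rM.
by apply: well_reduced_iso; rewrite // eC.
Qed.

Lemma spec_ex : exists T, core_spec g T.
Proof.
have mM : minimal (min_rtransducer n1 r0 ig) by apply: min_minimal => //; apply: min_finite.
by exists (core (body (min_rtransducer n1 r0 ig))); apply: minimal_core_spec mM _; apply: min_represents.
Qed.

End MinimalCore.

Lemma grpB_bisync n r (n1 : 1 < n) (r0 : 0 < r) (g : pnt n r -> pnt n r) :
  @grpB n r g <-> exists g', bisync g g'.
Proof.
split=> [[[cg [h [hK hK' ch]]] [g' [gK gK' fg fg']]]|[g' N]].
  have e : h = g' by apply: funext => z; rewrite -{1}(gK' z) hK.
  exists g'; split; last by split; apply: representable_local_sync.
  split=> //; apply: pcont_ucont; apply/continuous_pcont => //.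
  by rewrite -e.
have [ig ig'] := (bisync_inj N, bisync_inj (bisync_sym N)).
have [[gK gK' ug ug'] [lg lg']] := N.
have cg := ucont_pcont ug; have cg' := ucont_pcont ug'.
split; last by exists g'; split=> //; apply: (@bisync_representable n r).
by split; [|exists g'; split=> //]; apply/continuous_pcont.
Qed.

(** * Changing the number of dotted letters *)

Section Copies.
Context {n r s : nat} (n1 : 1 < n) (r0 : 0 < r) (s0 : 0 < s) {I : Type}.
Context (e : I -> 'I_r -> 'I_s * seq 'I_n) (L : nat).
Hypothesis eL : forall i j, size (e i j).2 <= L.

Definition glue (p : I * pnt n r) : pnt n s :=
  ((e p.1 p.2.1).1, cats (e p.1 p.2.1).2 p.2.2).

Context (D : pnt n s -> I * pnt n r) (DK : cancel D glue) (glueK : cancel glue D).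

(* One copy of [g] for each [i : I], acting on the pieces of C_{n,s} indexed by i. *)
Definition copies (g : pnt n r -> pnt n r) (z : pnt n s) : pnt n s :=
  let p := D z in glue (p.1, g p.2).

(** A word of length at least [L] extends the code word of the piece in which any point of its cone
    lies, so that the whole cone lies in that piece. *)
Lemma D_cats c w : L <= size w ->
  exists i j w', forall x, D (c, cats w x) = (i, (j, cats w' x)).
Proof.
move=> Lw; have [a _] := ord_neq n1.
case: (D (c, cats w (fun=> a))) (DK (c, cats w (fun=> a))) => i [j y] /= [e1 e2].
exists i, j, (drop (size (e i j).2) w) => x.
have [e3 _] := cats_eq_split (leq_trans (eL i j) Lw) e2.
by apply: (can_inj glueK); rewrite DK /glue /= e1 -cats_cat -e3.
Qed.

Lemma copiesK g g' : cancel g g' -> cancel (copies g) (copies g').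
Proof. by move=> gK z; rewrite /copies glueK /= gK -surjective_pairing DK. Qed.

Lemma agree_glue N i z z' : agree N (pletters z) (pletters z') ->
  agree N (pletters (glue (i, z))) (pletters (glue (i, z'))).
Proof.
case: N => [|N] //; case: z => c x; case: z' => d y /agree_plettersS[-> h].
by apply/agree_plettersS; split=> //=; apply: agreeW (agree_cats h); rewrite leq_addl.
Qed.

Lemma copies_ucont g : ucont g -> ucont (copies g).
Proof.
move=> ug N; have [K hK] := ug N; exists (L + K).+1 => -[c x] [d y].
case/agree_plettersS => <-{d} h.
have [w [sw ex ey]] : exists w, [/\ size w = L, x = cats w (drops L x) & y = cats w (drops L y)].
  by apply: agree_split; apply: agreeW h; rewrite leq_addr.
rewrite ex ey -{1}sw in h; move/agree_catsE: h => h.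
have [i [j [w' eD]]] := D_cats c (eq_leq (esym sw)).
rewrite ex ey /copies !eD /=; apply: agree_glue; apply: hK.
apply: (agreeW (leqnSn K)); apply/agree_plettersS; split=> //.
by apply: agreeW (agree_cats h); rewrite leq_addl.
Qed.

Lemma copies_in_core g u v F : in_core g v F -> L <= size u ->
  in_core (copies g) (u ++ v) F.
Proof.
move=> [rF l] Lu; split=> // c w.
have [|i [j [w' eD]]] := @D_cats c (w ++ u); first by rewrite size_cat (leq_trans Lu) ?leq_addl.
have [d [mu h]] := l j w'.
exists (e i d).1, ((e i d).2 ++ mu) => x.
by rewrite catA cats_cat /copies eD /= -cats_cat h /glue /= cats_cat.
Qed.

Lemma copies_local_sync g : injective g -> local_sync g -> local_sync (copies g).
Proof.
move=> ig lg; have [m hm] := local_sync_core n1 r0 ig lg.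
apply: (@core_local_sync _ _ _ (L + m)) => v sv.
have [|F cF] := hm (drop L v); first by rewrite size_drop sv addKn.
exists F; rewrite -(cat_take_drop L v); apply: copies_in_core => //.
by rewrite size_takel // sv leq_addr.
Qed.

Lemma copies_germs g : injective g -> local_sync g -> germs (copies g) = germs g.
Proof.
move=> ig lg; have [m hm] := local_sync_core n1 r0 ig lg.
have [a _] := ord_neq n1; pose u := nseq L a.
have Lu : L <= size u by rewrite size_nseq.
apply/seteqP; split=> F [v cF]; last by exists (u ++ v); apply: copies_in_core.
have [|F' cF'] := hm (nseq m a ++ v); first by rewrite size_cat size_nseq leq_addr.
exists (nseq m a ++ v).
have := copies_in_core cF' Lu; rewrite catA => c1.
by rewrite -(in_core_uniq s0 c1 (in_core_catl _ cF)).
Qed.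

Lemma copies_bisync g g' : bisync g g' -> bisync (copies g) (copies g').
Proof.
move=> N; have [ig ig'] := (bisync_inj N, bisync_inj (bisync_sym N)).
have [[gK gK' ug ug'] [lg lg']] := N.
split; last by split; apply: copies_local_sync.
by split; [exact: copiesK|exact: copiesK|exact: copies_ucont|exact: copies_ucont].
Qed.

End Copies.

(* The n - 1 copies of C_{n,r} are glued along a complete prefix code: for the
   copy i, the piece j < r - 1 goes to the cone of 0^j (i + 1) in the first
   dotted letter; the last pieces go to the cone of 0^(r-1) in the first dotted
   letter, and to the other dotted letters. *)
Section Pieces.
Context (s r : nat).

Definition piece (i : 'I_s.+1) (j : 'I_r) : 'I_s.+1 * seq 'I_s.+2 :=
  if j.+1 < r then (ord0, nseq j ord0 ++ [:: lift ord0 i])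
  else if i == ord0 then (ord0, nseq r.-1 ord0) else (i, [::]).

Lemma size_piece i j : size (piece i j).2 <= r.
Proof.
rewrite /piece; case: ifP => h /=; first by rewrite size_cat size_nseq addn1.
by case: ifP => //= _; rewrite size_nseq leq_pred.
Qed.

Lemma cats_nseq (a : 'I_s.+2) k (x : nat -> 'I_s.+2) :
  (forall l, l < k -> x l = a) -> x = cats (nseq k a) (drops k x).
Proof.
move=> h; have := @prefix_split _ (nseq k a) x; rewrite size_nseq; apply.
apply: (@eq_from_nth _ a); rewrite size_mkseq ?size_nseq // => l lk.
by rewrite nth_mkseq // nth_nseq lk h.
Qed.

Lemma piece_zero k j (b : 'I_s.+2) (x : nat -> 'I_s.+2) : k < j ->
  cats (nseq j ord0 ++ [:: b]) x k = ord0.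
Proof. by move=> h; rewrite cats_cat (cats_lt _ ord0) ?size_nseq // nth_nseq h. Qed.

Lemma piece_mark j (b : 'I_s.+2) (x : nat -> 'I_s.+2) :
  cats (nseq j ord0 ++ [:: b]) x j = b.
Proof.
by have := cats_size (nseq j ord0) (cats [:: b] x); rewrite size_nseq -cats_cat.
Qed.

(** Pieces marked by a nonzero letter at distinct places differ at the first of these places, where
    one of them has 0; a mark also lies within the range of the block of [r.-1] zeros. *)
Lemma piece_inj : injective (glue (n := s.+2) piece).
Proof.
move=> [i [j x]] [i' [j' x']]; rewrite /glue /piece /=.
have last (k k' : 'I_r) : ~~ (k.+1 < r) -> ~~ (k'.+1 < r) -> k = k'.
  rewrite -!leqNgt => h h'; apply: val_inj => /=.
  by have := ltn_ord k; have := ltn_ord k'; lia.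
have liftn0 (k : 'I_s.+1) : lift ord0 k <> ord0 :> 'I_s.+2 by [].
have mixed (k k' : 'I_r) (a : 'I_s.+1) (y y' : nat -> 'I_s.+2) : k.+1 < r ->
    cats (nseq k ord0 ++ [:: lift ord0 a]) y = cats (nseq r.-1 ord0) y' -> False.
  move=> kr /(congr1 (@^~ (val k))); rewrite piece_mark.
  have kk : k < r.-1 by rewrite -ltnS prednK // (leq_trans _ kr).
  by rewrite (cats_lt _ ord0) ?size_nseq // nth_nseq kk => /liftn0.
case: (boolP (j.+1 < r)) => hj; case: (boolP (j'.+1 < r)) => hj' /=.
- case=> ex; have h (k k' : 'I_r) (a a' : 'I_s.+1) (y y' : nat -> 'I_s.+2) : k < k' ->
      cats (nseq k ord0 ++ [:: lift ord0 a]) y = cats (nseq k' ord0 ++ [:: lift ord0 a']) y' ->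
      False.
    by move=> kk /(congr1 (@^~ (val k))); rewrite piece_mark piece_zero // => /liftn0.
  have ej : j = j'.
    apply: val_inj; case: (ltngtP j j') => //= lt; first by case: (h _ _ _ _ _ _ lt ex).
    by case: (h _ _ _ _ _ _ lt (esym ex)).
  subst j'; have := congr1 (@^~ (val j)) ex; rewrite !piece_mark => /lift_inj ei.
  by subst i'; move/cats_inj: ex => ->.
- case: (eqVneq i' ord0) => [_ [] /(mixed _ j) //|ne /= [e0 _]].
  by rewrite -e0 eqxx in ne.
- case: (eqVneq i ord0) => [_ [] /esym /(mixed _ j) //|ne /= [e0 _]].
  by rewrite e0 eqxx in ne.
rewrite (last j j' hj hj').
case: (eqVneq i ord0) => [->|ne]; case: (eqVneq i' ord0) => [->|ne'] /= [].
- by move/cats_inj => ->.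
- by move=> e0; rewrite -e0 eqxx in ne'.
- by move=> e0; rewrite e0 eqxx in ne.
- by rewrite !cats_nil => -> ->.
Qed.

(** In the first dotted letter, the piece is read off from the first nonzero letter among the first
    [r.-1], and it is the last piece if there is none. *)
Lemma piece_surj (r0 : 0 < r) (z : pnt s.+2 s.+1) : exists p, glue piece p = z.
Proof.
case: z => c x.
have rl : r.-1 < r by rewrite prednK.
have nl : (Ordinal rl).+1 < r = false by rewrite /= prednK // ltnn.
have [c0|nc] := eqVneq c ord0; last first.
  by exists (c, (Ordinal rl, x)); rewrite /glue /piece nl (negbTE nc) /= cats_nil.
subst c; case: (pselect (exists k, (k < r.-1) && (x k != ord0))) => [ex|no].
  case: (ex_minnP ex) => k /andP[kr xk] min.
  have [i ei] : exists i, x k = lift ord0 i.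
    by case: (unliftP ord0 (x k)) xk => [i ->|->]; [exists i|rewrite eqxx].
  have kr' : k < r by lia.
  exists (i, (Ordinal kr', drops k.+1 x)); rewrite /glue /piece /=.
  have -> : k.+1 < r by lia.
  congr pair; rewrite /= cats_cat [RHS](@cats_nseq ord0 k) => [|l lk]; last first.
    apply/eqP; apply: contraT => nl'; have := min l; rewrite nl' andbT => h.
    by have := h (ltn_trans lk kr); rewrite leqNgt lk.
  congr cats; apply: funext => -[|l]; rewrite /cats /drops /= ?addn0 ?ei // subSS subn0 nth_nil.
  by rewrite addSnnS.
exists (ord0, (Ordinal rl, drops r.-1 x)); rewrite /glue /piece nl /=.
rewrite -cats_nseq // => l lk; apply: contrapT => h; apply: no.
by exists l; rewrite lk /=; apply/eqP.
Qed.

End Pieces.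

Lemma bisync_same_rank n r (n1 : 1 < n) (r0 : 0 < r) (g g' : pnt n r -> pnt n r) :
  bisync g g' -> exists h h' : pnt n n.-1 -> pnt n n.-1,
    bisync h h' /\ germs h = germs g.
Proof.
case: n n1 g g' => [|[|s]] // n1 g g' N.
have [D DK] := choice (@piece_surj s r r0).
have glueK : cancel (glue (n := s.+2) (@piece s r)) D.
  by move=> p; apply: piece_inj; rewrite DK.
exists (copies (@piece s r) D g), (copies (@piece s r) D g'); split.
  exact: (copies_bisync n1 r0 (@size_piece s r) DK glueK).
have [ig [_ [lg _]]] := (bisync_inj N, N).
exact: (copies_germs n1 r0 _ (@size_piece s r) DK glueK).
Qed.

(** * Group laws *)

Lemma is_core_bisync n r (n1 : 1 < n) (r0 : 0 < r) (g g' : pnt n r -> pnt n r) T :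
  bisync g g' -> @is_core_of n r g T <-> core_spec g T.
Proof.
move=> N; apply: is_core_spec => //; first exact: bisync_inj N.
  by case: N => -[_ _ /ucont_pcont].
by case: N => _ [].
Qed.

Lemma bisync_spec_ex n r (n1 : 1 < n) (r0 : 0 < r) (g g' : pnt n r -> pnt n r) :
  bisync g g' -> exists T, core_spec g T.
Proof.
move=> N; apply: spec_ex => //; first exact: bisync_inj N.
  by case: N => -[_ _ /ucont_pcont].
by case: N => _ [].
Qed.

Section Group.
Context {n : nat} (n1 : 1 < n).
Implicit Types (T : transducer n).

Let p0 : 0 < n.-1. Proof. by case: (n) n1 => [|[]]. Qed.

Lemma spec_grpOr r (g g' : pnt n r -> pnt n r) T : 0 < r -> bisync g g' -> core_spec g T ->
  @grpB n r g /\ @is_core_of n r g T.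
Proof.
move=> r0 N sT; split; first by apply/grpB_bisync => //; exists g'.
by apply/(is_core_bisync n1 r0 _ N).
Qed.

Lemma spec_grpO r (g g' : pnt n r -> pnt n r) T : 1 <= r < n -> bisync g g' -> core_spec g T ->
  grpO n T.
Proof.
move=> hr N sT; exists r => //; have [|bg cg] := spec_grpOr _ N sT; first by case/andP: hr.
by exists g.
Qed.

Lemma grpO_spec T : grpO n T ->
  exists h h' : pnt n n.-1 -> pnt n n.-1, bisync h h' /\ core_spec h T.
Proof.
move=> [r /andP[r0 _] [g /(grpB_bisync n1 r0)[g' N] /(is_core_bisync n1 r0 _ N)[gT eT]]].
have [h [h' [Nh e]]] := bisync_same_rank n1 r0 N.
by exists h, h'; split=> //; split; rewrite // e.
Qed.

Lemma grpO_intro (h h' : pnt n n.-1 -> pnt n n.-1) T : bisync h h' -> core_spec h T -> grpO n T.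
Proof. by apply: spec_grpO; lia. Qed.

Lemma spec_iso r (g : pnt n r -> pnt n r) T1 T2 : core_spec g T1 -> core_spec g T2 -> strong_iso T1 T2.
Proof. by move=> [g1 e1] [g2 e2]; apply: well_reduced_iso; rewrite // e1. Qed.

Lemma spec_id_rank r s T : 0 < r -> 0 < s ->
  core_spec (id : pnt n r -> pnt n r) T -> core_spec (id : pnt n s -> pnt n s) T.
Proof. by move=> r0 s0 [gT e]; split; rewrite // e !germs_id. Qed.

Lemma identity_spec (G : set (transducer n)) E : G `<=` grpO n -> G E ->
  core_spec (id : pnt n n.-1 -> pnt n n.-1) E -> is_identity G E.
Proof.
move=> GO GE sE; split=> // T /GO/grpO_spec[h [h' [N sT]]].
have Ni := @bisync_id n n.-1.
split; [have := mulT_spec n1 p0 Ni N sE sT | have := mulT_spec n1 p0 N Ni sT sE].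
  by move=> sM; apply: spec_iso sT.
by move=> sM; apply: spec_iso sT.
Qed.

(** The product of [T] and [E] is isomorphic to [E] and to [T]. *)
Lemma identity_uniq E T : core_spec (id : pnt n n.-1 -> pnt n n.-1) E ->
  is_identity (grpO n) T -> core_spec (id : pnt n n.-1 -> pnt n n.-1) T.
Proof.
move=> sE [OT idT]; have OE := grpO_intro (@bisync_id n n.-1) sE.
have [_ i1] := idT E OE.
have [_ /(_ T OT)[_ i2]] := identity_spec (fun _ h => h) OE sE.
have [i3 _] := idT E OE.
have [_ /(_ T OT)[_ i4]] := identity_spec (fun _ h => h) OE sE.
have iso : strong_iso E T by apply: strong_iso_trans i4; apply: strong_iso_sym i3.
have [gE eE] := sE; have [gT e] := iso_spec iso gE.
by split; rewrite // -e.
Qed.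

Lemma powT_spec (r : nat) (g g' : pnt n r -> pnt n r) T k : 0 < r -> bisync g g' -> core_spec g T ->
  exists g'', bisync (iter k.+1 g) g'' /\ core_spec (iter k.+1 g) (powT T k.+1).
Proof.
move=> r0 N sT; elim: k => [|k [g'' [Nk sk]]]; first by exists g'.
have e : iter k.+2 g = iter k.+1 g \o g by apply: funext => z; rewrite iterSr.
exists (g' \o g''); rewrite e; split; first exact: (bisync_comp n1 r0 N Nk).
exact: (mulT_spec n1 r0 N Nk sT sk).
Qed.

(** The obstruction used for infinite order: some positive power would act on all small cones by a
    mere change of prefix. *)
Lemma finite_order_germs r (g g' : pnt n r -> pnt n r) T : 0 < r -> bisync g g' -> core_spec g T ->
  finite_order (grpO n) T -> exists k m, 0 < k /\ forall c v, size v = m ->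
  exists d mu, local_at (iter k g) c v d mu id.
Proof.
move=> r0 N sT [[|k] // _ idk].
have [E sE] := bisync_spec_ex n1 p0 (@bisync_id n n.-1).
have [_ ek] := identity_uniq sE idk.
have [g'' [Nk [_ ek']]] := powT_spec k r0 N sT.
have [_ [lk _]] := Nk; have [m hm] := local_sync_core n1 r0 (bisync_inj Nk) lk.
exists k.+1, m; split=> // c v sv; have [F cF] := hm v (eq_leq (esym sv)).
have : germs (iter k.+1 g) F by exists v.
rewrite -ek' ek germs_id // => eF.
by have := cF.2 c [::]; rewrite eF.
Qed.

Section Subgroup.
Variables (P : forall r, (pnt n r -> pnt n r) -> Prop) (Q : transducer n -> Prop).
Hypotheses
  (PQ : forall r g g' T, 0 < r -> bisync g g' -> core_spec g T -> @P r g <-> Q T)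
  (Pid : forall r, @P r id)
  (Pcomp : forall r g1 g1' g2 g2', bisync g1 g1' -> bisync g2 g2' ->
     @P r g1 -> P g2 -> P (g2 \o g1))
  (Pinv : forall r g g', bisync g g' -> @P r g -> P g').

(** [P] translates the property [Q] of transducers to maps, where closure is checked after moving to
    C_{n,n-1}. Allowing any [G] between the subset and [grpO n] covers both inclusions of the
    theorem. *)
Lemma subgroup_of (G : set (transducer n)) : G `<=` grpO n ->
  [set T | grpO n T /\ Q T] `<=` G -> subgroup [set T | grpO n T /\ Q T] G.
Proof.
move=> GO SG.
have [E sE] := bisync_spec_ex n1 p0 (@bisync_id n n.-1).
have Sid E' : core_spec (id : pnt n n.-1 -> pnt n n.-1) E' -> grpO n E' /\ Q E'.
  move=> sE'; split; first exact: grpO_intro (@bisync_id n n.-1) sE'.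
  exact/(PQ p0 (@bisync_id n n.-1) sE').
have idS E' : core_spec (id : pnt n n.-1 -> pnt n n.-1) E' -> is_identity G E'.
  by move=> sE'; apply: identity_spec (sE') => //; apply: SG; apply: Sid.
split=> //.
- by exists E; [apply: idS|apply: Sid].
- move=> T1 T2 [/grpO_spec[h1 [h1' [N1 s1]]] q1] [/grpO_spec[h2 [h2' [N2 s2]]] q2].
  have N := bisync_comp n1 p0 N1 N2; have s := mulT_spec n1 p0 N1 N2 s1 s2.
  split; first exact: (grpO_intro N s).
  apply/(PQ p0 N s); apply: (Pcomp N1 N2); [exact/(PQ p0 N1 s1)|exact/(PQ p0 N2 s2)].
- move=> T [/grpO_spec[h [h' [N s]]] q]; have N' := bisync_sym N.
  have [T' s'] := bisync_spec_ex n1 p0 N'.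
  have [[hK h'K _ _] _] := N.
  exists T'; first split; first exact: (grpO_intro N' s').
    by apply/(PQ p0 N' s'); apply: (Pinv N); apply/(PQ p0 N s).
  split; apply: idS.
    by have := mulT_spec n1 p0 N N' s s'; congr core_spec; apply: funext => z /=; rewrite hK.
  by have := mulT_spec n1 p0 N' N s' s; congr core_spec; apply: funext => z /=; rewrite h'K.
Qed.

End Subgroup.
End Group.

(** * Bi-Lipschitz maps *)

Definition diffat (T : Type) l (x y : nat -> T) := agree l x y /\ x l <> y l.

Section Diffat.
Context {T : Type}.
Implicit Types (x y : nat -> T).

Lemma diffat_ex x y : x <> y -> exists l, diffat l x y.
Proof. by case/neq_diff => l h ne; exists l. Qed.

Lemma diffat_agree l k x y : diffat l x y -> agree k x y -> k <= l.
Proof. by move=> [_ ne] h; rewrite leqNgt; apply/negP => /h. Qed.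

Lemma diffat_lt l k x y : diffat l x y -> ~ agree k x y -> l < k.
Proof.
by move=> [h _] nh; rewrite ltnNge; apply/negP => kl; apply: nh; apply: agreeW h.
Qed.

Lemma diffat_uniq l k x y : diffat l x y -> diffat k x y -> l = k.
Proof.
move=> h h'; apply/eqP; rewrite eqn_leq.
by rewrite (diffat_agree h' h.1) (diffat_agree h h'.1).
Qed.

Lemma diffat_cats w l x y : diffat l x y -> diffat (size w + l) (cats w x) (cats w y).
Proof. by move=> [h ne]; split; [exact: agree_cats | rewrite !cats_add]. Qed.

End Diffat.

Lemma diffat_pletters n r c w l (x y : nat -> 'I_n) : diffat l x y ->
  diffat (size w + l).+1 (pletters ((c, cats w x) : pnt n r)) (pletters ((c, cats w y) : pnt n r)).
Proof.
move=> h; have [h1 h2] := diffat_cats w h.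
by split; [apply/agree_plettersS | move=> /= -[]].
Qed.

(** The bi-Lipschitz condition on exponents: [diffat l] means distance 2^-l, and [K] is the
    logarithm of the constant. *)
Definition bilip n r (g : pnt n r -> pnt n r) := exists K, forall y z l l',
  diffat l (pletters y) (pletters z) -> diffat l' (pletters (g y)) (pletters (g z)) ->
  l <= l' + K /\ l' <= l + K.

Definition bounded_delay n (T : transducer n) := exists K, forall (q : T) w,
  size (output_word w q) <= size w + K /\ size w <= size (output_word w q) + K.

Section Distance.
Import Order.TTheory GRing.Theory Num.Theory.
Variable R : realType.
Context {n r : nat}.
Implicit Types (y z : pnt n r) (g : pnt n r -> pnt n r).

Lemma dist_diffat y z l : diffat l (pletters y) (pletters z) -> @dist R n r y z = (2 ^- l)%R.
Proof.
move=> h; rewrite /dist; case: asboolP => [e|_].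
  by case: h => _; rewrite e.
congr (2 ^- _)%R; rewrite /lcp_length.
set S := [set k | _]; have : S (xget 0 S).
  by apply: (@xgetPex _ 0 S); exists l; case: h => /agreeP h ne.
by move=> [/agreeP h1 h2]; apply: (@diffat_uniq _ _ _ (pletters y) (pletters z)).
Qed.

Lemma dist_refl y : @dist R n r y y = 0%R.
Proof. by rewrite /dist asboolT. Qed.

Lemma pow2_ratio (C : R) : (0 < C)%R ->
  exists K, forall l l', (2 ^- l' <= C * 2 ^- l :> R)%R -> l <= l' + K.
Proof.
move=> C0; have [K hK] : exists K, (C < 2 ^+ K)%R.
  have /archi_boundP := ltW C0; set N := Num.bound C => h.
  by exists N; apply: lt_trans h _; rewrite -natrX ltr_nat ltn_expl.
exists K => l l'; rewrite ler_pdivlMr ?exprn_gt0 // mulrC.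
rewrite ler_pdivrMr ?exprn_gt0 // => h.
have : (2 ^+ l < 2 ^+ (K + l') :> R)%R.
  by apply: le_lt_trans h _; rewrite exprD ltr_pM2r // exprn_gt0.
by rewrite ltr_eXn2l ?ltr1n // => /ltnW; rewrite addnC.
Qed.

Lemma bi_lipschitz_bilip g : @bi_lipschitz R n r g -> bilip g.
Proof.
move=> [C C0 h]; have [K hK] := pow2_ratio C0; exists K => y z l l' d d'.
have := h y z; rewrite (dist_diffat d) (dist_diffat d') => /andP[h1 h2].
split; apply: hK => //; by rewrite -ler_pdivrMl.
Qed.

Lemma bilip_bi_lipschitz g : injective g -> bilip g -> @bi_lipschitz R n r g.
Proof.
move=> ig [K hK]; exists (2 ^+ K)%R; first by rewrite exprn_gt0.
move=> y z; have [->|ne] := pselect (y = z); first by rewrite !dist_refl !mulr0 lexx.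
have [l d] : exists l, diffat l (pletters y) (pletters z) by apply: diffat_ex => /pletters_inj.
have [l' d'] : exists l, diffat l (pletters (g y)) (pletters (g z)).
  by apply: diffat_ex => /pletters_inj /ig.
have [h1 h2] := hK _ _ _ _ d d'; rewrite (dist_diffat d) (dist_diffat d').
have mono a b : a <= b + K -> (2 ^- b <= 2 ^+ K * 2 ^- a :> R)%R.
  move=> h; rewrite ler_pdivlMr ?exprn_gt0 // mulrC ler_pdivrMr ?exprn_gt0 //.
  by rewrite -exprD ler_eXn2l ?ltr1n // addnC.
by rewrite ler_pdivrMl ?exprn_gt0 // !mono.
Qed.

End Distance.

Section Bilip.
Context {n : nat}.

Lemma bilip_id r : bilip (id : pnt n r -> pnt n r).
Proof. by exists 0 => y z l l' h h'; rewrite (diffat_uniq h h') addn0. Qed.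

Lemma bilip_comp r (g1 g1' g2 g2' : pnt n r -> pnt n r) : bisync g1 g1' -> bisync g2 g2' ->
  bilip g1 -> bilip g2 -> bilip (g2 \o g1).
Proof.
move=> N1 _ [K hK] [L hL]; exists (K + L) => y z l l' h h'.
have [k hk] : exists k, diffat k (pletters (g1 y)) (pletters (g1 z)).
  apply: diffat_ex => /pletters_inj /(bisync_inj N1) e.
  by case: h => _; rewrite e.
by have := hK _ _ _ _ h hk; have := hL _ _ _ _ hk h'; lia.
Qed.

Lemma bilip_inv r (g g' : pnt n r -> pnt n r) : bisync g g' -> bilip g -> bilip g'.
Proof.
move=> [[_ g'K _ _] _] [K hK]; exists K => y z l l' h h'.
by have [] := hK (g' y) (g' z) l' l h'; rewrite ?g'K.
Qed.

Hypothesis n1 : 1 < n.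

Section Core.
Context {r : nat} (r0 : 0 < r) (g g' : pnt n r -> pnt n r) (T : transducer n).
Hypotheses (N : bisync g g') (sT : core_spec g T).

(** Each state map is the germ at a word of length exactly [m], obtained by padding a word of the
    state on the left and keeping the last [m] letters. *)
Lemma state_word : exists m M,
  (forall v, size v = m -> exists F, in_core g v F /\
    forall c, exists d mu, local_at g c v d mu F /\ size mu <= M) /\
  forall q : T, exists v, size v = m /\ in_core g v (stmap q).
Proof.
have ig := bisync_inj N; have [[_ _ ug _] [lg _]] := N; have [a _] := ord_neq n1.
have [m hm] := local_sync_core n1 r0 ig lg.
have [M hM] := @core_mu_bound n r g m (fun v e => hm v (eq_leq (esym e))).
exists m, M; split=> // q; have [v cv] : germs g (stmap q) by rewrite -sT.2; exists q.
pose u := nseq m a ++ v; have mu : m <= size u by rewrite size_cat size_nseq leq_addr.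
have su : size (drop (size u - m) u) = m by rewrite size_drop subKn.
have [F cF] := hm _ (eq_leq (esym su)); exists (drop (size u - m) u); split=> //.
have := in_core_catl (take (size u - m) u) cF; rewrite cat_take_drop => cu.
by rewrite (in_core_uniq r0 (in_core_catl (nseq m a) cv) cu).
Qed.

(** Two points that part right after a word have images that agree on all that is written for this
    word; how much further the images agree is bounded by uniform continuity of the inverse. *)
Lemma bilip_bounded : bilip g <-> bounded_delay T.
Proof.
have [m [M [hM sw]]] := state_word.
have ig := bisync_inj N; have [[gK _ ug ug'] [lg _]] := N.
have [[inf red inj] eT] := sT; have [a [b ab]] := ord_neq n1.
pose c0 := Ordinal r0.
have loc0 (q : T) : exists v d mu, [/\ size v = m,
    forall w, local_at g c0 (v ++ w) d (mu ++ output_word w q) (stmap (trans_word w q))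
    & size mu <= M].
  have [v [sv cv]] := sw q; have [F [cF hF]] := hM v sv.
  have [d [mu [l lM]]] := hF c0; exists v, d, mu; split=> // w.
  apply: local_cat l _ => x; rewrite (in_core_uniq r0 cF cv).
  exact: stmap_cat.
split=> [[K hK]|[K hK]].
  exists (m + M + K) => q w; have [v [d [mu [sv l sM]]]] := loc0 q.
  (* Inputs that part right after [v ++ w] show that the output is not too long; below, inputs whose
     images part right after the output show that it is not too short. *)
  have D0 : diffat 0 (fun=> a) (fun=> b) by [].
  have im x y k : diffat k (stmap (trans_word w q) x) (stmap (trans_word w q) y) ->
      diffat (size mu + size (output_word w q) + k).+1
        (pletters (g (c0, cats (v ++ w) x))) (pletters (g (c0, cats (v ++ w) y))).
    by move=> h; rewrite !l -size_cat; apply: diffat_pletters.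
  split.
    have [k hk] : exists k, diffat k (stmap (trans_word w q) (fun=> a))
        (stmap (trans_word w q) (fun=> b)).
      apply: diffat_ex => /(spec_inj r0 ig sT) /(congr1 (@^~ 0)) //.
    have := hK _ _ _ _ (diffat_pletters c0 (v ++ w) D0) (im _ _ _ hk).
    rewrite size_cat; lia.
  have [x [y ne]] := red (trans_word w q).
  have [k hk] : exists k, diffat k x y.
    by apply: diffat_ex => e; apply: ne; rewrite e.
  have := hK _ _ _ _ (diffat_pletters c0 (v ++ w) hk) (im x y 0 (conj _ ne)).
  rewrite size_cat => h; have {}h := h (fun i => fun h => False_ind _ (notF h)); lia.
(* [m.+2] counts the dotted letter, a word of length [m] and the letter after it: points that differ
   within this range have images that differ before [N0]. *)
have [N0 hN0] := ug' m.+2.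
have imN y z l' l : diffat l (pletters y) (pletters z) -> l <= m.+1 ->
    diffat l' (pletters (g y)) (pletters (g z)) -> l' < N0.
  move=> h lm h'; apply: diffat_lt h' _ => /hN0; rewrite !gK => h2.
  by have := diffat_agree h h2; lia.
exists (m + N0 + M + K) => -[c x] [d y] l l' h h'.
have [lm|ml] := leqP l m.
  by have := imN _ _ _ _ h (leqW lm) h'; lia.
case: l h ml => [//|l] h ml; have [hl ne] := h; move/agree_plettersS: hl => [e hl].
subst d; have nexy : x l <> y l by move=> e; apply: ne; rewrite /= e.
have [v [sv ex ey]] := agree_split hl.
set x1 := drops l x in ex; set y1 := drops l y in ey.
have nxy : x1 0 <> y1 0 by rewrite /x1 /y1 /drops addn0.
have [F [cF hF]] : exists F, in_core g (take m v) F /\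
    forall c, exists d mu, local_at g c (take m v) d mu F /\ size mu <= M.
  by apply: hM; rewrite size_takel // sv; lia.
have [d [mu [lo sM]]] := hF c.
have [q _ eq] : range (@stmap n T) F by rewrite eT; exists (take m v).
set w := drop m v; have sw' : size w = l - m by rewrite size_drop sv.
have lo' : local_at g c v d (mu ++ output_word w q) (stmap (trans_word w q)).
  rewrite -(cat_take_drop m v); apply: local_cat lo _ => u; rewrite -eq.
  exact: stmap_cat.
set q' := trans_word w q in lo'.
have [k hk] : exists k, diffat k (stmap q' x1) (stmap q' y1).
  by apply: diffat_ex => /(spec_inj r0 ig sT) e; rewrite e in nxy.
(* The map of [q'] also occurs on the cone of a word [v0] of length [m], where the choice of [N0]
   applies to the tails [x1] and [y1]. *)
have kN : k < N0.
  have [v0 [d0 [mu0 [s0 l0 _]]]] := loc0 q'.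
  have {}l0 := l0 [::]; rewrite !cats0 /= in l0.
  have D1 : diffat 0 x1 y1 by [].
  have h0 := diffat_pletters c0 v0 D1; have h1 := diffat_pletters d0 mu0 hk.
  rewrite -!l0 in h1; have := imN _ _ _ _ h0 _ h1; rewrite s0 addn0 => /(_ (leqnn _)).
  lia.
have h1 := diffat_pletters d (mu ++ output_word w q) hk.
rewrite -!lo' -ex -ey in h1.
rewrite (diffat_uniq h' h1) size_cat; have := hK q w; lia.
Qed.

End Core.

(** Bounded delay is a property of [T] alone, so that one [g] with core [T] is bi-Lipschitz only if
    all are. *)
Lemma grpLE (R : realType) : grpL R n = [set T | grpO n T /\ bounded_delay T].
Proof.
apply/seteqP; split=> T /= [OT].
  move=> [r /andP[r0 _] [g [/(grpB_bisync n1 r0)[g' N] lg cg]]]; split=> //.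
  have sT := (is_core_bisync n1 r0 _ N).1 cg.
  by apply/(bilip_bounded r0 N sT); apply: bi_lipschitz_bilip lg.
move=> bT; split=> //; have [r rn [g gB cg]] := OT; exists r => //; exists g.
have /andP[r0 _] := rn; have [g' N] := (grpB_bisync n1 r0 _).1 gB.
have sT := (is_core_bisync n1 r0 _ N).1 cg.
split=> //; apply: bilip_bi_lipschitz; first exact: bisync_inj N.
exact/(bilip_bounded r0 N sT).
Qed.

Lemma subgroup_L (R : realType) : subgroup (grpL R n) (grpO n).
Proof.
rewrite grpLE; apply: (@subgroup_of _ n1 (fun r => @bilip n r)) => //.
- by move=> r g g' T r0 N sT; apply: bilip_bounded N sT.
- exact: bilip_id.
- exact: bilip_comp.
- exact: bilip_inv.
- by move=> T [].
Qed.

End Bilip.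

(** * Synchronous cores *)

Definition bij_isom n (F : smap n) :=
  (forall x y k, agree k (F x) (F y) <-> agree k x y) /\ forall y, exists x, F x = y.

Definition loc_iso n r (g : pnt n r -> pnt n r) := exists m, forall c v, size v = m ->
  exists d mu F, bij_isom F /\ local_at g c v d mu F.

Definition letter_perm n (T : transducer n) :=
  (forall a (q : T), size (output a q) = 1) /\
  forall q : T, injective (fun a => output a q).

Lemma fin_inj_onto (I : finType) (f : I -> I) : injective f -> forall b, exists a, f a = b.
Proof. by move=> /injF_bij[h _ hK] b; exists (h b). Qed.

Lemma fin_onto_inj (I : finType) (f : I -> I) : (forall b, exists a, f a = b) -> injective f.
Proof.
by move=> /choice[h hK]; have [h' h'K hK'] := injF_bij (can_inj hK);
  move=> a b e; rewrite -(hK' a) -(hK' b) -(hK (h' a)) -(hK (h' b)) !hK' e.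
Qed.

Section Isometries.
Context {n : nat} (n1 : 1 < n).
Implicit Types (F : smap n) (u v w : seq 'I_n).

Lemma bij_isom_id : bij_isom (id : smap n).
Proof. by split=> // y; exists y. Qed.

Lemma bij_isom_comp F1 F2 : bij_isom F1 -> bij_isom F2 -> bij_isom (F2 \o F1).
Proof.
move=> [h1 s1] [h2 s2]; split=> [x y k|y].
  exact: iff_trans (h2 _ _ _) (h1 _ _ _).
by have [z <-] := s2 y; have [x <-] := s1 z; exists x.
Qed.

Lemma bij_isom_reduced F : bij_isom F -> reduced F.
Proof.
move=> [h _]; have [a [b ab]] := ord_neq n1; exists (fun=> a), (fun=> b) => e.
by apply: ab; apply: ((h (fun=> a) (fun=> b) 1).1 _ 0) => // -[].
Qed.

Lemma bij_isom_inj F : bij_isom F -> injective F.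
Proof. by move=> [h _] x y e; apply: agree_all => k; apply/h; rewrite e. Qed.

Lemma bij_isom_inv F : bij_isom F -> exists F',
  [/\ bij_isom F', cancel F F' & cancel F' F].
Proof.
move=> iF; have [h /choice[F' F'K]] := iF; exists F'.
have FK : cancel F F' by move=> x; apply: (bij_isom_inj iF); rewrite F'K.
split=> //; split=> [x y k|y]; last by exists (F y).
by rewrite -{2}(F'K x) -{2}(F'K y); apply: iff_sym.
Qed.

Lemma bij_isom_section F w : bij_isom F -> exists w' F',
  [/\ size w' = size w, bij_isom F' & forall x, F (cats w x) = cats w' (F' x)].
Proof.
move=> [h s]; have [a _] := ord_neq n1.
pose z : nat -> 'I_n := fun=> a.
exists (mkseq (F (cats w z)) (size w)), (fun x => drops (size w) (F (cats w x))).
have sz := size_mkseq (F (cats w z)) (size w).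
have e x : F (cats w x) = cats (mkseq (F (cats w z)) (size w)) (drops (size w) (F (cats w x))).
  have /agreeP -> : agree (size w) (F (cats w z)) (F (cats w x)).
    by apply/h; apply: agree_prefix.
  by rewrite cats_mkseq_drops.
split=> //; split=> [x y k|y].
  split=> [hk|hk].
    apply: (@agree_catsE _ k w); apply/h; rewrite (e x) (e y) -{1}sz.
    exact: agree_cats.
  apply: (@agree_catsE _ k (mkseq (F (cats w z)) (size w))); rewrite -e -e sz.
  by apply/h; apply: agree_cats.
have [u eu] := s (cats (mkseq (F (cats w z)) (size w)) y).
have au : agree (size w) (cats w z) u.
  apply/h; have := @agree_prefix _ (mkseq (F (cats w z)) (size w))
    (drops (size w) (F (cats w z))) y.
  by rewrite -e -eu sz.
have ew : u = cats w (drops (size w) u).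
  by apply: prefix_split; move/agreeP: au => <-; rewrite mkseq_cats_size.
exists (drops (size w) u); rewrite -ew eu.
by have := drops_cats (mkseq (F (cats w z)) (size w)) y; rewrite sz.
Qed.

Context {r : nat}.
Implicit Types (g : pnt n r -> pnt n r).

Lemma loc_iso_long g : loc_iso g -> exists m, forall c v, m <= size v ->
  exists d mu F, [/\ bij_isom F, local_at g c v d mu F & size v - m <= size mu].
Proof.
move=> [m hm]; exists m => c v mv.
have [|d [mu [F [iF l]]]] := hm c (take m v); first by rewrite size_takel.
have [w [F' [sw iF' e]]] := bij_isom_section (drop m v) iF.
exists d, (mu ++ w), F'; split=> //.
  by rewrite -(cat_take_drop m v); apply: local_cat l e.
by rewrite size_cat sw size_drop leq_addl.
Qed.

Lemma loc_iso_id : loc_iso (id : pnt n r -> pnt n r).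
Proof. by exists 0 => c v _; exists c, v, id; split=> //; apply: bij_isom_id. Qed.

Lemma loc_iso_comp g1 g2 : loc_iso g1 -> loc_iso g2 -> loc_iso (g2 \o g1).
Proof.
move=> /loc_iso_long[m1 h1] /loc_iso_long[m2 h2]; exists (m1 + m2) => c v sv.
have [|d [mu [F [iF l]]]] := h1 c v; first by rewrite sv leq_addr.
rewrite sv addKn => smu; have [d' [mu' [F' [iF' l' _]]]] := h2 d mu smu.
exists d', mu', (F' \o F); split; first exact: bij_isom_comp.
by move=> x; rewrite /= l l'.
Qed.

(** The prefixes [mu] at the cones of length [m] have length at most [M]; hence a cone of length [M]
    lies in the image of a single one of them, where [F] can be inverted. *)
Lemma loc_iso_inv g g' : cancel g g' -> cancel g' g -> loc_iso g -> loc_iso g'.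
Proof.
move=> gK g'K [m hm]; have [a _] := ord_neq n1.
have [M hM] : exists M, forall v, size v = m -> forall c,
    exists d mu F, [/\ bij_isom F, local_at g c v d mu F & size mu <= M].
  apply: (@word_bound n m (fun v M => forall c,
    exists d mu F, [/\ bij_isom F, local_at g c v d mu F & size mu <= M])).
    move=> w k l kl h c; have [d [mu [F [iF lF s]]]] := h c.
    by exists d, mu, F; split=> //; apply: leq_trans kl.
  move=> v sv; apply: (@fin_bound _ (fun c M =>
    exists d mu F, [/\ bij_isom F, local_at g c v d mu F & size mu <= M])).
    move=> c k l kl [d [mu [F [iF lF s]]]].
    by exists d, mu, F; split=> //; apply: leq_trans kl.
  move=> c; have [d [mu [F [iF lF]]]] := hm c v sv.
  by exists (size mu), d, mu, F.
exists M => d nu snu.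
case: (g' (d, cats nu (fun=> a))) (g'K (d, cats nu (fun=> a))) => c x ex.
have sv := size_mkseq x m; set v := mkseq x m in sv.
have [d' [mu [F [iF l sM]]]] := hM v sv c.
move: ex; rewrite -(cats_mkseq_drops m x) l => -[ed ex].
have [enu eF] := cats_eq_split (leq_trans sM (eq_leq (esym snu))) ex.
have [F' [iF' FK F'K]] := bij_isom_inv iF.
have [w [F2 [_ iF2 e2]]] := bij_isom_section (drop (size mu) nu) iF'.
exists c, (v ++ w), F2; split=> // y.
by apply: (can_inj gK); rewrite g'K cats_cat -e2 l F'K -cats_cat -enu ed.
Qed.

Section Core.
Variables (r0 : 0 < r) (g g' : pnt n r -> pnt n r) (T : transducer n).
Hypotheses (N : bisync g g') (sT : core_spec g T).

Lemma output1_size : (forall a (q : T), size (output a q) = 1) ->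
  forall w (q : T), size (output_word w q) = size w.
Proof. by move=> h; elim=> //= a w IH q; rewrite size_cat h IH. Qed.

Lemma output1_head : (forall a (q : T), size (output a q) = 1) ->
  forall (q : T) x, output (x 0) q = [:: stmap q x 0].
Proof.
move=> h q x; have [[inf _ _] _] := sT.
have {2}-> : x = cats [:: x 0] (drops 1 x) by rewrite -{1}(cats_mkseq_drops 1 x).
rewrite stmap_cat // output_word1.
by have := h (x 0) q; case: (output (x 0) q) => [|b []].
Qed.

(** Until their first difference two inputs reach the same state, which then writes different
    letters. For surjectivity, a word whose output is a prefix of [y] can be extended by a letter,
    and Koenig's lemma gives a preimage. *)
Lemma letter_perm_bij_isom (q : T) : letter_perm T -> bij_isom (stmap q).
Proof.
move=> [h1 hi]; have [[inf _ _] _] := sT; have so := output1_size h1.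
have hd := output1_head h1.
split=> [x y k|y].
  split=> h; last first.
    have [w [sw -> ->]] := agree_split h; rewrite !stmap_cat // -{1}sw -(so w q).
    exact: agree_prefix.
  apply: contrapT => nh; have [l dl] : exists l, diffat l x y.
    by apply: diffat_ex => e; apply: nh; rewrite e.
  have lk := diffat_lt dl nh; have [al ne] := dl.
  have [w [sw ex ey]] := agree_split al.
  have e x1 y1 : x = cats w x1 -> y = cats w y1 -> x1 0 = y1 0.
    move=> e1 e2; have := h _ lk; rewrite e1 e2 !stmap_cat // -sw -(so w q) !cats_size => e.
    by apply: (hi (trans_word w q)); rewrite !hd e.
  by apply: ne; have := e _ _ ex ey; rewrite /drops addn0.
pose P w := output_word w q = mkseq y (size w).
have [w v Pwv|k|x hx] := @koenig n P.
- have := congr1 (take (size w)) Pwv; rewrite output_word_cat size_cat mkseqD.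
  by rewrite -{1}(so w q) take_size_cat // take_size_cat ?size_mkseq.
- elim: k => [|k [w sw Pw]]; first by exists [::].
  pose z := fun a : 'I_n => stmap (trans_word w q) (fun=> a) 0.
  have [a ea] : exists a, z a = y k.
    apply: fin_inj_onto => b b' e; apply: (hi (trans_word w q)).
    by rewrite (hd _ (fun=> b)) (hd _ (fun=> b')) -/(z b) -/(z b') e.
  exists (rcons w a); first by rewrite size_rcons sw.
  rewrite /P -cats1 output_word_cat Pw size_cat addn1 mkseqS sw /= cats0.
  by rewrite (hd _ (fun=> a)) -[stmap _ _ _]/(z a) ea cats1.
exists x; apply: stmap_eq => // k; have := hx k; rewrite /P size_mkseq => e.
by rewrite /= so size_mkseq e.
Qed.

Lemma loc_iso_perm : loc_iso g <-> letter_perm T.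
Proof.
have [[inf red inj] eT] := sT; have ig := bisync_inj N.
split=> [lg|lp]; last first.
  have [m [M [hM _]]] := state_word n1 r0 N sT.
  exists m => c v sv; have [F [cF hF]] := hM v sv.
  have [d [mu [l _]]] := hF c; exists d, mu, F; split=> //.
  have [q _ <-] : range (@stmap n T) F by rewrite eT; exists v.
  exact: letter_perm_bij_isom.
have [m hm] := loc_iso_long lg; have [a0 _] := ord_neq n1.
have iso (q : T) : bij_isom (stmap q).
  have [v cv] : germs g (stmap q) by rewrite -eT; exists q.
  have [|d [mu [F [iF l _]]]] := hm (Ordinal r0) (nseq m a0 ++ v).
    by rewrite size_cat size_nseq leq_addr.
  have [d' [mu' l']] := cv.2 (Ordinal r0) (nseq m a0).
  by have [_ _ <-] := local_uniq l l' (bij_isom_reduced iF) (red q).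
have sec a (q : T) : exists b, output a q = [:: b].
  have [w [F' [sw iF' e]]] := bij_isom_section [:: a] (iso q).
  have [] := well_reduced_det inf red (bij_isom_reduced iF') e; rewrite output_word1 => -> _.
  by case: w sw {e} => [|b []] // _; exists b.
have h1 a (q : T) : size (output a q) = 1 by have [b ->] := sec a q.
split=> // q a b e; have [h _] := iso q.
apply: ((h (fun=> a) (fun=> b) 1).1 _ 0) => // -[|//] _.
by have := output1_head h1 q (fun=> a); rewrite e (output1_head h1 q (fun=> b)) => -[].
Qed.

(** With outputs of one letter, a surjective state permutes the letters, so that the states after it
    are surjective too; and every state can be reached from the given one. *)
Lemma homeo_state_perm : letter_perm T <->
  (forall a (q : T), size (output a q) = 1) /\ exists q : T, homeomorphism (state_map q).
Proof.
have [[inf red inj] eT] := sT; have ig := bisync_inj N.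
split=> [lp|[h1 [q0 [_ [f [_ fK _]]]]]].
  split; first exact: lp.1.
  have [m [M [hM _]]] := state_word n1 r0 N sT; have [a0 _] := ord_neq n1.
  have [|F [cF _]] := hM (nseq m a0); first by rewrite size_nseq.
  have [q _ _] : range (@stmap n T) F by rewrite eT; exists (nseq m a0).
  exists q; have iq := letter_perm_bij_isom q lp.
  have [F' [iF' FK F'K]] := bij_isom_inv iq.
  split; first by apply: continuous_cantor => x k; exists k => y /(iq.1 _ _ _).
  exists F'; split=> //.
  by apply: continuous_cantor => x k; exists k => y /(iF'.1 _ _ _).
split=> // q.
have step (p : T) : (forall y, exists x, stmap p x = y) ->
    injective (fun a => output a p) /\ forall a y, exists x, stmap (trans a p) x = y.
  move=> sp; have ij : injective (fun a => output a p).
    pose z a := stmap p (fun=> a) 0.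
    have oz a : output a p = [:: z a] by apply: (output1_head h1 p (fun=> a)).
    have iz : injective z.
      apply: fin_onto_inj => b; have [x ex] := sp (fun=> b); exists (x 0).
      by have := output1_head h1 p x; rewrite oz ex => -[].
    by move=> a b; rewrite !oz => -[] /iz.
  split=> // a y; have [x ex] := sp (cats (output a p) y).
  have xa : x 0 = a.
    apply: ij; rewrite (output1_head h1 p x) ex.
    by have := h1 a p; case: (output a p) => [|b []].
  have e1 : x = cats [:: a] (drops 1 x) by rewrite -{1}(cats_mkseq_drops 1 x) -xa.
  exists (drops 1 x); apply: (@cats_inj _ (output a p)).
  by rewrite -ex {2}e1 stmap_cat // output_word1.
have all w (p : T) : (forall y, exists x, stmap p x = y) ->
    forall y, exists x, stmap (trans_word w p) x = y.
  by elim: w p => //= a w IH p /step[_ h]; apply: IH.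
have [v cv] : germs g (stmap q) by rewrite -eT; exists q.
have eq : trans_word v q0 = q by apply: inj; apply: (spec_trans r0 q0 sT cv).
apply: (step q _).1; rewrite -eq; apply: all => y; exists (f y).
exact: fK.
Qed.

End Core.
End Isometries.

Lemma grpHE n (n1 : 1 < n) : grpH n = [set T | grpO n T /\ letter_perm T].
Proof.
apply/seteqP; split=> T /=.
  move=> [OT h1 h2]; split=> //; have [h [h' [N sT]]] := grpO_spec n1 OT.
  have p0 : 0 < n.-1 by lia.
  exact/(homeo_state_perm n1 p0 N sT).
move=> [OT lp]; have [h [h' [N sT]]] := grpO_spec n1 OT.
have p0 : 0 < n.-1 by lia.
by have [h1 h2] := (homeo_state_perm n1 p0 N sT).1 lp.
Qed.

Lemma letter_perm_bounded n (T : transducer n) : letter_perm T -> bounded_delay T.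
Proof.
move=> [h1 _]; exists 0 => q w.
have -> : size (output_word w q) = size w by elim: w q => //= a w IH q; rewrite size_cat h1 IH.
by rewrite addn0.
Qed.

Lemma subgroup_H (R : realType) n (n1 : 1 < n) : subgroup (grpH n) (grpL R n).
Proof.
rewrite grpHE //; apply: (@subgroup_of _ n1 (fun r => @loc_iso n r)) => //.
- by move=> r g g' T r0 N sT; apply: loc_iso_perm N sT.
- by move=> r; apply: loc_iso_id.
- by move=> r g1 g1' g2 g2' _ _; apply: loc_iso_comp.
- by move=> r g g' [[gK g'K _ _] _]; apply: loc_iso_inv.
- by rewrite grpLE // => T [].
- by rewrite grpLE // => T [OT lp]; split=> //; apply: letter_perm_bounded.
Qed.

(** * Examples *)

Section Lift.
Context {n : nat}.
Implicit Types (f : smap n).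

Definition lift1 f (z : pnt n 1) : pnt n 1 := (z.1, f z.2).

Definition stream_lip t f := forall k x y, agree (k + t) x y -> agree k (f x) (f y).

Definition stream_ucont f :=
  forall k, exists l, forall x y, agree l x y -> agree k (f x) (f y).

Definition stream_sync f := exists m, forall v, size v = m -> exists F : smap n,
  forall w, exists mu, forall x, f (cats (w ++ v) x) = cats mu (F x).

Lemma stream_lip_ucont t f : stream_lip t f -> stream_ucont f.
Proof. by move=> h k; exists (k + t); apply: h. Qed.

Lemma lift1_ucont f : stream_ucont f -> ucont (lift1 f).
Proof.
move=> h [|k]; first by exists 0.
have [l hl] := h k; exists l.+1 => -[c x] [d y] /agree_plettersS[-> a].
by apply/agree_plettersS; split=> //; apply: hl.
Qed.

Lemma lift1_sync f : stream_sync f -> local_sync (lift1 f).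
Proof.
move=> [m hm]; exists m => v /hm[F hF]; exists F => c w.
by have [mu h] := hF w; exists c, mu => x; rewrite /lift1 /= h.
Qed.

Lemma lift1_bisync f : involutive f -> stream_ucont f -> stream_sync f ->
  bisync (lift1 f) (lift1 f).
Proof.
move=> fK uf sf; have lK : cancel (lift1 f) (lift1 f) by move=> [c x]; rewrite /lift1 /= fK.
split; first by split=> //; apply: lift1_ucont.
by split; apply: lift1_sync.
Qed.

(** As [f] is its own inverse, [key] also applies to the images, and one modulus bounds both
    directions. *)
Lemma lift1_bilip t f : involutive f -> stream_lip t f -> bilip (lift1 f).
Proof.
move=> fK h; exists t => -[c x] [d y] l l'.
have key x1 y1 k k' : diffat k (pletters ((c, x1) : pnt n 1)) (pletters ((d, y1) : pnt n 1)) ->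
    diffat k' (pletters (lift1 f (c, x1))) (pletters (lift1 f (d, y1))) -> k <= k' + t.
  move=> [a _] dk'.
  case: (leqP k t) => [kt|tk]; first by rewrite (leq_trans kt) ?leq_addl.
  have e : (k - t).-1.+1 = k - t by lia.
  suff : agree (k - t) (pletters (lift1 f (c, x1))) (pletters (lift1 f (d, y1))).
    by move/(diffat_agree dk'); lia.
  rewrite -e; have ek : k = ((k - t).-1 + t).+1 by lia.
  rewrite ek in a; move/agree_plettersS: a => [-> a].
  by apply/agree_plettersS; split=> //; apply: h.
move=> dl dl'; split; first exact: key dl dl'.
apply: key dl' _; rewrite /lift1 /= !fK; exact: dl.
Qed.

Lemma lift1_loc_iso f : involutive f -> stream_lip 0 f -> loc_iso (lift1 f).
Proof.
move=> fK h; exists 0 => c [|//] _; exists c, [::], f; split=> [|x]; last by rewrite !cats_nil.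
split=> [x y k|y]; last by exists (f y).
split=> [a|a]; last by apply: h; rewrite addn0.
by rewrite -(fK x) -(fK y); apply: h; rewrite addn0.
Qed.

(* Block codes with anticipation t and memory s; at the first s places, where the
   memory is incomplete, f may be arbitrary. *)
Lemma sliding_sync s t f : 1 < n -> stream_lip t f ->
  (forall w x i, s <= i -> f (cats w x) (size w + i) = f x i) -> stream_sync f.
Proof.
move=> n1 h hs; exists (s + t) => v sv; exists (fun x => drops s (f (cats v x))) => w.
have [a _] := ord_neq n1.
exists (mkseq (f (cats (w ++ v) (fun=> a))) (size w + s)) => x.
rewrite -{1}(cats_mkseq_drops (size w + s) (f (cats (w ++ v) x))).
have /agreeP -> : agree (size w + s) (f (cats (w ++ v) x)) (f (cats (w ++ v) (fun=> a))).
  apply: h; rewrite -addnA -sv -size_cat; exact: agree_prefix.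
congr cats; apply: funext => i.
by rewrite /drops -addnA cats_cat hs // leq_addr.
Qed.

End Lift.

Section Swap.
Context {n : nat}.
Implicit Types (p q a : 'I_n) (x : nat -> 'I_n).

Definition swap p q a := if a == p then q else if a == q then p else a.

Lemma swapK p q : involutive (swap p q).
Proof.
move=> a; rewrite /swap; have [->|ap] := eqVneq a p.
  by have [->|] := eqVneq q p; rewrite ?eqxx.
have [->|aq] := eqVneq a q; first by rewrite eqxx.
by rewrite (negbTE ap) (negbTE aq).
Qed.

Definition swap_when p q (ctx : (nat -> 'I_n) -> nat -> bool) : smap n :=
  fun x i => if ctx x i then swap p q (x i) else x i.

Lemma swap_whenK p q ctx :
  (forall x i, ctx (swap_when p q ctx x) i = ctx x i) -> involutive (swap_when p q ctx).
Proof.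
move=> h x; apply: funext => i; rewrite {1}/swap_when h /swap_when.
by case: (ctx x i); rewrite ?swapK.
Qed.

Lemma swap_when_lip p q ctx t :
  (forall k x y, agree (k.+1 + t) x y -> ctx x k = ctx y k) ->
  stream_lip t (swap_when p q ctx).
Proof.
move=> h k x y a i ik; rewrite /swap_when (h i x y) ?(a i) //; first by lia.
by apply: agreeW a; lia.
Qed.

Lemma swap_when_slide p q ctx s :
  (forall w x i, s <= i -> ctx (cats w x) (size w + i) = ctx x i) ->
  forall w x i, s <= i -> swap_when p q ctx (cats w x) (size w + i) = swap_when p q ctx x i.
Proof. by move=> h w x i si; rewrite /swap_when h // cats_add. Qed.

End Swap.

(** * A bi-Lipschitz element of infinite order *)

Section Particle.
Variable N : nat.
Notation n := N.+2.
Notation l0 := (ord0 : 'I_n).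
Notation l1 := (lift ord0 ord0 : 'I_n).
Implicit Types (x y : nat -> 'I_n).

(** With this context 0100 and 0110 are exchanged, and with the next one 0010 and 0110. *)
Definition ctx_grow x i :=
  if i is k.+2 then [&& x k == l0, x k.+1 == l1 & x k.+3 == l0] else false.

Definition ctx_shrink x i :=
  if i is k.+1 then [&& x k == l0, x k.+2 == l1 & x k.+3 == l0] else false.

Definition grow : smap n := swap_when l0 l1 ctx_grow.
Definition shrink : smap n := swap_when l0 l1 ctx_shrink.

Lemma swap_eq0 (a : 'I_n) : (swap l0 l1 a == l0) = (a == l1).
Proof.
rewrite /swap; case: (eqVneq a l0) => [->//|n0].
by case: (eqVneq a l1) => // _; rewrite (negbTE n0).
Qed.

Lemma swap_eq1 (a : 'I_n) : (swap l0 l1 a == l1) = (a == l0).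
Proof.
rewrite /swap; case: (eqVneq a l0) => [//|n0].
by case: (eqVneq a l1) => [//|n1]; rewrite (negbTE n1).
Qed.

Lemma swap_when01 ctx x i :
  (swap_when l0 l1 ctx x i == l0) = (if ctx x i then x i == l1 else x i == l0) /\
  (swap_when l0 l1 ctx x i == l1) = (if ctx x i then x i == l0 else x i == l1).
Proof. by rewrite /swap_when; case: (ctx x i); rewrite ?swap_eq0 ?swap_eq1. Qed.

Lemma eq01 (a : 'I_n) : (a == l0) && (a == l1) = false.
Proof. by case: eqVneq => // ->. Qed.

(** Simultaneous flips do not disturb each other's contexts. This is a finite check on which letters
    are 0 or 1; the first places are separate cases because no context holds there. *)
Lemma ctx_growK x i : ctx_grow (grow x) i = ctx_grow x i.
Proof.
case: i => [|[|k]] //=; rewrite /grow !(swap_when01 _ _ _).1 !(swap_when01 _ _ _).2.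
move: (eq01 (x k)) (eq01 (x k.+1)) (eq01 (x k.+2)) (eq01 (x k.+3)).
case: k => [|[|k]] /=.
- by do ![case: (_ == _) => //=].
- by do ![case: (_ == _) => //=].
by move: (eq01 (x k.+1)); do ![case: (_ == _) => //=].
Qed.

Lemma ctx_shrinkK x i : ctx_shrink (shrink x) i = ctx_shrink x i.
Proof.
case: i => [|k] //=; rewrite /shrink !(swap_when01 _ _ _).1 !(swap_when01 _ _ _).2.
move: (eq01 (x k)) (eq01 (x k.+1)) (eq01 (x k.+2)) (eq01 (x k.+3)) (eq01 (x k.+4)).
case: k => [|k] /=; first by do ![case: (_ == _) => //=].
by do ![case: (_ == _) => //=].
Qed.

Lemma growK : involutive grow.
Proof. exact/swap_whenK/ctx_growK. Qed.

Lemma shrinkK : involutive shrink.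
Proof. exact/swap_whenK/ctx_shrinkK. Qed.

Lemma grow_lip : stream_lip 1 grow.
Proof. by apply: swap_when_lip => -[|[|k]] x y a //=; rewrite !a; lia. Qed.

Lemma shrink_lip : stream_lip 2 shrink.
Proof. by apply: swap_when_lip => -[|k] x y a //=; rewrite !a; lia. Qed.

Lemma grow_bisync : bisync (lift1 grow) (lift1 grow).
Proof.
apply: lift1_bisync growK (stream_lip_ucont grow_lip) _.
apply: (@sliding_sync _ 2 _ _ (isT : 1 < n) grow_lip); apply: swap_when_slide => w x [|[|k]] // _.
by rewrite /ctx_grow !addnS -!addnS !cats_add.
Qed.

Lemma shrink_bisync : bisync (lift1 shrink) (lift1 shrink).
Proof.
apply: lift1_bisync shrinkK (stream_lip_ucont shrink_lip) _.
apply: (@sliding_sync _ 1 _ _ (isT : 1 < n) shrink_lip); apply: swap_when_slide => w x [|k] // _.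
by rewrite /ctx_shrink !addnS -!addnS !cats_add.
Qed.

Definition ind (p : nat -> bool) : nat -> 'I_n := fun i => if p i then l1 else l0.

Lemma ind0 p i : (ind p i == l0) = ~~ p i.
Proof. by rewrite /ind; case: (p i). Qed.

Lemma ind1 p i : (ind p i == l1) = p i.
Proof. by rewrite /ind; case: (p i). Qed.

Lemma swap_when_ind ctx p i :
  swap_when l0 l1 ctx (ind p) i = if ctx (ind p) i then ind (negb \o p) i else ind p i.
Proof. by rewrite /swap_when /ind /swap /=; case: (ctx _ i) => //; case: (p i). Qed.

Lemma grow_ind p i : grow (ind p) i = if ctx_grow (ind p) i then ind (negb \o p) i else ind p i.
Proof. exact: swap_when_ind. Qed.

Lemma shrink_ind p i :
  shrink (ind p) i = if ctx_shrink (ind p) i then ind (negb \o p) i else ind p i.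
Proof. exact: swap_when_ind. Qed.

Definition single m := ind (fun i => i == m).
Definition double m := ind (fun i => (i == m) || (i == m.+1)).
Definition triple m := ind (fun i => [|| i == m, i == m.+1 | i == m.+2]).

(** [0 < m] leaves room for the 0 that the context requires before the particle. *)
Lemma grow_single m : 0 < m -> grow (single m) = double m.
Proof.
move=> m0; apply: funext => i; rewrite grow_ind; case: i => [|[|k]].
- by rewrite /single /double /ind /= (_ : (0 == m.+1) = false) ?orbF.
- rewrite /single /double /ind /= (_ : (1 == m.+1) = false) ?orbF //; lia.
rewrite /= !ind0 !ind1 /single /double /ind /=.
case: ifP => h; congr (if _ then _ else _); lia.
Qed.

Lemma shrink_double m : 0 < m -> shrink (double m) = single m.+1.
Proof.
move=> m0; apply: funext => i; rewrite shrink_ind; case: i => [|k].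
  rewrite /single /double /ind /= (_ : (0 == m) = false) //; lia.
rewrite /= !ind0 !ind1 /single /double /ind /=.
case: ifP => h; congr (if _ then _ else _); lia.
Qed.

Lemma grow_triple m : 0 < m -> grow (triple m) = triple m.
Proof.
move=> m0; apply: funext => i; rewrite grow_ind; case: i => [|[|k]] //.
rewrite /= !ind0 !ind1 /triple /ind /=.
case: ifP => h; congr (if _ then _ else _); lia.
Qed.

Lemma shrink_triple m : 0 < m -> shrink (triple m) = triple m.
Proof.
move=> m0; apply: funext => i; rewrite shrink_ind; case: i => [|k] //.
rewrite /= !ind0 !ind1 /triple /ind /=.
case: ifP => h; congr (if _ then _ else _); lia.
Qed.

(* The particle 1 is first turned into 11, and then into 01. *)
Definition move_right : pnt n 1 -> pnt n 1 := lift1 shrink \o lift1 grow.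

Lemma move_right_bisync : bisync move_right (lift1 grow \o lift1 shrink).
Proof. by apply: bisync_comp grow_bisync shrink_bisync. Qed.

Lemma move_right_bilip : bilip move_right.
Proof.
apply: (bilip_comp grow_bisync shrink_bisync).
  exact: (lift1_bilip growK grow_lip).
exact: (lift1_bilip shrinkK shrink_lip).
Qed.

Lemma iter_single c m k : 0 < m -> iter k move_right (c, single m) = (c, single (m + k)).
Proof.
move=> m0; elim: k => [|k /= ->]; first by rewrite addn0.
by rewrite /move_right /lift1 /= grow_single ?shrink_double ?addnS // ltn_addr.
Qed.

Lemma iter_triple c m k : 0 < m -> iter k move_right (c, triple m) = (c, triple m).
Proof.
move=> m0; elim: k => [|k /= ->] //.
by rewrite /move_right /lift1 /= grow_triple ?shrink_triple.
Qed.

Lemma ind_shift p m : (forall i, i < m -> ~~ p i) ->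
  ind p = cats (nseq m l0) (ind (fun i => p (m + i))).
Proof.
move=> h; apply: funext => i; have [im|mi] := ltnP i m.
  by rewrite (cats_lt _ l0) ?size_nseq // nth_nseq im /ind (negbTE (h i im)).
by rewrite cats_ge size_nseq // /ind subnKC.
Qed.

Lemma move_right_infinite T : core_spec move_right T -> ~ finite_order (grpO n) T.
Proof.
move=> sT fT.
have [k [m [k0 h]]] := finite_order_germs (isT : 1 < n) (isT : 0 < 1) move_right_bisync sT fT.
have [d [mu l]] := h ord0 (nseq m l0) (size_nseq _ _).
have e1 : single m.+1 = cats (nseq m l0) (single 1).
  rewrite /single (@ind_shift _ m); last by move=> i im; lia.
  by congr cats; apply: funext => i; rewrite /ind; congr (if _ then _ else _); lia.
have e2 : triple m.+1 = cats (nseq m l0) (triple 1).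
  rewrite /triple (@ind_shift _ m); last by move=> i im; lia.
  by congr cats; apply: funext => i; rewrite /ind; congr (if _ then _ else _); lia.
have := l (triple 1); rewrite -e2 iter_triple // => -[_ h2].
have := l (single 1); rewrite -e1 iter_single // => -[_ h1].
have at1 x y i : x = y -> (x i == l1) = (y i == l1) by move->.
(* These places are the two ends of the block 111. Being fixed, it forces [size mu = m], whereas the
   particle moved by [k] forces [size mu = m + k]. *)
have := at1 _ _ (size mu + 1) h1; have := at1 _ _ (size mu + 1) h2.
have := at1 _ _ (size mu + 3) h2; rewrite !cats_add !ind1 /=; lia.
Qed.

End Particle.

Lemma bij_isom_diffat n (F : smap n) l x y : bij_isom F -> diffat l x y -> diffat l (F x) (F y).
Proof.
move=> [h _] d; have [a ne] := d.
have [k dk] : exists k, diffat k (F x) (F y).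
  apply: diffat_ex => e; apply: ne.
  by have /h := (fun i => fun _ : i < l.+1 => congr1 (@^~ i) e); apply.
suff -> : l = k by [].
apply/eqP; rewrite eqn_leq (diffat_agree dk ((h _ _ _).2 a)).
by rewrite (diffat_agree d ((h _ _ _).1 dk.1)).
Qed.

(** After 0^m 0 1, a difference at place [m.+3] already shows at [m.+2], which forces
    [size mu = m.+1]. Inputs that differ right after this word would then have images differing at
    [m.+1], where all have the letter 1. *)
Lemma grow_not_loc_iso N : ~ loc_iso (lift1 (@grow N)).
Proof.
move=> /(loc_iso_long (isT : 1 < N.+2))[m hm].
pose l0 : 'I_N.+2 := ord0; pose l1 : 'I_N.+2 := lift ord0 ord0.
pose v := nseq m l0 ++ [:: l0; l1].
have sv : size v = m.+2 by rewrite size_cat size_nseq addn2.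
have [|d [mu [F [iF l _]]]] := hm ord0 v; first by rewrite sv; lia.
have vm x : cats v x m = l0.
  by rewrite (cats_lt _ l0) ?sv ?ltnS ?leqnSn // nth_cat size_nseq ltnn subnn.
have vm1 x : cats v x m.+1 = l1.
  by rewrite (cats_lt _ l0) ?sv // nth_cat size_nseq ltnNge leqnSn /= subSnn.
have vge x j : cats v x (m.+2 + j) = x j by rewrite -sv cats_add.
have lF x y k : diffat k x y ->
    diffat (size mu + k) (grow (cats v x)) (grow (cats v y)).
  move=> /(bij_isom_diffat iF) /(diffat_cats mu).
  by have := l x; have := l y; rewrite /lift1 /= => -[_ ->] [_ ->].
pose x0 : nat -> 'I_N.+2 := fun=> l0; pose x1 : nat -> 'I_N.+2 := fun=> l1.
pose x01 : nat -> 'I_N.+2 := cats [:: l0] x1.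
have d1 : diffat 1 x0 x01 by split=> [[]|].
have d0 : diffat 0 x0 x1 by [].
have gv x : grow (cats v x) m.+2 = if x 1 == l0 then swap l0 l1 (x 0) else x 0.
  rewrite /grow /swap_when /= vm vm1 !eqxx /=.
  have := vge x 1; have := vge x 0; rewrite addn0 addn1 => -> ->.
  by [].
have dp : diffat m.+2 (grow (cats v x0)) (grow (cats v x01)).
  split; last by rewrite !gv.
  apply: grow_lip; rewrite -sv; apply: agree_cats => -[] //.
have := diffat_uniq dp (lF _ _ _ d1); rewrite addn1 => -[smu].
have := (lF _ _ _ d0).2; rewrite addn0 -smu.
have gm x : grow (cats v x) m.+1 = l1.
  rewrite /grow /swap_when /=; case: (m) vm vm1 => [|m'] vm' vm1' /=; first by [].
  by rewrite vm' andbF.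
by rewrite !gm.
Qed.

(** * A synchronous element of infinite order for n > 2 *)

Section Front.
Variable N : nat.
Notation n := N.+3.
Notation l0 := (ord0 : 'I_n).
Notation l1 := (lift ord0 ord0 : 'I_n).
Notation l2 := (lift ord0 (lift ord0 ord0) : 'I_n).
Implicit Types (x y : nat -> 'I_n).

Definition ctx_after a x i := if i is k.+1 then x k == a else false.

Definition flip01 : smap n := swap_when l0 l1 (ctx_after l2).
Definition flip12 : smap n := swap_when l1 l2 (ctx_after l0).

Lemma flip01K : involutive flip01.
Proof.
apply: swap_whenK => x [|i] //=; rewrite /swap_when.
case: (ctx_after _ _ _) => //; rewrite /swap.
by case: (eqVneq (x i) l0) => [->|] //; case: (eqVneq (x i) l1) => [->|].
Qed.

Lemma flip12K : involutive flip12.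
Proof.
apply: swap_whenK => x [|i] //=; rewrite /swap_when.
case: (ctx_after _ _ _) => //; rewrite /swap.
by case: (eqVneq (x i) l1) => [->|] //; case: (eqVneq (x i) l2) => [->|].
Qed.

Lemma after_lip p q a : stream_lip 0 (swap_when p q (ctx_after a)).
Proof. by apply: swap_when_lip => -[|k] x y h //=; rewrite h; lia. Qed.

Lemma after_sync p q a : stream_sync (swap_when p q (ctx_after a)).
Proof.
apply: (@sliding_sync _ 1 _ _ (isT : 1 < n) (@after_lip _ _ _)).
apply: swap_when_slide => w x [|k] // _.
by rewrite /ctx_after addnS cats_add.
Qed.

Lemma flip01_bisync : bisync (lift1 flip01) (lift1 flip01).
Proof.
exact: (lift1_bisync flip01K (stream_lip_ucont (@after_lip _ _ _)) (@after_sync _ _ _)).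
Qed.

Lemma flip12_bisync : bisync (lift1 flip12) (lift1 flip12).
Proof.
exact: (lift1_bisync flip12K (stream_lip_ucont (@after_lip _ _ _)) (@after_sync _ _ _)).
Qed.

Definition flips : pnt n 1 -> pnt n 1 := lift1 flip12 \o lift1 flip01.

Lemma flips_bisync : bisync flips (lift1 flip01 \o lift1 flip12).
Proof. by apply: (bisync_comp (isT : 1 < n) (isT : 0 < 1)) flip01_bisync flip12_bisync. Qed.

Lemma flips_loc_iso : loc_iso flips.
Proof.
apply: (loc_iso_comp (isT : 1 < n)).
  exact: (lift1_loc_iso flip01K (@after_lip _ _ _)).
exact: (lift1_loc_iso flip12K (@after_lip _ _ _)).
Qed.

(** The two ends of the part of a word outside the letters 1: the right end moves, while the left
    end, in [start], stays. *)
Definition front j x := x j = l2 /\ forall i, j < i -> x i = l1.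
Definition start j x := x j = l2 /\ forall i, i < j -> x i = l1.

Lemma front_uniq j k x : front j x -> front k x -> j = k.
Proof.
move=> [h1 h2] [h3 h4]; case: (ltngtP j k) => // lt.
  by have := h2 _ lt; rewrite h3.
by have := h4 _ lt; rewrite h1.
Qed.

(** From place [j] on, 211 becomes 201 under [flip01], and [flip12] then turns the 1 after the 0
    into 2. *)
Lemma front_flips j x : front j x -> front j.+2 (flip12 (flip01 x)).
Proof.
move=> [xj h].
have e1 : flip01 x j.+1 = l0 by rewrite /flip01 /swap_when /= xj eqxx h.
have e2 i : flip01 x (j.+2 + i) = l1.
  by rewrite /flip01 /swap_when /= !h //; lia.
split=> [|i ji].
  have := e2 0; rewrite addn0 => e20.
  by rewrite /flip12 {1}/swap_when /= -/(flip01 x) e1 eqxx e20.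
have -> : i = (j.+2 + (i - j.+3)).+1 by lia.
rewrite /flip12 {1}/swap_when /= e2 -addnS e2.
by [].
Qed.

Lemma start_flips j x : start j x -> start j (flip12 (flip01 x)).
Proof.
move=> [xj h].
have f1 i : i < j -> flip01 x i = l1.
  move=> ij; rewrite /flip01 /swap_when h //; case: i ij => [|i] ij //=.
  by rewrite h //; lia.
have e1 : flip01 x j = l2.
  by rewrite /flip01 /swap_when xj; case: (ctx_after _ _ _).
split=> [|i ij].
  rewrite /flip12 {1}/swap_when e1; case: (j) f1 => [|k] f1' //=.
  by rewrite f1'.
rewrite /flip12 {1}/swap_when f1 //; case: i ij => [|i] ij //=.
by rewrite f1 //; lia.
Qed.

Lemma const_flips : flip12 (flip01 (fun=> l1)) = (fun=> l1).
Proof.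
have e : flip01 (fun=> l1) = (fun=> l1) by apply: funext => -[].
by rewrite e; apply: funext => -[].
Qed.

(** The fixed word 111... makes all letters of [mu] equal to 1. The image of 1^m 2 1 1 ... has its
    front at [m + k.*2] and at [size mu], so that place [m] lies in [mu]; but the start keeps a 2
    there. *)
Lemma flips_infinite T : core_spec flips T -> ~ finite_order (grpO n) T.
Proof.
move=> sT fT.
have [k [m [k0 h]]] := finite_order_germs (isT : 1 < n) (isT : 0 < 1) flips_bisync sT fT.
have it c x : iter k flips (c, x) = (c, iter k (flip12 \o flip01) x).
  by elim: (k) => //= i ->.
have [d [mu l]] := h ord0 (nseq m l1) (size_nseq _ _).
pose x : nat -> 'I_n := cats [:: l2] (fun=> l1).
have fx : front 0 x by split=> // i i0; rewrite /x cats_ge.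
have nth1 y i : i < m -> cats (nseq m l1) y i = l1.
  by move=> im; rewrite (cats_lt _ l1) ?size_nseq // nth_nseq im.
have atm y i : cats (nseq m l1) y (m + i) = y i.
  by have := cats_add (nseq m l1) y i; rewrite size_nseq.
have fvx : front m (cats (nseq m l1) x).
  split=> [|i mi]; first by have := atm x 0; rewrite addn0.
  by rewrite -(subnKC mi) addSnnS atm fx.2.
have svx : start m (cats (nseq m l1) x).
  by split; [exact: fvx.1|move=> i; apply: nth1].
have c1 : iter k (flip12 \o flip01) (fun=> l1) = (fun=> l1).
  by elim: (k) => //= i ->; apply: const_flips.
have cm : cats (nseq m l1) (fun=> l1) = (fun=> l1).
  by apply: funext => i; case: (ltnP i m) => [/nth1//|im]; rewrite -(subnKC im) atm.
have := l (fun=> l1); rewrite cm it c1 => -[_ emu].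
have mu1 i : i < size mu -> nth l1 mu i = l1.
  by move=> im; rewrite -(cats_lt (fun=> l1) l1 im) -emu.
have := l x; rewrite it => -[_ ex].
have Fk : front (m + k.*2) (iter k (flip12 \o flip01) (cats (nseq m l1) x)).
  by elim: (k) => [|i /= /front_flips]; rewrite ?addn0 // doubleS !addnS.
have Sk : start m (iter k (flip12 \o flip01) (cats (nseq m l1) x)).
  by elim: (k) => [|i /= /start_flips].
have Fmu : front (size mu) (cats mu x).
  split=> [|i mi]; first by rewrite cats_size.
  by rewrite -(subnKC mi) addSnnS cats_add fx.2.
rewrite ex in Fk Sk; have e := front_uniq Fk Fmu.
have [e2 _] := Sk; move: e2; rewrite (cats_lt _ l1) -?e; last by lia.
by rewrite mu1 // -e; lia.
Qed.

End Front.

(** * An involution that is not bi-Lipschitz *)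

Section Tokens.
Variable N : nat.
Notation n := N.+2.
Notation l0 := (ord0 : 'I_n).
Notation l1 := (lift ord0 ord0 : 'I_n).
Implicit Types (x y : nat -> 'I_n).

Variant token_state := Free | One | OneZero.

Definition token_trans (a : 'I_n) q :=
  if a == l1 then One
  else if a == l0 then (if q is One then OneZero else Free) else Free.

Definition token_output (a : 'I_n) q :=
  match q with
  | Free => [:: a]
  | One => if a == l1 then [:: l0; l1] else if a == l0 then [::] else [:: l0; a]
  | OneZero => if a == l0 then [:: l0; l0] else [:: a]
  end.

(* An infinite word is cut at its letters 1 into the tokens 1 0^k, up to the
   other letters; the map exchanges the tokens 1 and 10.  The state [One], resp.
   [OneZero], is reached after 1, resp. 10, of which only 1, which starts the new
   token in all cases, has been written. *)
Definition tokens := @Transducer n token_state token_trans token_output.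

(** Only a 0 read in state [One] writes nothing, and the letter read next, in state [OneZero],
    writes at least one. *)
Lemma tokens_size w (q : tokens) :
  size w <= (size (output_word w q)).*2 + (if q is OneZero then 0 else 1).
Proof.
elim: w q => // a w IH q; rewrite /= size_cat.
have := IH (token_trans a q); rewrite /token_trans /token_output; case: q => /=;
  case: (a == l1); case: (a == l0) => /=; lia.
Qed.

Lemma tokens_infinite : infinite_out tokens.
Proof.
move=> q x i; exists (i.*2.+2).
have := tokens_size (mkseq x i.*2.+2) q; rewrite size_mkseq.
by case: q => /=; lia.
Qed.

Notation f := (@stmap n tokens).

Lemma tokens_step (q : tokens) a x :
  f q (cats [:: a] x) = cats (token_output a q) (f (token_trans a q) x).
Proof. by rewrite (stmap_cat _ _ _ tokens_infinite) output_word1. Qed.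

Lemma split_head x : x = cats [:: x 0] (drops 1 x).
Proof. by rewrite -{1}(cats_mkseq_drops 1 x). Qed.

Lemma cats_cons a w x : cats (a :: w) x = cats [:: a] (cats w x).
Proof. by rewrite -cat1s cats_cat. Qed.

Lemma agree_cons k a x y : agree k x y -> agree k.+1 (cats [:: a] x) (cats [:: a] y).
Proof. exact: (@agree_cats _ k [:: a]). Qed.

(** After a token 10, of which only 1 has been written, the first run is in [OneZero] and the second
    in [One], owing a 0: hence the third claim. *)
Lemma tokens_involution k x : [/\ agree k (f Free (f Free x)) x,
  agree k (f One (f One x)) x & agree k (f One (f OneZero x)) (cats [:: l0] x)].
Proof.
elim: k x => [|k IH] x; first by split.
have n01 : (l0 == l1) = false by [].
have n10 : (l1 == l0) = false by [].
(* On a first letter 0, the second claim reduces to this one without any letter being gained, so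
   that it is needed already at [k.+1]. *)
have third z : agree k.+1 (f One (f OneZero z)) (cats [:: l0] z).
  rewrite (split_head z); move: (z 0) (drops 1 z) => a y.
  have [ef eo _] := IH y.
  rewrite tokens_step /token_output /token_trans.
  case: (eqVneq a l1) => [->|a1].
    rewrite n10 tokens_step /token_output /token_trans eqxx.
    by rewrite cats_cons; apply: agree_cons; apply: (agreeW (leqnSn _)); apply: agree_cons.
  case: (eqVneq a l0) => [->|a0].
    rewrite cats_cons tokens_step /token_output /token_trans n01 eqxx cats_nil.
    rewrite tokens_step /token_output /token_trans n01 eqxx.
    by rewrite cats_cons; apply: agree_cons; apply: (agreeW (leqnSn _)); apply: agree_cons.
  rewrite tokens_step /token_output /token_trans (negbTE a1) (negbTE a0).
  by rewrite cats_cons; apply: agree_cons; apply: (agreeW (leqnSn _)); apply: agree_cons.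
rewrite (split_head x); move: (x 0) (drops 1 x) => a y.
have [ef eo et] := IH y; split=> //.
  rewrite (tokens_step Free a y) (tokens_step Free a) /token_trans.
  by case: (eqVneq a l1) => [->|a1]; rewrite ?if_same; apply: agree_cons.
rewrite (tokens_step One a y) /token_output /token_trans.
case: (eqVneq a l1) => [->|a1].
  rewrite cats_cons (tokens_step One l0) /token_output /token_trans /= cats_nil.
  by rewrite (tokens_step OneZero l1) /token_output /token_trans /=; apply: agree_cons.
case: (eqVneq a l0) => [ea|a0].
  by rewrite cats_nil ea; apply: third.
rewrite cats_cons (tokens_step One l0) /token_output /token_trans /= cats_nil.
rewrite (tokens_step OneZero a) /token_output /token_trans (negbTE a1) (negbTE a0).
exact: agree_cons.
Qed.

Lemma tokensK : involutive (f Free).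
Proof. by move=> x; apply: agree_all => k; have [] := tokens_involution k x. Qed.

Lemma tokens_sync_at a b (p q : tokens) :
  trans_word [:: a; b] p = trans_word [:: a; b] q.
Proof.
rewrite /= /token_trans; case: (b == l1) => //; case: (b == l0) => //.
by case: (a == l1) => //; case: (a == l0) => //; case: p; case: q.
Qed.

Lemma tokens_ucont : stream_ucont (f Free).
Proof.
move=> k; exists k.*2.+2 => x y /agree_split[w [sw -> ->]].
rewrite !stmap_cat; try exact: tokens_infinite.
by apply: agreeW (@agree_prefix _ _ _ _); have := tokens_size w (Free : tokens); rewrite sw /=; lia.
Qed.

Lemma tokens_stream_sync : stream_sync (f Free).
Proof.
exists 2 => -[|a [|b []]] // _; exists (f (trans_word [:: a; b] (Free : tokens))) => w.
exists (output_word (w ++ [:: a; b]) (Free : tokens)) => x.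
rewrite stmap_cat; last exact: tokens_infinite.
by rewrite trans_word_cat (tokens_sync_at a b (trans_word w _) (Free : tokens)).
Qed.

Lemma tokens_bisync : bisync (lift1 (f Free)) (lift1 (f Free)).
Proof. exact: lift1_bisync tokensK tokens_ucont tokens_stream_sync. Qed.

Lemma tokens_ones k : size (output_word (nseq k l1) (One : tokens)) = k.*2.
Proof.
elim: k => // k IH; by rewrite doubleS -IH.
Qed.

Lemma tokens_not_bilip : ~ bilip (lift1 (f Free)).
Proof.
move=> [K hK].
pose x c k : nat -> 'I_n := cats (nseq k.+1 l1) (fun=> c).
have fx c k : f Free (x c k) =
    cats (l1 :: output_word (nseq k l1) (One : tokens)) (f (trans_word (nseq k l1) (One : tokens)) (fun=> c)).
  by rewrite /x stmap_cat; last exact: tokens_infinite.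
(* The inputs part after [k.+1] letters 1, the outputs after at least [k.*2.+1] letters, so that any
   [k] above [K] gives a contradiction. *)
pose k := K.+2.
have d : diffat 0 ((fun=> l0) : nat -> 'I_n) (fun=> l1) by [].
have := diffat_pletters (ord0 : 'I_1) (nseq k.+1 l1) d; rewrite -/(x l0 k) -/(x l1 k) => d1.
have [l dl] : exists l, diffat l (f (trans_word (nseq k l1) (One : tokens)) (fun=> l0))
    (f (trans_word (nseq k l1) (One : tokens)) (fun=> l1)).
  apply: diffat_ex => e; have := fx l0 k; rewrite e -fx.
  by move/(can_inj tokensK)/cats_inj/(congr1 (@^~ 0)).
have := diffat_pletters (ord0 : 'I_1) (l1 :: output_word (nseq k l1) (One : tokens)) dl.
rewrite -!fx => d2; have [_] := hK _ _ _ _ d1 d2.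
rewrite /= size_nseq tokens_ones /k; lia.
Qed.

End Tokens.

(** * The examples as elements of O_n *)

Lemma nonlipschitz_torsion (R : realType) N : exists T : transducer N.+2,
  [/\ grpO N.+2 T, finite_order (grpO N.+2) T & ~ grpL R N.+2 T].
Proof.
have n1 : 1 < N.+2 by []; have r0 : 0 < 1 by [].
have Nt := tokens_bisync N; have [T sT] := bisync_spec_ex n1 r0 Nt.
have O2 : grpO N.+2 T by apply: (spec_grpO n1 _ Nt sT).
exists T; split=> //.
  have := mulT_spec n1 r0 Nt Nt sT sT.
  have -> : lift1 (@stmap _ (tokens N) (Free : tokens N)) \o
      lift1 (@stmap _ (tokens N) (Free : tokens N)) = id.
    by apply: funext => -[c x]; rewrite /lift1 /= tokensK.
  (* The involution lives on C_{n,1}, whereas the identity of O_n is recognized on C_{n,n-1}. *)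
  move=> /(spec_id_rank n1 r0 (isT : 0 < N.+1)) sM; exists 2 => //.
  apply: (identity_spec n1) => //; exact: (grpO_intro n1 (@bisync_id _ _) sM).
rewrite grpLE // => -[_] /(bilip_bounded n1 r0 Nt sT); exact: tokens_not_bilip.
Qed.

Lemma lipschitz_not_synchronous (R : realType) N : exists T : transducer N.+2,
  grpL R N.+2 T /\ ~ grpH N.+2 T.
Proof.
have n1 : 1 < N.+2 by []; have r0 : 0 < 1 by [].
have Ng := grow_bisync N; have [T sT] := bisync_spec_ex n1 r0 Ng; exists T.
rewrite grpLE // grpHE //; split.
  split; first exact: (spec_grpO n1 _ Ng sT).
  apply/(bilip_bounded n1 r0 Ng sT); apply: (lift1_bilip (@growK N) (@grow_lip N)).
by move=> [_ /(loc_iso_perm n1 r0 Ng sT)]; apply: grow_not_loc_iso.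
Qed.

Lemma lipschitz_infinite_order (R : realType) N : exists T : transducer N.+2,
  grpL R N.+2 T /\ ~ finite_order (grpO N.+2) T.
Proof.
have n1 : 1 < N.+2 by []; have r0 : 0 < 1 by [].
have Nm := move_right_bisync N; have [T sT] := bisync_spec_ex n1 r0 Nm; exists T.
rewrite grpLE //; split; last exact: move_right_infinite.
split; first exact: (spec_grpO n1 _ Nm sT).
apply/(bilip_bounded n1 r0 Nm sT); exact: move_right_bilip.
Qed.

Lemma synchronous_infinite_order N : exists T : transducer N.+3,
  grpH N.+3 T /\ ~ finite_order (grpO N.+3) T.
Proof.
have n1 : 1 < N.+3 by []; have r0 : 0 < 1 by [].
have Nf := flips_bisync N; have [T sT] := bisync_spec_ex n1 r0 Nf; exists T.
rewrite grpHE //; split; last exact: flips_infinite.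
split; first exact: (spec_grpO n1 _ Nf sT).
apply/(loc_iso_perm n1 r0 Nf sT); exact: flips_loc_iso.
Qed.

Theorem theorem1p4 (R : realType) (n r : nat)
    (hr : (1 <= r)%N) (hrn : (r < n)%N) :
  (subgroup (grpH n) (grpL R n) /\ subgroup (grpL R n) (grpO n)) /\
  (exists T : transducer n, grpO n T /\ ~ grpL R n T) /\
  (exists T : transducer n, grpL R n T /\ ~ grpH n T) /\
  ((2 < n)%N ->
     exists T : transducer n, grpH n T /\ ~ finite_order (grpO n) T) /\
  (exists T : transducer 2,
     [/\ grpO 2 T, finite_order (grpO 2) T & ~ grpL R 2 T]) /\
  (exists T : transducer 2, grpL R 2 T /\ ~ finite_order (grpO 2) T).
Proof.
have n1 : 1 < n by apply: leq_trans hrn.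
split; first by split; [exact: subgroup_H|exact: subgroup_L].
split; first by case: n n1 {hrn} => [|[|N]] // _;
  have [T [OT _ nL]] := nonlipschitz_torsion R N; exists T.
split; first by case: n n1 {hrn} => [|[|N]] // _; apply: lipschitz_not_synchronous.
split; first by case: n {n1 hrn} => [|[|[|N]]] // _; apply: synchronous_infinite_order.
by split; [apply: nonlipschitz_torsion | apply: lipschitz_infinite_order].
Qed.
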